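(* Let $L'$ be a finite supersolvable lattice of rank $r$ such that $\mu(x,y)\neq0$ whenever $x<y$ in $L'$, let $S\subseteq[r-1]$, let $\lambda$ be an $S_r$-labeling of $L'$, and let $L=L'_S=\{x\in L':\operatorname{rank}(x)\in S\}$. Let $\mathbf c$ be the unique maximal chain of $L'$ with increasing labels (the M-chain), let $\mathbf c_1,\dots,\mathbf c_t$ be all maximal chains of $L'$ with strictly decreasing labels, and let $L_i$ be the sublattice of $L'$ generated by $\mathbf c_i$ and $\mathbf c$ (it is isomorphic to the Boolean lattice $B_r$). For each $i$ let $\mathbf c_i^1,\dots,\mathbf c_i^k$ be all maximal chains of $L_i$ whose $\lambda$-labels have descent set $S$, listed in lexicographic order of their labels ($k$ does not depend on $i$). For each $i,j$, writing $\mathbf c_i^j:\hat 0=x_0<x_1<\dots<x_r=\hat 1$, let $C_i^j$ be the set of maximal chains $\hat 0=y_0<y_1<\dots<y_r=\hat 1$ of $L_i$ with $y_n=x_n$ for all $n\notin S$; let $L_i^j=\{z\in L:z\in\mathbf d\text{ for some }\mathbf d\in C_i^j\}$; let $E_i^j$ be the set of maximal chains of $L_i^j$ that are not maximal chains of any $L_i^m$ with $m<j$ nor of any $L_m^{p}$ with $m<i$ and $1\le p\le k$; and let $\Sigma_i^j$ be the simplicial complex whose facets are the chains in $E_i^j$ (with $\Sigma_i^j=\emptyset$ if $E_i^j=\emptyset$). Then the sequence $$\Sigma_1^1,\Sigma_1^2,\dots,\Sigma_1^k,\Sigma_2^1,\dots,\Sigma_2^k,\dots,\Sigma_t^k,$$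 once all $\Sigma_i^j$ with $\Sigma_i^j=\emptyset$ are eliminated, is a convex-ear decomposition of the order complex $\Delta(L)$.
   Context: A lattice is supersolvable if it has a maximal chain $\mathbf c$ (an M-chain) such that for every (not necessarily maximal) chain $\mathbf d$ the sublattice generated by $\mathbf c$ and $\mathbf d$ is distributive. $\mu$ is the Möbius function: $\mu(x,x)=1$, $\mu(x,y)=-\sum_{x\le z<y}\mu(x,z)$ for $x<y$. The order complex $\Delta(P)$ of a poset $P$ is the simplicial complex whose simplices are the chains of $P$. $[n]=\{1,\dots,n\}$. An EL-labeling of a finite graded poset with $\hat 0$ and $\hat 1$ is a map $\lambda$ from cover relations $(x,y)$ to $\mathbb N$ such that in each interval $[x,y]$ there is a unique saturated chain from $x$ to $y$ whose sequence of labels is weakly increasing, and this label sequence lexicographically precedes that of every other saturated chain from $x$ to $y$. An $S_r$-labeling of a lattice of rank $r$ is an EL-labeling with labels in $[r]$ such that no two edges of a common chain have the same label; every supersolvable lattice of rank $r$ has one. The label of a maximal chain is its sequence of edge labels read upward. The descent set of a word $a_1a_2\cdots a_m$ is $\{i:a_i>a_{i+1}\}$. A sequence of subcomplexes $\Sigma_1,\dots,\Sigma_n$ of a $(d-1)$-dimensional simplicial complex $\Delta$ is a convex-ear decomposition of $\Delta$ if: (i) $\bigcup_{i=1}^n\Sigma_i=\Delta$; (ii) $\Sigma_1$ is the boundary complex of a simplicial $d$-polytope, and for $i>1$, $\Sigma_i$ is a full-dimensional (i.e. $(d-1)$-dimensional) proper subcomplex of the boundary complex of some simplicial $d$-polytope;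 (iii) for $i>1$, $\Sigma_i$ is a simplicial ball; (iv) for $i>1$, $\left(\bigcup_{j=1}^{i-1}\Sigma_j\right)\cap\Sigma_i=\partial\Sigma_i$. (Being a boundary complex, or subcomplex thereof, is meant up to isomorphism.) *)

(* Defs.v *)
From HB Require Import structures.
From mathcomp Require Import all_boot all_order all_algebra.
From mathcomp Require Import all_classical all_reals all_analysis.
Set Implicit Arguments.
Unset Strict Implicit.
Unset Printing Implicit Defensive.
Import Order.TTheory GRing.Theory Num.Theory.
Import numFieldNormedType.Exports.

(** * Finite posets and lattices *)

Section Posets.
Context {disp : Order.disp_t} {T : finPOrderType disp}.
Implicit Types (x y z : T) (A D : {set T}).
Local Open Scope order_scope.

Definition covers x y : bool := (x < y) && [forall z, ~~ (x < z < y)].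

Definition closed_interval x y : {set T} := [set z | x <= z <= y].

Definition is_chain D : bool := [forall x in D, forall y in D, x >=< y].

(* The maximal chains of the subposet A; consecutive elements need not be
   cover relations of T. *)
Definition maxchains A : {set {set T}} :=
  [set D | maxset (fun D' : {set T} => is_chain D' && (D' \subset A)) D].

(* The elements x_0 < x_1 < ... of the chain D. *)
Definition chain_seq D : seq T := sort <=%O (enum D).

Definition graded : bool :=
  [forall D in maxchains [set: T]%SET,
   forall E in maxchains [set: T]%SET, #|D| == #|E|].

Definition rank x : nat :=
  (\max_(D : {set T} | is_chain D && (D \subset [set z | z <= x])) #|D|).-1.

Definition order_complex A : {set {set T}} :=
  [set D | is_chain D && (D \subset A)].

(* The first argument bounds the recursion depth. *)
Fixpoint mobius_rec (n : nat) x y : int :=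
  if x == y then 1%R
  else if n is n'.+1 then
    if x < y then (- \sum_(z : T | (x <= z < y)%O) mobius_rec n' x z)%R
    else 0%R
  else 0%R.

Definition mobius x y : int := mobius_rec #|T| x y.

Lemma mobius_rec_enough (n m : nat) x y :
  (#|[set z | (x <= z < y)%O]%SET| <= n)%N ->
  (#|[set z | (x <= z < y)%O]%SET| <= m)%N ->
  mobius_rec n x y = mobius_rec m x y.
Proof.
have card_gt0 a b : a < b -> (0 < #|[set z | (a <= z < b)%O]%SET|)%N.
  by move=> ab; apply/card_gt0P; exists a; rewrite inE lexx.
elim: n m y => [|n IHn] [|m] y //=; case: (x =P y) => // _.
- by move=> h _; case: ifP => // /card_gt0; rewrite ltnNge h.
- by move=> _ h; case: ifP => // /card_gt0; rewrite ltnNge h.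
move=> hn hm; case: ifP => // xy; congr (- _)%R.
apply: eq_bigr => z /andP[xz zy].
have lt_card : (#|[set w | (x <= w < z)%O]%SET| <
                #|[set w | (x <= w < y)%O]%SET|)%N.
  apply: proper_card; apply/properP; split; last first.
    by exists z; rewrite inE ?ltxx ?andbF // xz.
  by apply/fintype.subsetP => w; rewrite !inE => /andP[-> /lt_trans->].
by apply: IHn; rewrite -ltnS (leq_trans lt_card).
Qed.

Lemma mobiusxx x : mobius x x = 1%R.
Proof. by rewrite /mobius; case: #|T| => [|n] /=; rewrite eqxx. Qed.

Lemma mobius_lt x y : x < y ->
  mobius x y = (- \sum_(z : T | (x <= z < y)%O) mobius x z)%R.
Proof.
move=> xy; rewrite /mobius.
rewrite (@mobius_rec_enough _ #|T|.+1) ?max_card //; last exact/leqW/max_card.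
by rewrite /= xy (lt_eqF xy).
Qed.

Section Labelings.
Variable lam : T -> T -> nat.

(* The label of a saturated chain, read upward. *)
Definition labels D : seq nat :=
  if chain_seq D is x :: s then pairmap lam x s else [::].

Definition lex_le D E : bool :=
  ((labels D : seqlexi nat) <= (labels E : seqlexi nat)).
Definition lex_lt D E : bool :=
  ((labels D : seqlexi nat) < (labels E : seqlexi nat)).

Definition EL_labeling : Prop :=
  graded /\
  forall x y, x <= y ->
    exists D, [/\ D \in maxchains (closed_interval x y),
                  sorted leq (labels D),
                  forall E, E \in maxchains (closed_interval x y) ->
                    sorted leq (labels E) -> E = D
                & forall E, E \in maxchains (closed_interval x y) -> E != D ->
                    lex_lt D E].

Definition S_labeling (r : nat) : Prop :=
  [/\ EL_labeling,
      forall x y, covers x y -> (1 <= lam x y <= r)%N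
    & forall D, D \in maxchains [set: T]%SET -> uniq (labels D)].

End Labelings.
End Posets.

(* Positions in the word a_1 ... a_m start at 1. *)
Definition descents (a : seq nat) : seq nat :=
  [seq i <- iota 1 (size a).-1 | nth 0 a i < nth 0 a i.-1].

Definition has_descent_set (S : {pred nat}) (a : seq nat) : bool :=
  [seq i <- iota 1 (size a).-1 | i \in S] == descents a.

Section Lattices.
Context {disp : Order.disp_t} {T : finTBLatticeType disp}.
Implicit Types (x y z : T) (A D : {set T}).
Local Open Scope order_scope.

Definition is_sublattice A : bool :=
  [forall x in A, forall y in A, (x `&` y \in A) && (x `|` y \in A)].

Definition generated A : {set T} :=
  \bigcap_(B : {set T} | (A \subset B) && is_sublattice B) B.

Definition distributive_on A : bool :=
  [forall x in A, forall y in A, forall z in A,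
     x `&` (y `|` z) == (x `&` y) `|` (x `&` z)].

Definition supersolvable : Prop :=
  exists2 c : {set T}, c \in maxchains [set: T]%SET
    & forall D, is_chain D -> distributive_on (generated (c :|: D)).

End Lattices.
Arguments supersolvable {disp} T.

(** * Simplicial complexes, polytopes and convex-ear decompositions *)

Definition is_complex (V : finType) (D : {set {set V}}) : Prop :=
  finset.set0 \in D /\
  (forall F G : {set V}, F \in D -> G \subset F -> G \in D).

(* Without facets this is the empty family, which is not the complex whose only
   face is the empty one. *)
Definition complex_of (V : finType) (E : {set {set V}}) : {set {set V}} :=
  [set F : {set V} | [exists G in E, F \subset G]].

(* One more than the dimension. *)
Definition dim1 (V : finType) (D : {set {set V}}) : nat := \max_(F in D) #|F|.

(* The complex generated by the codimension-one faces contained in exactly one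
   facet. *)
Definition bdry (V : finType) (D : {set {set V}}) : {set {set V}} :=
  complex_of [set F in D | (#|F|.+1 == dim1 D) &&
    (#|[set G in D | (F \subset G) && (#|G| == dim1 D)]| == 1)].

Definition complex_iso (V W : finType) (D : {set {set V}})
    (D' : {set {set W}}) : Prop :=
  exists2 f : V -> W,
    {in [set v | [set v] \in D] &, injective f}
    & D' = [set f @: (F : {set V}) | F in D].

Section Topology.
Variable R : realType.
Local Open Scope ring_scope.
Local Open Scope classical_set_scope.

Definition homeomorphic (X Y : topologicalType) (A : set X) (B : set Y) : Prop :=
  exists f : X -> Y, exists g : Y -> X,
    [/\ {within A, continuous f}, {within B, continuous g},
        forall x, A x -> B (f x) /\ g (f x) = x
      & forall y, B y -> A (g y) /\ f (g y) = y].

(* The geometric realization, in barycentric coordinates. *)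
Definition realization (V : finType) (D : {set {set V}}) : set 'rV[R]_#|V| :=
  [set x | [/\ forall i, 0 <= x 0 i, \sum_i x 0 i = 1
             & [set v | x 0 (enum_rank v) != 0]%SET \in D]].

(* The norm of the library on 'rV[R]_m is the sup norm. *)
Definition euclidean_ball (m : nat) : set 'rV[R]_m :=
  [set x | \sum_i x 0 i ^+ 2 <= 1].

(* The complexes with dim1 D = 0 have an empty realization and are not balls. *)
Definition simplicial_ball (V : finType) (D : {set {set V}}) : Prop :=
  homeomorphic (realization D) (@euclidean_ball (dim1 D).-1).

Section Polytopes.
Variables (I : finType) (d : nat) (v : I -> 'rV[R]_d).

Definition conv_hull : set 'rV[R]_d :=
  [set x | exists w : I -> R,
     [/\ forall i, 0 <= w i, \sum_i w i = 1 & x = \sum_i w i *: v i]].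

Definition affinely_independent (F : {set I}) : Prop :=
  forall w : I -> R, \sum_(i in F) w i = 0 -> \sum_(i in F) w i *: v i = 0 ->
    forall i, i \in F -> w i = 0.

Definition affinely_spanning : Prop :=
  forall x : 'rV[R]_d, exists w : I -> R,
    \sum_i w i = 1 /\ x = \sum_i w i *: v i.

(* F indexes the points v i lying on the face of the polytope conv_hull that is
   cut out by the valid inequality a . x <= b.  The empty face and the polytope
   itself are obtained for a = 0. *)
Definition is_face (F : {set I}) : Prop :=
  exists (a : 'cV[R]_d) (b : R),
    (forall x, conv_hull x -> (x *m a) 0 0 <= b) /\
    (forall i, (i \in F) = ((v i *m a) 0 0 == b)).

(* The v i are the distinct vertices of a simplicial d-polytope in R^d. *)
Definition simplicial_polytope : Prop :=
  [/\ affinely_spanning,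
      forall i, is_face [set i]%SET
    & forall F, is_face F -> F != [set: I]%SET -> affinely_independent F].

Definition boundary_complex : {set {set I}} :=
  [set F : {set I} | `[< is_face F >] && (F != [set: I]%SET)]%SET.

End Polytopes.

Definition polytope_boundary (V : finType) (d : nat) (D : {set {set V}}) : Prop :=
  exists (n : nat) (v : 'I_n -> 'rV[R]_d),
    simplicial_polytope v /\ complex_iso D (boundary_complex v).

Definition proper_in_polytope_boundary (V : finType) (d : nat)
    (D : {set {set V}}) : Prop :=
  exists (n : nat) (v : 'I_n -> 'rV[R]_d) (G : {set {set 'I_n}}),
    [/\ simplicial_polytope v, G \proper boundary_complex v & complex_iso D G].

(* s lists the ears, indexed from 0. *)
Definition convex_ear_decomposition (V : finType) (D : {set {set V}})
    (s : seq {set {set V}}) : Prop :=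
  let d := dim1 D in
  let Sigma i := nth finset.set0 s i in
  [/\ (0 < size s)%N /\ (forall X, X \in s -> is_complex X /\ X \subset D),
      (\bigcup_(i < size s) Sigma i)%SET = D,
      polytope_boundary d (Sigma 0%N) /\
        (forall i, (0 < i < size s)%N ->
           dim1 (Sigma i) = d /\ proper_in_polytope_boundary d (Sigma i)),
      forall i, (0 < i < size s)%N -> simplicial_ball (Sigma i)
    & forall i, (0 < i < size s)%N ->
        ((\bigcup_(j < i) Sigma j) :&: Sigma i)%SET = bdry (Sigma i)].

End Topology.

(** * The ears of a rank-selected supersolvable lattice *)

Section Ears.
Context {disp : Order.disp_t} {T : finTBLatticeType disp}.
Variables (lam : T -> T -> nat) (S : {pred nat}).
(* c is the increasing chain; cs lists the decreasing chains. *)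
Variables (c : {set T}) (cs : seq {set T}).

Definition rank_selected : {set T} := [set x | rank x \in S].

(* L_i; all indices below start from 0. *)
Definition Lsub (i : nat) : {set T} := generated (nth finset.set0 cs i :|: c).

(* c_i^1, c_i^2, ... *)
Definition descent_chains (i : nat) : seq {set T} :=
  sort (lex_le lam)
    (enum [set D in maxchains (Lsub i) | has_descent_set S (labels lam D)]).

(* C_i^j *)
Definition Cset (i j : nat) : {set {set T}} :=
  let x := chain_seq (nth finset.set0 (descent_chains i) j) in
  [set D in maxchains (Lsub i) |
    all (fun n => (n \in S) || (nth \bot%O (chain_seq D) n == nth \bot%O x n))
        (iota 0 (rank (\top%O : T)).+1)].

(* L_i^j *)
Definition Lsub2 (i j : nat) : {set T} :=
  rank_selected :&: \bigcup_(D in Cset i j) D.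

(* E_i^j *)
Definition Eset (i j : nat) : {set {set T}} :=
  [set D in maxchains (Lsub2 i j) |
    [forall m : 'I_j, D \notin maxchains (Lsub2 i m)] &&
    [forall m : 'I_i, forall p : 'I_(size (descent_chains m)),
       D \notin maxchains (Lsub2 m p)]].

Definition ears : seq {set {set T}} :=
  [seq complex_of (Eset i j) | i <- iota 0 (size cs),
                               j <- iota 0 (size (descent_chains i))].

End Ears.

(* Main.v *)
(* The labels identify each L_i with the Boolean lattice of subsets of [r], hence its
   maximal chains with permutations. Since no Moebius number vanishes, every chain lies
   in some L_i. The chains of L_i^j form the boundary of a polytope whose vertices are
   the prefixes of length in S of the words that agree with c_i^j off S: a strictly
   concave height makes its proper faces exactly the chains. A facet is new in E_i^j iff
   its word ascends off S and does not occur in an earlier L_m, and these words form an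
   up-set of the weak order. In coordinates where c_i^j spans the orthant, the cone over
   an up-set is closed under increasing coordinates, so it is the epigraph of a Lipschitz
   function and the ear is a ball. A face of the ear lies in an earlier complex iff some
   adjacent descent of its word at a position in S can be sorted without moving the face;
   the swapped words show that these faces form the boundary. *)

(* Label sets are not injective on the whole lattice. What rescues them is that the element of [c]
   with labels 1..k is the only one with that label set, by uniqueness of increasing chains, so
   meets with [c] and joins x \/ (c_k /\ y) have computable labels. A facet records only the
   prefixes of lengths in S, yet it has to decide whether a whole word lies in an earlier L_m. The
   letter sets that L_m shares with L_i form a ring of sets containing every {1..k}. Membership in
   such a ring is tested by separating pairs of letters, and pairs in natural order are separated
   for free, so only inversions count. This gives both the up-set property and the sufficiency of
   few prefixes. The geometry takes place in the functions on letters modulo those constant on the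
   blocks between cuts off S. A word is the chamber of functions decreasing along it inside each
   block. One inequality for concave heights yields the faces of the polytope and also the
   injectivity of the map from an ear to its cone, so no shelling is used for the balls. *)
Require Import Defs.
From HB Require Import structures.
From mathcomp Require Import all_boot all_order all_algebra perm zify ring lra.
From mathcomp Require Import boolp reals.
From mathcomp Require all_classical all_reals all_analysis.

Set Implicit Arguments.
Unset Strict Implicit.
Unset Printing Implicit Defensive.

Import Order.TTheory GRing.Theory Num.Theory.

(** * Words and their prefixes *)

Section Words.
Variable r : nat.
Implicit Types (p q w : 'S_r) (a b : 'I_r) (A B : {set 'I_r}).

(* A permutation stands for the word in which the letter a has position p a; the
   letter a : 'I_r is the label a + 1. *)
Definition initial_seg p (n : nat) : {set 'I_r} := [set a | p a < n].

Lemma mem_initial_seg p n a : (a \in initial_seg p n) = (p a < n).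
Proof. by rewrite inE. Qed.

Lemma card_initial_seg p n : n <= r -> #|initial_seg p n| = n.
Proof.
move=> n_le; rewrite -(card_imset (mem (initial_seg p n)) (@perm_inj _ p)).
have -> : p @: initial_seg p n = [set k : 'I_r | k < n].
  apply/setP=> k; rewrite inE; apply/imsetP/idP => [[a]|kn].
    by rewrite inE => an ->.
  by exists (p^-1%g k); rewrite ?inE permKV.
have -> : [set k : 'I_r | k < n] = widen_ord n_le @: setT.
  apply/setP=> k; rewrite inE; apply/idP/imsetP => [kn|[l _ ->]]; last exact: (ltn_ord l).
  by exists (Ordinal kn) => //; apply: val_inj.
rewrite card_imset ?cardsT ?card_ord // => k l /(congr1 val) /=; exact: val_inj.
Qed.

Lemma initial_seg_top p n : r <= n -> initial_seg p n = setT.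
Proof. by move=> rn; apply/setP=> a; rewrite !inE (leq_trans _ rn). Qed.

Lemma initial_seg_mono p m n : m <= n -> initial_seg p m \subset initial_seg p n.
Proof. by move=> mn; apply/subsetP=> a; rewrite !inE => /leq_trans->. Qed.

Lemma perm_nat_inj p a b : p a = p b :> nat -> a = b.
Proof. by move/val_inj/perm_inj. Qed.

(** Counting: if b is in A, all letters up to b are in A, so [p b < #|A|]; otherwise A lies strictly
    before b, so [#|A| <= p b]. *)
Lemma initial_segP p A :
  (forall a b, a \in A -> b \notin A -> p a < p b) -> A = initial_seg p #|A|.
Proof.
move=> init; apply/setP=> b; rewrite inE.
have [bA|bA] := boolP (b \in A); apply/esym.
  rewrite -[p b < _]/((p b).+1 <= _) -(@card_initial_seg p (p b).+1) //.
  apply: subset_leq_card; apply/subsetP=> c; rewrite inE ltnS => cb.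
  by apply: contraLR cb => cA; rewrite -ltnNge init.
apply/negbTE; rewrite -leqNgt -[leqRHS](@card_initial_seg p (p b)); last exact: ltnW.
by apply: subset_leq_card; apply/subsetP=> c cA; rewrite inE init.
Qed.

Lemma eq_initial_seg p q : (forall n, initial_seg p n = initial_seg q n) -> p = q.
Proof.
move=> e; apply/permP=> a; apply/val_inj/eqP; rewrite /= eqn_leq.
have mem n : (p a < n) = (q a < n) by rewrite -!mem_initial_seg e.
by rewrite -ltnS mem leqnn -ltnS -mem leqnn.
Qed.

Lemma perm_of_order (lt : rel 'I_r) : irreflexive lt -> transitive lt ->
    (forall a b, a != b -> lt a b || lt b a) ->
  exists p, forall a b, (p a < p b) = lt a b.
Proof.
move=> irr tr tot; pose f a := #|[set b | lt b a]|.
have f_lt a : f a < r.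
  rewrite -[ltnRHS]card_ord -[in ltnRHS]cardsT; apply/proper_card/properP.
  by split; [apply/subsetP=> b; rewrite inE | exists a; rewrite ?inE ?irr].
have f_mono a b : lt a b -> f a < f b.
  move=> ab; apply/proper_card/properP; split; last first.
    by exists a; rewrite !inE ?irr.
  by apply/subsetP=> c; rewrite !inE => /tr->.
have f_inj : injective (fun a => Ordinal (f_lt a)).
  move=> a b [/eqP]; apply: contraTeq => /tot /orP[] /f_mono.
    by move/ltn_eqF->.
  by move/gtn_eqF->.
exists (perm f_inj) => a b; rewrite !permE /=.
apply/idP/idP => [|/f_mono //]; apply: contraTT => nab.
have [->|/tot] := eqVneq a b; first by rewrite ltnn.
by rewrite (negbTE nab) /= -leqNgt => /f_mono/ltnW.
Qed.

(** Inclusion of inversion sets: the weak order, with the identity as least element. *)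
Definition weak_le p q : Prop :=
  forall a b, a < b -> p b < p a -> q b < q a.

(** Positions start at 0, so [p b] is the length of the prefix ending just before [b]; the condition
    says that the descent set of the word is contained in N. *)
Definition ascends_off (N : {pred nat}) p : Prop :=
  forall a b, p b = (p a).+1 :> nat -> (p b : nat) \notin N -> a < b.

Lemma ascends_off_between (N : {pred nat}) p a b : ascends_off N p -> p a < p b ->
  (forall m, p a < m <= p b -> m \notin N) -> a < b.
Proof.
move=> asc; have [k] := ubnP (p b - p a); elim: k b => // k IH b dk ab nN.
have [e|ne] := eqVneq (p b : nat) (p a).+1; first by apply: asc => //; apply: nN; rewrite ab leqnn.
have lt1 : (p b).-1 < r by rewrite (leq_ltn_trans (leq_pred _)).
pose b' := p^-1%g (Ordinal lt1).
have pb' : p b' = (p b).-1 :> nat by rewrite permKV.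
have pb0 : (p b).-1.+1 = p b by rewrite prednK // (leq_ltn_trans _ ab).
have ab' : p a < p b' by rewrite pb' -ltnS pb0 ltn_neqAle eq_sym ne.
apply: (@ltn_trans b'); last by apply: asc; rewrite ?pb' ?pb0 // nN // ab leqnn.
apply: IH => // [|m /andP[am mb]].
  by rewrite pb' -ltnS (leq_trans _ dk) // ltnS ltn_sub2r // -[ltnRHS]pb0.
by apply: nN; rewrite am (leq_trans mb) // pb' leq_pred.
Qed.

(* Ordering the letters by the number of members of the chain that miss them,
   ties being broken by the natural order. *)
Lemma chain_extension (F : {set {set 'I_r}}) :
    {in F &, forall A B, (A \subset B) || (B \subset A)} ->
  exists p, (forall A, A \in F -> A = initial_seg p #|A|) /\
   (forall a b, a < b -> (forall A, A \in F -> b \in A -> a \in A) -> p a < p b).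
Proof.
move=> ch; pose k a := #|[set A in F | a \notin A]|.
pose lt a b := (k a < k b) || (k a == k b) && (a < b).
have [|||p pE] := @perm_of_order lt.
- by move=> a; rewrite /lt !ltnn eqxx.
- move=> b a c; rewrite /lt; move: (k a) (k b) (k c) => ka kb kc; clear; lia.
- move=> a b; rewrite -val_eqE /lt /=; move: (k a) (k b) => ka kb; clear; lia.
exists p; split=> [A AF|a b ab sub]; last first.
  rewrite pE /lt ab andbT orbC -leq_eqVlt.
  apply: subset_leq_card; apply/subsetP=> A; rewrite !inE => /andP[AF].
  by rewrite AF; apply: contra => /(sub _ AF).
apply: initial_segP => a b aA bA; rewrite pE /lt.
suff -> : k a < k b by [].
apply: proper_card; apply/properP; split; last by exists A; rewrite !inE AF ?aA.
apply/subsetP=> B; rewrite !inE => /andP[BF aB]; rewrite BF /=.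
apply: contra aB => bB; case/orP: (ch _ _ AF BF) => /subsetP; first exact.
by move=> /(_ _ bB) bA'; rewrite bA' in bA.
Qed.

(** * Rings of sets that contain all initial intervals of letters *)

Definition lower_labels (k : nat) : {set 'I_r} := [set a : 'I_r | a < k].

Definition set_lattice (X : {set {set 'I_r}}) : Prop :=
  [/\ {in X &, forall A B, A :&: B \in X}, {in X &, forall A B, A :|: B \in X}
    & forall k, lower_labels k \in X].

(** A is the union, over its letters a, of the intersections, over the letters b outside A, of
    members containing a and missing b. *)
Lemma set_lattice_sep X A : set_lattice X ->
    (forall a b, a \in A -> b \notin A -> exists2 B, B \in X & (a \in B) && (b \notin B)) ->
  A \in X.
Proof.
move=> [XI XU XL] sep.
have X0 : set0 \in X by rewrite (_ : set0 = lower_labels 0) //; apply/setP=> a; rewrite !inE.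
have XT : setT \in X.
  by rewrite (_ : setT = lower_labels r) //; apply/setP=> a; rewrite !inE ltn_ord.
pose f a b := odflt set0 [pick B in X | (a \in B) && (b \notin B)].
have fP a b : a \in A -> b \notin A -> [&& f a b \in X, a \in f a b & b \notin f a b].
  rewrite /f => aA bA; case: pickP => [B /and3P[-> -> ->] //|none].
  by have [B BX /andP[aB bB]] := sep a b aA bA; have := none B; rewrite BX aB bB.
have -> : A = \bigcup_(a in A) \bigcap_(b in ~: A) f a b.
  apply/setP=> c; apply/idP/bigcupP => [cA|[a aA /bigcapP ic]].
    exists c => //; apply/bigcapP=> b; rewrite inE => bA.
    by case/and3P: (fP _ _ cA bA).
  apply/negPn/negP => cA; have /ic : c \in ~: A by rewrite inE.
  by case/and3P: (fP _ _ aA cA) => _ _ /negP.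
apply: (big_ind (fun B => B \in X)) => // a aA; apply: (big_ind (fun B => B \in X)) => // b; rewrite inE => bA.
by case/and3P: (fP _ _ aA bA).
Qed.

(** A pair in natural order is separated by some [lower_labels]; a pair that p reverses is an
    inversion of q as well, and a prefix of q separates it. Hence the words that are not in an
    earlier Boolean sublattice form an up-set. *)
Lemma set_lattice_weak X p q : set_lattice X -> weak_le p q ->
  (forall n, initial_seg q n \in X) -> forall n, initial_seg p n \in X.
Proof.
move=> Xl pq Xq n; have [_ _ XL] := Xl; apply: set_lattice_sep => // a b.
rewrite !inE -leqNgt => an nb.
have pab := leq_trans an nb; have [ba|ab|/val_inj ab] := ltngtP b a.
- exists (initial_seg q (q b)); first exact: Xq.
  by rewrite !inE ltnn andbT; apply: pq.
- exists (lower_labels a.+1); first exact: XL.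
  by rewrite !inE ltnS leqnn /= -leqNgt.
- by rewrite ab ltnn in pab.
Qed.

(** Since p ascends between consecutive cuts of N, every inversion straddles such a cut, and the
    prefix there separates its two letters. So the prefixes recorded by a face can decide about the
    whole word. *)
Lemma set_lattice_ascends X (N : {pred nat}) p : set_lattice X -> ascends_off N p ->
  (forall n, n \in N -> initial_seg p n \in X) -> forall n, initial_seg p n \in X.
Proof.
move=> Xl asc XN n; have [_ _ XL] := Xl; apply: set_lattice_sep => // a b.
rewrite !inE -leqNgt => an nb.
have pab := leq_trans an nb; have [ba|ab|/val_inj ab] := ltngtP b a.
- have [/existsP[m /andP[mN /andP[am mb]]]|none] :=
    boolP [exists m : 'I_r.+1, ((m : nat) \in N) && (p a < m <= p b)].
    exists (initial_seg p m); first exact: XN.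
    by rewrite !inE am -leqNgt mb.
  suff : a < b by rewrite ltnNge ltnW.
  apply: (ascends_off_between asc) => // m amb; apply: contra none => mN.
  have mr : m < r.+1 by rewrite ltnS; case/andP: amb => _ /leq_trans-> //; apply: ltnW.
  by apply/existsP; exists (Ordinal mr); rewrite /= mN.
- exists (lower_labels a.+1); first exact: XL.
  by rewrite !inE ltnS leqnn /= -leqNgt.
- by rewrite ab ltnn in pab.
Qed.
End Words.

(** * Words with the same prefixes off S *)

Lemma ltxi_first_diff (s t : seq nat) : size s = size t ->
    ((s : seqlexi nat) < (t : seqlexi nat))%O ->
  exists k, [/\ k < size s, forall i, i < k -> nth 0 s i = nth 0 t i
                & nth 0 s k < nth 0 t k].
Proof.
elim: s t => [|x s IH] [|y t] //= [st]; rewrite ltxi_cons !leEnat /=.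
case: (ltngtP x y) => //= [xy _|-> /(IH _ st)[k [ks eqs lts]]].
  by exists 0.
by exists k.+1; split=> // -[|i] //= /eqs.
Qed.

Section Blocks.
Variables (r : nat) (S : {pred nat}).
Implicit Types (p q w : 'S_r) (a b : 'I_r) (A B : {set 'I_r}).
Hypothesis S_lt : forall n, n \in S -> 0 < n < r.

(** The prefixes off S divide the word into blocks, and words of one class differ by rearranging
    letters inside blocks. A class corresponds to one [Cset]. *)
Definition same_off p q : Prop :=
  forall n, n \notin S -> initial_seg p n = initial_seg q n.

Definition descends_exactly_on w : Prop :=
  forall a b, w b = (w a).+1 :> nat -> ((w b : nat) \in S) = (b < a).

Definition word w : seq nat := [seq (w^-1%g k : 'I_r).+1 | k <- enum 'I_r].

Lemma size_word w : size (word w) = r.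
Proof. by rewrite size_map size_enum_ord. Qed.

Lemma nth_word w (k : 'I_r) : nth 0 (word w) k = (w^-1%g k : 'I_r).+1.
Proof. by rewrite (nth_map k) ?size_enum_ord // nth_ord_enum. Qed.

Lemma word_inj : injective word.
Proof.
move=> p q e; apply: invg_inj; apply/permP=> k; apply/val_inj/succn_inj.
by rewrite -!nth_word e.
Qed.

Lemma same_off_sym p q : same_off p q -> same_off q p.
Proof. by move=> pq n nS; rewrite pq. Qed.

Lemma same_off_trans p q w : same_off p q -> same_off q w -> same_off p w.
Proof. by move=> pq qw n nS; rewrite pq // qw. Qed.

Lemma descends_between w a b : descends_exactly_on w -> w a < w b ->
  (forall m, w a < m <= w b -> m \in S) -> b < a.
Proof.
(* Reading the word backwards turns descents into ascents and the cut m into [r - m], which reduces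
   the claim to [ascends_off_between]. *)
move=> desw ab mS; pose w' := (w * (perm (@rev_ord_inj r)))%g.
have w'E c : w' c = r - (w c).+1 :> nat by rewrite permM permE.
have le1 c : (w c).+1 <= r by [].
suff asc : ascends_off [pred m | r - m \notin S] w'.
  apply: (ascends_off_between asc) => [|m].
    by rewrite !w'E; have := le1 b; lia.
  rewrite !w'E !inE negbK => mm; apply: mS.
  by have := le1 a; have := le1 b; lia.
move=> c d; rewrite !inE negbK !w'E => e rS.
have e' : w c = (w d).+1 :> nat by have := le1 c; have := le1 d; lia.
rewrite -(desw _ _ e'); suff -> : (w c : nat) = r - (r - (w d).+1) by [].
by have := le1 c; have := le1 d; lia.
Qed.

Lemma eq_of_same_off p q : same_off p q ->
  (forall n, n \in S -> initial_seg p n = initial_seg q n) -> p = q.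
Proof.
by move=> pq pq'; apply: eq_initial_seg => n; case: (boolP (n \in S)) => [/pq'|/pq].
Qed.

(** Suppose w' is smaller at the first difference, where w has the letter x. As w' descends inside
    its block, the rest of that block has only letters below x, and x comes later in w'. Some
    smaller letter a takes its place in the prefix up to the end of the block. Then x precedes a in
    p, an inversion that q must share; but in q the letter a comes in an earlier block than x. *)
Lemma word_le_of_weak_le p q w w' : descends_exactly_on w -> descends_exactly_on w' ->
    same_off p w -> same_off q w' -> weak_le p q ->
  ((word w : seqlexi nat) <= (word w' : seqlexi nat))%O.
Proof.
move=> desw desw' pw qw' pq; rewrite leNgt; apply/negP => lt.
have [|k [kr eqk ltk]] := ltxi_first_diff _ lt; first by rewrite !size_word.
rewrite size_word in kr; pose K := Ordinal kr.
have {}eqk (i : 'I_r) : i < k -> w'^-1%g i = w^-1%g i.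
  by move=> /eqk; rewrite !nth_word => -[/val_inj].
have eqw a : w a < k -> w' a = w a by move=> /eqk; rewrite permK => e; rewrite -[in LHS]e permKV.
have eqw' a : w' a < k -> w a = w' a by move=> /eqk; rewrite permK => e; rewrite [in LHS]e permKV.
pose x := w^-1%g K; pose y := w'^-1%g K.
have {ltk} yx : y < x by have := ltk; rewrite !(nth_word _ K).
have wx : w x = k :> nat by rewrite permKV.
have wy : w' y = k :> nat by rewrite permKV.
(* The end [n] of the block containing position k is the next cut off S; [r] is always such a
   cut. *)
have exn : exists n, (k < n) && (n \notin S).
  by exists r; rewrite kr; apply/negP => /S_lt; rewrite ltnn andbF.
case: (ex_minnP exn) => n /andP[kn nS] min_n.
have n_le : n <= r.
  by apply: min_n; rewrite kr; apply/negP => /S_lt; rewrite ltnn andbF.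
have kS m : k < m < n -> m \in S.
  by case/andP=> km mn; apply: contraLR mn => mS; rewrite -leqNgt min_n ?km.
have below b : k <= w' b < n -> b <= y.
  case/andP; rewrite leq_eqVlt => /orP[/eqP e _|kb bn].
    by rewrite (_ : b = y) //; apply: (@perm_nat_inj _ w'); rewrite wy.
  apply/ltnW/(descends_between desw'); rewrite wy // => m /andP[km mb].
  by rewrite kS // km (leq_ltn_trans mb).
have above b : w' b < k -> b != x.
  move=> bk; apply/eqP => e; have := congr1 (@nat_of_ord r) (eqw' _ bk); rewrite e wx => h.
  by move: bk; rewrite e -h ltnn.
have xn : n <= w' x.
  rewrite leqNgt; apply/negP => xn; have [xk|kx] := ltnP (w' x) k.
    by have := above _ xk; rewrite eqxx.
  by have := below x; rewrite kx xn leqNgt yx => /(_ isT).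
(* Both prefixes have n letters and only that of w contains x, so that of w' contains a letter
   missing from the other. *)
have /subsetPn[a] : ~~ (initial_seg w' n \subset initial_seg w n).
  apply/negP => sub; have /setP/(_ x) : initial_seg w' n = initial_seg w n.
    by apply/eqP; rewrite eqEcard sub !card_initial_seg ?leqnn.
  by rewrite !inE wx kn ltnNge xn.
rewrite !inE -leqNgt => a1 a2.
have ax : a < x.
  apply: leq_ltn_trans yx; apply: below; rewrite a1 andbT leqNgt.
  by apply/negP => ak; move: a2; rewrite (eqw' _ ak) leqNgt a1.
have xp : x \in initial_seg p n by rewrite pw // inE wx.
have ap : n <= p a by rewrite leqNgt -mem_initial_seg pw // inE -leqNgt.
have aq : a \in initial_seg q n by rewrite qw' // inE.
have : x \in initial_seg q n.
  move: aq xp; rewrite !inE => aq xp; apply: ltn_trans aq; apply: pq => //.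
  exact: leq_trans ap.
by rewrite qw' // inE ltnNge xn.
Qed.

(** Sort each block in decreasing order. An ascent remains at each cut off S: the smallest letter of
    the left block is at most its last letter in p, which is below the first letter of the next
    block in p, hence below the largest letter there. *)
Lemma exists_descends_exactly_on p : ascends_off S p ->
  exists w, descends_exactly_on w /\ same_off p w.
Proof.
move=> asc.
(* [k a] numbers the block of [a], by counting the cuts off S up to its position. *)
pose k a := #|[set n : 'I_r.+1 | ((n : nat) \notin S) && (n <= p a)]|.
pose lt a b := (k a < k b) || (k a == k b) && (b < a).
have [|||w wE] := @perm_of_order r lt.
- by move=> a; rewrite /lt !ltnn eqxx.
- move=> b a c; rewrite /lt; move: (k a) (k b) (k c) => ka kb kc; clear; lia.
- move=> a b; rewrite -val_eqE /lt /=; move: (k a) (k b) => ka kb; clear; lia.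
have k_mono a b : p a <= p b -> k a <= k b.
  move=> pab; apply: subset_leq_card; apply/subsetP=> n; rewrite !inE => /andP[-> /=].
  by move/leq_trans->.
have k_lt a b n : n \notin S -> p a < n -> n <= p b -> k a < k b.
  move=> nS an nb; have nr : n < r.+1 by rewrite ltnS (leq_trans nb) // ltnW.
  apply/proper_card/properP; split.
    apply/subsetP=> m; rewrite !inE => /andP[-> /leq_trans-> //].
    by rewrite (leq_trans (ltnW an)).
  by exists (Ordinal nr); rewrite !inE /= nS //= -ltnNge.
have pw : same_off p w.
  move=> n nS; have [nr|rn] := leqP n r; last by rewrite !initial_seg_top // ltnW.
  rewrite -[in RHS](card_initial_seg p nr); apply: initial_segP => a b.
  by rewrite !inE -leqNgt wE /lt => an nb; rewrite (k_lt _ _ n).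
exists w; split=> // a b e; set n := (w b : nat) in e *.
have [nS|nS] := boolP (n \in S).
  have : w a < w b by rewrite -/n e.
  rewrite wE /lt => /orP[|/andP[_ ->] //]; rewrite ltnNge => /negP[].
  apply: subset_leq_card; apply/subsetP=> m; rewrite !inE => /andP[mS]; rewrite mS /=.
  move=> mb; rewrite leqNgt; apply/negP => am.
  have : w a < m by rewrite -mem_initial_seg -pw // inE.
  rewrite -e leq_eqVlt => /orP[/eqP em|nm]; first by rewrite -em nS in mS.
  have : p b < m by rewrite -mem_initial_seg pw // inE.
  by rewrite ltnNge mb.
apply/esym/negbTE; rewrite -leqNgt ltnW //.
pose a' := p^-1%g (w a); pose b' := p^-1%g (w b).
have pa' : p a' = w a by rewrite permKV.
have pb' : p b' = w b by rewrite permKV.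
have ab' : a' < b' by apply: asc; rewrite ?pa' pb' -/n.
have an : w a < n by rewrite e.
have aa' : a <= a'.
  have : p a < n by rewrite -mem_initial_seg pw // inE.
  have : w a' < n by rewrite -mem_initial_seg -pw // inE pa'.
  rewrite e !ltnS leq_eqVlt => /orP[/eqP/perm_nat_inj <- //|a'a paa'].
  move: a'a; rewrite wE /lt ltnNge k_mono ?pa' //= => /andP[_]; exact: ltnW.
have bb' : b' <= b.
  have : n <= p b by rewrite leqNgt -mem_initial_seg pw // inE -leqNgt.
  have : n <= w b' by rewrite leqNgt -mem_initial_seg -pw // inE pb' -leqNgt.
  rewrite leq_eqVlt => /orP[/eqP/perm_nat_inj -> //|bb' pbb'].
  move: bb'; rewrite wE /lt ltnNge k_mono ?pb' //= => /andP[_]; exact: ltnW.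
exact: leq_ltn_trans aa' (leq_trans ab' bb').
Qed.

(** Going up in the weak order inside a class can only lower the last letter of a block and raise
    the first one, so an ascent at a cut off S survives. *)
Lemma ascends_off_weak p q : same_off p q -> weak_le p q -> ascends_off S p ->
  ascends_off S q.
Proof.
move=> pq le_pq asc a b e nS; set n := (q b : nat) in e nS.
pose a' := p^-1%g (q a); pose b' := p^-1%g (q b).
have pa' : p a' = q a by rewrite permKV.
have pb' : p b' = q b by rewrite permKV.
have ab' : a' < b' by apply: asc; rewrite ?pa' pb' -/n.
have aa' : a <= a'.
  have : p a < n by rewrite -mem_initial_seg pq // inE e.
  rewrite e ltnS leq_eqVlt -pa' => /orP[/eqP/perm_nat_inj -> //|paa'].
  rewrite leqNgt; apply/negP => a'a; have := le_pq _ _ a'a paa'.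
  have : q a' < n by rewrite -mem_initial_seg -pq // inE pa' e.
  by rewrite e ltnS => h; rewrite ltnNge h.
have bb' : b' <= b.
  have : n <= p b by rewrite leqNgt -mem_initial_seg pq // inE -leqNgt.
  rewrite /n -pb' leq_eqVlt => /orP[/eqP/perm_nat_inj -> //|pbb'].
  rewrite leqNgt; apply/negP => bb'; have := le_pq _ _ bb' pbb'.
  have : n <= q b' by rewrite leqNgt -mem_initial_seg -pq // inE pb' -leqNgt.
  by move=> h; rewrite ltnNge h.
exact: leq_ltn_trans aa' (leq_trans ab' bb').
Qed.

Lemma same_off_lt p q a b n : same_off p q -> n \notin S -> p a < n -> n <= p b -> q a < q b.
Proof.
move=> pq nS an nb; apply: (@leq_trans n).
  by rewrite -mem_initial_seg -pq // inE.
by rewrite leqNgt -mem_initial_seg -pq // inE -leqNgt.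
Qed.

End Blocks.

(** * Linear functionals attached to words *)

Local Open Scope ring_scope.

Section Gaps.
Variables (R : realFieldType) (r : nat) (S : {pred nat}).
Implicit Types (p q w : 'S_r) (a b : 'I_r) (A B : {set 'I_r}) (f g : 'I_r -> R).
Hypothesis S_lt : forall n, n \in S -> (0 < n < r)%N.

(** The sum has at most one term; this form makes the value total in n, with 0 for [n >= r], and
    visibly linear in f. *)
Definition value_at f p (n : nat) : R := \sum_(a | p a == n :> nat) f a.

Lemma value_at_pos f p a : value_at f p (p a) = f a.
Proof.
rewrite /value_at (bigD1 a) //= big1 ?addr0 // => b /andP[/eqP e].
by rewrite (perm_nat_inj e) eqxx.
Qed.

Lemma sum_value_at f p (h : nat -> R) : \sum_a f a * h (p a) = \sum_(k < r) value_at f p k * h k.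
Proof.
rewrite [RHS](reindex_inj (@perm_inj _ p)); apply: eq_bigr => a _.
by rewrite value_at_pos.
Qed.

(** The drop of f across the cut n. The gaps at cuts are dual to the indicators of prefixes
    ([gap_initial_seg]), and all gaps at S vanish exactly when f is constant on blocks. *)
Definition gap f p (n : nat) : R := value_at f p n.-1 - value_at f p n.

Lemma gap_consecutive f p a b : p b = (p a).+1 :> nat -> gap f p (p b) = f a - f b.
Proof. by move=> e; rewrite /gap {1}e /= !value_at_pos. Qed.

Lemma gapD f g p n : gap (fun a => f a + g a) p n = gap f p n + gap g p n.
Proof. by rewrite /gap /value_at !big_split /=; ring. Qed.

Lemma gapN f p n : gap (fun a => - f a) p n = - gap f p n.
Proof. by rewrite /gap /value_at !sumrN; ring. Qed.

Lemma gapZ c f p n : gap (fun a => c * f a) p n = c * gap f p n.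
Proof. by rewrite /gap /value_at -!mulr_sumr; ring. Qed.

Lemma gap_sum (I : Type) (s : seq I) (P : pred I) (F : I -> 'I_r -> R) p n :
  gap (fun a => \sum_(i <- s | P i) F i a) p n = \sum_(i <- s | P i) gap (F i) p n.
Proof. by rewrite /gap /value_at sumrB; congr (_ - _); apply: exchange_big. Qed.

Lemma eq_gap f g p n : f =1 g -> gap f p n = gap g p n.
Proof. by move=> e; rewrite /gap /value_at; congr (_ - _); apply: eq_bigr => a _; rewrite e. Qed.

Definition chi A a : R := (a \in A)%:R.

Lemma gap_initial_seg p m n : (0 < n < r)%N -> gap (chi (initial_seg p m)) p n = (n == m)%:R.
Proof.
move=> /andP[n0 nr]; have va k : (k < r)%N -> value_at (chi (initial_seg p m)) p k = (k < m)%:R.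
  move=> kr; pose a := p^-1%g (Ordinal kr); have pa : p a = k :> nat by rewrite permKV.
  by rewrite -{1}pa value_at_pos /chi inE pa.
have n1r := leq_ltn_trans (leq_pred n) nr; rewrite /gap !va //.
have [nm|mn|nm] := ltngtP n m.
- by rewrite (leq_ltn_trans (leq_pred n)) // subrr.
- by rewrite subr0; case: n n0 nr n1r mn => //= n _ _ _; rewrite ltnS leqNgt => /negbTE->.
- by rewrite -nm prednK // leqnn subr0.
Qed.

Definition cuts : {set 'I_r} := [set n : 'I_r | (n : nat) \in S].

(** Abel summation; the boundary terms vanish because 0 and r are not in S. *)
Lemma sum_by_parts f p (h : nat -> R) : (forall n, n \notin S -> h n = 0) ->
  \sum_a f a * (h (p a).+1 - h (p a)) = \sum_(n in cuts) h n * gap f p n.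
Proof.
move=> h0; have r0 : (r : nat) \notin S by apply/negP => /S_lt; rewrite ltnn andbF.
have z0 : 0%N \notin S by apply/negP => /S_lt; rewrite ltnn.
rewrite (eq_bigr (fun a => f a * h (p a).+1 - f a * h (p a))); last by move=> a _; rewrite mulrBr.
rewrite sumrB (sum_value_at _ _ (fun k => h k.+1)) (sum_value_at _ _ h).
rewrite [RHS](eq_bigr (fun n : 'I_r => h n * value_at f p n.-1 - h n * value_at f p n)); last first.
  by move=> n _; rewrite /gap mulrBr.
rewrite sumrB; congr (_ - _); last first.
  rewrite [RHS]big_mkcond; apply: eq_bigr => n _; rewrite inE mulrC; case: ifPn => // /h0->.
  by rewrite mul0r.
rewrite [RHS]big_mkcond /=.
rewrite [RHS](eq_bigr (fun n : 'I_r => h n * value_at f p n.-1)); last first.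
  by move=> n _; rewrite inE; case: ifPn => // /h0->; rewrite mul0r.
rewrite -(big_mkord xpredT (fun k => value_at f p k * h k.+1)).
rewrite -(big_mkord xpredT (fun k => h k * value_at f p k.-1)).
case: (r) r0 => [|r' r0]; first by rewrite !big_nil.
rewrite big_nat_recr //= (h0 _ r0) mulr0 addr0 big_nat_recl // (h0 _ z0) mul0r add0r.
by apply: eq_bigr => k _; rewrite mulrC.
Qed.

Definition together p a b : bool :=
  [forall n : 'I_r.+1, ((n : nat) \in S) || ((a \in initial_seg p n) == (b \in initial_seg p n))].

Lemma togetherP p a b : reflect
  (forall n, n \notin S -> (a \in initial_seg p n) = (b \in initial_seg p n)) (together p a b).
Proof.
apply: (iffP forallP) => [h n nS|h n]; last by case: (boolP (_ \in S)) => //= /h->.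
have [nr|rn] := leqP n r; last by rewrite !initial_seg_top ?inE // ltnW.
by have := h (Ordinal (nr : (n < r.+1)%N)); rewrite /= (negbTE nS) => /eqP.
Qed.

Lemma together_sym p a b : together p a b = together p b a.
Proof. by apply/togetherP/togetherP => h n nS; rewrite h. Qed.

Lemma together_same_off p q a b : same_off S p q -> together p a b = together q a b.
Proof. by move=> pq; apply/togetherP/togetherP => h n nS; have := h n nS; rewrite pq. Qed.

Lemma togetherPn p a b : (p a < p b)%N -> ~~ together p a b ->
  exists n, [/\ n \notin S, (p a < n)%N & (n <= p b)%N].
Proof.
move=> ab; rewrite negb_forall => /existsP[n]; rewrite negb_or => /andP[nS].
rewrite !inE => ne; exists n; split=> //; move: ne; have [?|?] := ltnP (p b) n;
  by have [?|?] //= := ltnP (p a) n; lia.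
Qed.

Lemma together_cuts p a b m : together p a b -> (p a < m)%N -> (m <= p b)%N -> m \in S.
Proof.
move=> /togetherP t am mb; apply: contraLR isT => /t; rewrite !inE am.
by rewrite ltnNge mb.
Qed.

Lemma together_cover p a b : p b = (p a).+1 :> nat -> (p b : nat) \in S -> together p a b.
Proof.
move=> e bS; apply/togetherP=> n nS; rewrite !inE; move: e => e.
have : n != p b :> nat by apply: contraNneq nS => ->.
lia.
Qed.

Lemma block_monotone f p a b :
    (forall a b, p b = (p a).+1 :> nat -> (p b : nat) \in S -> f b <= f a) ->
  together p a b -> (p a <= p b)%N -> f b <= f a.
Proof.
move=> mono t ab; have [k] := ubnP (p b - p a); elim: k b ab t => // k IH b ab t dk.
move: ab; rewrite leq_eqVlt => /orP[/eqP/perm_nat_inj-> //|ab].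
have lt1 : ((p b).-1 < r)%N by rewrite (leq_ltn_trans (leq_pred _)).
pose b' := p^-1%g (Ordinal lt1); have pb' : p b' = (p b).-1 :> nat by rewrite permKV.
have pb0 : p b = (p b').+1 :> nat by rewrite pb' prednK // (leq_ltn_trans _ ab).
have bS : (p b : nat) \in S by apply: (together_cuts t) => //.
have t' : together p a b'.
  apply/togetherP=> n nS; have /togetherP/(_ n nS) := t; rewrite !inE pb0.
  move=> ->; move: nS; rewrite pb0 in bS; move=> nS.
  have : n != (p b').+1 by apply: contraNneq nS => ->.
  lia.
by apply: le_trans (mono _ _ pb0 bS) (IH b' _ t' _); lia.
Qed.

Lemma block_const f p a b : (forall n, n \in S -> gap f p n = 0) -> together p a b -> f a = f b.
Proof.
move=> g0; have e x y : p y = (p x).+1 :> nat -> (p y : nat) \in S -> f x = f y.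
  by move=> xy yS; apply/eqP; rewrite -subr_eq0 -(gap_consecutive _ xy) g0.
wlog ab : a b / (p a <= p b)%N.
  by move=> W t; case/orP: (leq_total (p a) (p b)) => h; [|apply/esym];
    apply: W; rewrite // together_sym.
move=> t; apply/eqP; rewrite eq_le; apply/andP; split; last first.
  by apply: (block_monotone _ t ab) => x y xy yS; rewrite (e x y).
rewrite -lerN2; apply: (@block_monotone (fun x => - f x) _ _ _ _ t ab) => x y xy yS.
by rewrite (e x y).
Qed.

(** Vanishing gaps mean that f is constant on blocks, and the blocks depend only on the class of the
    word. This makes coordinates taken along one word meaningful for the whole class. *)
Lemma gap_same_off f p q : same_off S p q -> (forall n, n \in S -> gap f p n = 0) ->
  forall n, n \in S -> gap f q n = 0.
Proof.
move=> pq g0 n nS; have /andP[n0 nr] := S_lt nS.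
have n1r : (n.-1 < r)%N by rewrite (leq_ltn_trans (leq_pred n)).
pose b := q^-1%g (Ordinal nr); pose a := q^-1%g (Ordinal n1r).
have qb : q b = n :> nat by rewrite permKV.
have qa : q b = (q a).+1 :> nat by rewrite qb permKV /= prednK.
rewrite -qb (gap_consecutive _ qa); apply/eqP; rewrite subr_eq0; apply/eqP.
apply: (block_const g0); rewrite (together_same_off _ _ pq).
by apply: together_cover => //; rewrite qb.
Qed.

(** These are exactly the sets that occur as a prefix of some word in the class of p. *)
Definition compatible p A : Prop :=
  forall n, n \notin S -> (A \subset initial_seg p n) || (initial_seg p n \subset A).

Lemma compatible_same_off p q A : same_off S p q -> compatible p A -> compatible q A.
Proof. by move=> pq cA n nS; rewrite -pq // cA. Qed.

Lemma compatible_initial_seg p q n : same_off S p q -> compatible q (initial_seg p n).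
Proof.
move=> pq m mS; rewrite -pq //.
by case/orP: (leq_total n m) => nm; rewrite (initial_seg_mono p nm) ?orbT.
Qed.

(* By concavity of h, exchanging two adjacent letters increases the functional. *)
Lemma functional_le p A (h : nat -> R) : (forall n, n \notin S -> h n = 0) ->
    (forall n, n \in S -> h n.-1 + h n.+1 < 2 * h n) -> compatible p A ->
    \sum_(a in A) (h (p a).+1 - h (p a)) <= h #|A| ?= iff (A == initial_seg p #|A|).
Proof.
move=> h0 hc; pose L B := \sum_(a in B) (h (p a).+1 - h (p a)).
have Lseg n : (n <= r)%N -> L (initial_seg p n) = h n.
  move=> nr; rewrite /L big_mkcond /=.
  rewrite (eq_bigr (fun a => chi (initial_seg p n) a * (h (p a).+1 - h (p a)))); last first.
    by move=> a _; rewrite /chi; case: ifP; rewrite ?mul1r ?mul0r.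
  rewrite sum_by_parts // (eq_bigr (fun k : 'I_r => if k == n :> nat then h k else 0)).
    rewrite -big_mkcondr /=; have [nS|nS] := boolP (n \in S); last first.
      by rewrite h0 // big1 // => k /andP[_ /eqP->]; apply: h0.
    have /andP[_ nr'] := S_lt nS.
    rewrite (big_pred1 (Ordinal nr')) // => k; rewrite inE /= -(inj_eq val_inj) /=.
    by case: eqP => [->|]; rewrite ?nS ?andbF.
  move=> k; rewrite inE => kS; rewrite gap_initial_seg ?S_lt //.
  by case: eqP; rewrite ?mulr1 ?mulr0.
have card_le B : (#|B| <= r)%N by rewrite -[leqRHS]card_ord max_card.
(* Induction on the sum of the positions occupied by A, which drops when a letter b of A is replaced
   by its left neighbour a outside A. *)
have [k] := ubnP (\sum_(a in A) p a)%N; elim: k A => // k IH A sA cA.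
have [eA|nA] := eqVneq A (initial_seg p #|A|).
  have := Lseg _ (card_le A); rewrite -eA => e; apply/leifP.
  by apply/eqP.
suff [B [cB eB sB ltB]] : exists B, [/\ compatible p B, #|B| = #|A|,
    (\sum_(a in B) p a < \sum_(a in A) p a)%N & L A < L B].
  apply/leifP; apply: lt_le_trans ltB _; rewrite -eB.
  have sB' : (\sum_(a in B) p a < k)%N by apply: leq_trans sB _; rewrite -ltnS.
  by case: (IH B sB' cB).
have [a [b [aA bA e]]] : exists a b, [/\ a \notin A, b \in A & p b = (p a).+1 :> nat].
  have [/existsP[a /existsP[b /and3P[aA bA /eqP e]]]|none] :=
    boolP [exists a, exists b, [&& a \notin A, b \in A & p b == (p a).+1 :> nat]].
    by exists a, b.
  case/eqP: nA; apply: initial_segP => b a bA aA; rewrite ltnNge leq_eqVlt.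
  apply/negP => /orP[/eqP/perm_nat_inj e|ab]; first by rewrite e bA in aA.
  suff notA n c : (p c < n)%N -> (p a <= p c)%N -> c \notin A.
    by move: (notA (p b).+1 b (ltnSn _) (ltnW ab)); rewrite bA.
  elim: n c => // n IHn c cn; rewrite leq_eqVlt => /orP[/eqP/perm_nat_inj <- //|ac].
  have lt1 : ((p c).-1 < r)%N by rewrite (leq_ltn_trans (leq_pred _)).
  pose c' := p^-1%g (Ordinal lt1); have pc' : p c' = (p c).-1 :> nat by rewrite permKV.
  have ec : p c = (p c').+1 :> nat by rewrite pc' prednK // (leq_ltn_trans _ ac).
  have c'A : c' \notin A by apply: IHn; rewrite -ltnS -ec.
  apply/negP=> mA; case/negP: none; apply/existsP; exists c'; apply/existsP; exists c.
  by rewrite c'A mA ec eqxx.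
(* If the cut between a and b were off S, its prefix would be incomparable with A, which contains b
   and misses a. *)
have bS : (p b : nat) \in S.
  apply: contraLR isT => /cA /orP[/subsetP/(_ b bA)|/subsetP/(_ a)]; rewrite inE ?ltnn //.
  by rewrite e ltnS leqnn (negbTE aA) => /(_ isT).
have ab : a != b by apply: contraNneq aA => ->.
exists (a |: A :\ b); split.
- move=> m mS; case/orP: (cA m mS) => sub; apply/orP; [left|right].
    apply/subsetP=> x; rewrite !inE => /orP[/eqP->|/andP[_ xA]]; last first.
      by have := subsetP sub x xA; rewrite inE.
    by have := subsetP sub b bA; rewrite inE e => /ltnW.
  have am : (m <= p a)%N by rewrite leqNgt; apply: contra aA => am; apply: (subsetP sub); rewrite inE.
  apply/subsetP=> x xm; have xA := subsetP sub x xm; rewrite !inE xA andbT.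
  apply/orP; right; apply/eqP=> xb; move: xm; rewrite xb inE e ltnNge.
  by rewrite leqW.
- by rewrite cardsU1 !inE ab aA /= add1n (cardsD1 b A) bA.
- rewrite big_setU1 ?inE ?ab ?(negbTE aA) //= (big_setD1 b bA) /=.
  by rewrite ltn_add2r e.
- rewrite /L big_setU1 ?inE ?ab ?(negbTE aA) //= (big_setD1 b bA) /= ltrD2r.
  by have := hc _ bS; rewrite e /= mulr2n mulrDl !mul1r; lra.
Qed.

Lemma block_sort w (lt : rel 'I_r) : irreflexive lt -> transitive lt ->
    (forall a b, a != b -> lt a b || lt b a) ->
  exists q, same_off S w q /\ forall a b, together w a b -> (q a < q b)%N = lt a b.
Proof.
move=> irr tr tot.
pose k a := #|[set n : 'I_r.+1 | ((n : nat) \notin S) && (n <= w a)%N]|.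
pose lt' a b := (k a < k b)%N || (k a == k b) && lt a b.
have k_lt a b n : n \notin S -> (w a < n)%N -> (n <= w b)%N -> (k a < k b)%N.
  move=> nS an nb; have nr : (n < r.+1)%N by rewrite ltnS (leq_trans nb) // ltnW.
  apply/proper_card/properP; split.
    apply/subsetP=> m; rewrite !inE => /andP[-> /leq_trans-> //].
    by rewrite (leq_trans (ltnW an)).
  by exists (Ordinal nr); rewrite !inE /= nS //= -ltnNge.
have [|||q qE] := @perm_of_order r lt'.
- by move=> a; rewrite /lt' ltnn irr andbF.
- move=> b a c; rewrite /lt' => /orP[ab|/andP[/eqP-> ab]] /orP[bc|/andP[/eqP <- bc]].
  + by rewrite (ltn_trans ab).
  + by rewrite ab.
  + by rewrite bc.
  + by rewrite eqxx (tr _ _ _ ab bc) orbT.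
- by move=> a b /tot; rewrite /lt'; case: ltngtP.
exists q; split=> [n nS|a b /togetherP t]; last first.
  rewrite qE /lt' (_ : k a = k b) ?ltnn ?eqxx //; apply: eq_card => n; rewrite !inE.
  case: (boolP (_ \in S)) => //= nS; have := t n nS; rewrite !inE.
  by case: ltnP => _; case: ltnP.
have [nr|rn] := leqP n r; last by rewrite !initial_seg_top // ltnW.
rewrite -[in RHS](card_initial_seg w nr); apply: initial_segP => a b.
by rewrite !inE -leqNgt qE /lt' => an nb; rewrite (k_lt _ _ n).
Qed.

End Gaps.

(** * Coordinates modulo block-constant functions, and the vertices of a sphere *)

Section Coordinates.
Variables (R : realType) (r : nat) (S : {pred nat}) (w : 'S_r).
Implicit Types (p q : 'S_r) (a b : 'I_r) (A B : {set 'I_r}) (f g : 'I_r -> R).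
Hypothesis S_lt : forall n, n \in S -> (0 < n < r)%N.
Local Notation cuts := (cuts r S).
Local Notation d := #|cuts|.

Definition nth_cut (k : 'I_d) : nat := enum_val k.

Lemma cut_in k : nth_cut k \in S.
Proof. by have := enum_valP k; rewrite inE. Qed.

Lemma cut_lt k : (0 < nth_cut k < r)%N. Proof. exact/S_lt/cut_in. Qed.

Lemma cut_inj : injective nth_cut.
Proof. by move=> j k /val_inj/enum_val_inj. Qed.

Lemma cut_ex n : n \in S -> exists k, nth_cut k = n.
Proof.
move=> nS; have /andP[_ nr] := S_lt nS.
have nc : Ordinal nr \in cuts by rewrite inE.
by exists (enum_rank_in nc (Ordinal nr)); rewrite /nth_cut enum_rankK_in.
Qed.

Lemma sum_cuts (F : nat -> R) : \sum_(n in cuts) F n = \sum_k F (nth_cut k).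
Proof. by rewrite big_enum_val. Qed.

(** Coordinates on the quotient by block-constant functions: the prefixes of w of lengths in S
    become the standard basis, and the prefixes off S become 0. *)
Definition row_of f : 'rV[R]_d := \row_k gap f w (nth_cut k).

Lemma eq_row_of f g : f =1 g -> row_of f = row_of g.
Proof. by move=> e; apply/rowP=> k; rewrite !mxE; apply: eq_gap. Qed.

Lemma row_ofD f g : row_of (fun a => f a + g a) = row_of f + row_of g.
Proof. by apply/rowP=> k; rewrite !mxE gapD. Qed.

Lemma row_of_seg n : row_of (chi R (initial_seg w n)) = \row_k (nth_cut k == n)%:R.
Proof. by apply/rowP=> k; rewrite !mxE gap_initial_seg ?cut_lt. Qed.

Lemma row_of_seg_out n : n \notin S -> row_of (chi R (initial_seg w n)) = 0.
Proof.
move=> nS; rewrite row_of_seg; apply/rowP=> k; rewrite !mxE; case: eqP => // e.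
by rewrite -e cut_in in nS.
Qed.

Lemma chiUI A B a : chi R A a + chi R B a = chi R (A :&: B) a + chi R (A :|: B) a.
Proof. by rewrite /chi !inE; case: (a \in A); case: (a \in B); rewrite /= ?addr0 ?add0r. Qed.

Lemma row_ofUI A B : row_of (chi R A) + row_of (chi R B) =
  row_of (chi R (A :&: B)) + row_of (chi R (A :|: B)).
Proof. by rewrite -!row_ofD; apply: eq_row_of => a; apply: chiUI. Qed.

Definition lift_fun (z : 'rV[R]_d) a : R := \sum_k z 0 k * chi R (initial_seg w (nth_cut k)) a.

Lemma gap_lift_fun z k : gap (lift_fun z) w (nth_cut k) = z 0 k.
Proof.
rewrite gap_sum (bigD1 k) //= big1 => [|l lk]; rewrite gapZ gap_initial_seg ?cut_lt //.
  by rewrite eqxx mulr1 addr0.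
by rewrite (inj_eq cut_inj) eq_sym (negbTE lk) mulr0.
Qed.

Lemma lift_funK z : row_of (lift_fun z) = z.
Proof. by apply/rowP=> k; rewrite mxE gap_lift_fun. Qed.

(** f and its lift have equal gaps along w, so their difference is constant on blocks and has zero
    gaps along every word of the class. *)
Lemma gap_lift_row f p n : same_off S w p -> n \in S ->
  gap (lift_fun (row_of f)) p n = gap f p n.
Proof.
move=> wp nS; apply/eqP; rewrite -subr_eq0 -gapN -gapD.
apply/eqP/(gap_same_off S_lt wp) => // m /cut_ex[k <-].
by rewrite gapD gapN gap_lift_fun mxE subrr.
Qed.

(** The linear form with value [h n] on the prefix of p of length n ([functional_seg]), written in
    the basis of prefixes of w. Vanishing of h off S lets it descend to the quotient. *)
Definition functional p (h : nat -> R) : 'cV[R]_d :=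
  \col_k \sum_(a in initial_seg w (nth_cut k)) (h (p a).+1 - h (p a)).

Lemma functionalE f p h : same_off S w p -> (forall n, n \notin S -> h n = 0) ->
  (row_of f *m functional p h) 0 0 = \sum_a f a * (h (p a).+1 - h (p a)).
Proof.
move=> wp h0; rewrite (sum_by_parts S_lt) //.
have -> : \sum_(n in cuts) h n * gap f p n = \sum_(n in cuts) h n * gap (lift_fun (row_of f)) p n.
  by apply: eq_bigr => n; rewrite inE => nS; rewrite gap_lift_row.
rewrite -(sum_by_parts S_lt) // /lift_fun mxE.
under [RHS]eq_bigr do rewrite mulr_suml.
rewrite exchange_big; apply: eq_bigr => k _; rewrite [functional _ _ _ _]mxE mulr_sumr.
rewrite big_mkcond; apply: eq_bigr => a _; rewrite /chi.
by case: ifP => _; rewrite ?mulr1 // mulr0 mul0r.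
Qed.

Lemma functional_chi A p h : same_off S w p -> (forall n, n \notin S -> h n = 0) ->
  (row_of (chi R A) *m functional p h) 0 0 = \sum_(a in A) (h (p a).+1 - h (p a)).
Proof.
move=> wp h0; rewrite functionalE // [RHS]big_mkcond; apply: eq_bigr => a _.
by rewrite /chi; case: ifP; rewrite ?mul1r ?mul0r.
Qed.

Lemma functional_seg n p h : same_off S w p -> (forall m, m \notin S -> h m = 0) ->
  (row_of (chi R (initial_seg p n)) *m functional p h) 0 0 = h n.
Proof.
move=> wp h0; rewrite functionalE // (sum_by_parts S_lt) //.
rewrite (sum_cuts (fun m => h m * gap (chi R (initial_seg p n)) p m)).
rewrite (eq_bigr (fun k => if nth_cut k == n then h n else 0)); last first.
  move=> k _; rewrite gap_initial_seg ?cut_lt //.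
  by case: eqP => [->|_]; rewrite ?mulr1 ?mulr0.
rewrite -big_mkcond /=; have [nS|nS] := boolP (n \in S); last first.
  by rewrite h0 // big1 // => k _; rewrite h0.
have [k kn] := cut_ex nS; rewrite (big_pred1 k) // => l.
by rewrite -kn (inj_eq cut_inj).
Qed.

Definition verts : {set {set 'I_r}} := [set A : {set 'I_r} | (#|A| \in S) &&
  [forall n : 'I_r.+1, ((n : nat) \in S) || (A \subset initial_seg w n) || (initial_seg w n \subset A)]].

Lemma vertsP A : reflect (#|A| \in S /\ compatible S w A) (A \in verts).
Proof.
rewrite inE; apply: (iffP andP) => -[cA].
  move=> /forallP h; split=> // n nS; have [nr|rn] := leqP n r.
    by have := h (Ordinal (nr : (n < r.+1)%N)); rewrite /= (negbTE nS).
  by rewrite initial_seg_top ?subsetT // ltnW.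
by move=> h; split=> //; apply/forallP=> n; case: (boolP (_ \in S)) => //= /h.
Qed.

Lemma verts_seg p n : same_off S w p -> n \in S -> initial_seg p n \in verts.
Proof.
move=> wp nS; apply/vertsP; have /andP[_ nr] := S_lt nS.
rewrite card_initial_seg ?(ltnW nr) //; split=> //.
by apply: compatible_initial_seg; apply: same_off_sym.
Qed.

(** By compatibility the chain stays a chain when the prefixes of w off S are added, and a word
    through all of these sets belongs to the class of w. *)
Lemma verts_chain (F : {set {set 'I_r}}) : F \subset verts ->
    {in F &, forall A B, (A \subset B) || (B \subset A)} ->
  exists2 p, same_off S w p & forall A, A \in F -> A = initial_seg p #|A|.
Proof.
move=> /subsetP FV chF.
pose G := F :|: [set initial_seg w n | n : 'I_r.+1 & (n : nat) \notin S].
have [|p [pG _]] := @chain_extension r G.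
  move=> A B /setUP[AF|/imsetP[m mS ->]] /setUP[BF|/imsetP[n nS ->]].
  - exact: chF.
  - by have /vertsP[_ ->] := FV _ AF; last by move: nS; rewrite inE.
  - by rewrite orbC; have /vertsP[_ ->] := FV _ BF; last by move: mS; rewrite inE.
  - by case/orP: (leq_total m n) => h; rewrite (initial_seg_mono w h) ?orbT.
exists p; last by move=> A AF; apply: pG; rewrite inE AF.
move=> n nS; have [nr|rn] := leqP n r; last by rewrite !initial_seg_top // ltnW.
rewrite {1}(pG (initial_seg w n)) ?card_initial_seg // inE; apply/orP; right.
by apply/imsetP; exists (Ordinal (nr : (n < r.+1)%N)); rewrite ?inE.
Qed.

(** Compatible sets are closed under intersection. If the intersection has a size off S, it is the
    prefix of w of that size, which is 0 in the quotient. *)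
Lemma verts_meet A B : A \in verts -> B \in verts ->
  A :&: B \in verts \/ row_of (chi R (A :&: B)) = 0 /\ #|A :&: B| \notin S.
Proof.
move=> /vertsP[_ cA] /vertsP[_ cB].
have cI : compatible S w (A :&: B).
  move=> n nS; case/orP: (cA n nS) => sA.
    by rewrite (subset_trans (subsetIl A B) sA).
  case/orP: (cB n nS) => sB; first by rewrite (subset_trans (subsetIr A B) sB).
  by rewrite subsetI sA sB orbT.
have [IS|nS] := boolP (#|A :&: B| \in S); first by left; apply/vertsP.
right; split=> //; rewrite (_ : A :&: B = initial_seg w #|A :&: B|); first exact: row_of_seg_out.
have cr : (#|A :&: B| <= r)%N by rewrite -[leqRHS]card_ord max_card.
case/orP: (cI _ nS) => sub; apply/eqP; [|rewrite eq_sym]; rewrite eqEcard sub /=;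
  by rewrite card_initial_seg.
Qed.

Lemma verts_join A B : A \in verts -> B \in verts ->
  A :|: B \in verts \/ row_of (chi R (A :|: B)) = 0 /\ #|A :|: B| \notin S.
Proof.
move=> /vertsP[_ cA] /vertsP[_ cB].
have cI : compatible S w (A :|: B).
  move=> n nS; case/orP: (cA n nS) => sA; last first.
    by rewrite (subset_trans sA (subsetUl A B)) orbT.
  case/orP: (cB n nS) => sB; last by rewrite (subset_trans sB (subsetUr A B)) orbT.
  by rewrite subUset sA sB.
have [IS|nS] := boolP (#|A :|: B| \in S); first by left; apply/vertsP.
right; split=> //; rewrite (_ : A :|: B = initial_seg w #|A :|: B|); first exact: row_of_seg_out.
have cr : (#|A :|: B| <= r)%N by rewrite -[leqRHS]card_ord max_card.
case/orP: (cI _ nS) => sub; apply/eqP; [|rewrite eq_sym]; rewrite eqEcard sub /=;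
  by rewrite card_initial_seg.
Qed.

(* The witness is the complement of A inside its block. *)
Lemma verts_opposite A : A \in verts ->
  exists2 B, B \in verts & row_of (chi R B) = - row_of (chi R A).
Proof.
move=> /vertsP[AS cA]; set k := #|A| in AS *; have /andP[k0 kr] := S_lt AS.
have z0 : 0%N \notin S by apply/negP => /S_lt; rewrite ltnn.
have rS : r \notin S by apply/negP => /S_lt; rewrite ltnn andbF.
have ex0 : exists m, (m <= k)%N && (m \notin S) by exists 0%N.
have ub m : (m <= k)%N && (m \notin S) -> (m <= k)%N by case/andP.
have ex1 : exists m, (k <= m)%N && (m \notin S) by exists r; rewrite (ltnW kr).
(* [n0] and [n1] are the two ends of the block in which A stops; they exist because 0 and r are off
   S. *)
case: (ex_maxnP ex0 ub) => n0 /andP[n0k n0S] max0.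
case: (ex_minnP ex1) => n1 /andP[kn1 n1S] min1.
have n0k' : (n0 < k)%N by rewrite ltn_neqAle n0k andbT; apply: contraNneq n0S => ->.
have kn1' : (k < n1)%N by rewrite ltn_neqAle kn1 andbT; apply: contraNneq n1S => <-.
have n1r : (n1 <= r)%N by apply: min1; rewrite (ltnW kr).
have betw m : m \notin S -> (m <= n0)%N || (n1 <= m)%N.
  by move=> mS; case/orP: (leq_total m k) => h; [rewrite max0 ?h|rewrite min1 ?h ?orbT].
have s0 : initial_seg w n0 \subset A.
  case/orP: (cA _ n0S) => // /subset_leq_card.
  by rewrite card_initial_seg ?(leq_trans n0k (ltnW kr)) // leqNgt n0k'.
have s1 : A \subset initial_seg w n1.
  case/orP: (cA _ n1S) => // /subset_leq_card.
  by rewrite card_initial_seg // leqNgt kn1'.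
have s01 := subset_trans s0 s1.
pose B := initial_seg w n0 :|: (initial_seg w n1 :\: A).
have ind a : chi R B a + chi R A a =
    chi R (initial_seg w n0) a + chi R (initial_seg w n1) a.
  have := subsetP s0 a; have := subsetP s1 a; rewrite /chi /B in_setU in_setD.
  case: (a \in A); case: (a \in initial_seg w n0); case: (a \in initial_seg w n1) => /= h1 h0;
    rewrite ?addr0 ?add0r //; by [move: (h1 isT) | move: (h0 isT)].
exists B; last first.
  apply/eqP; rewrite -subr_eq0 opprK -row_ofD (eq_row_of ind) row_ofD.
  by rewrite !row_of_seg_out ?addr0.
have cB : #|B| = (n0 + (n1 - k))%N.
  rewrite /B cardsU (_ : _ :&: _ = set0) ?cards0 ?subn0.
    rewrite card_initial_seg ?(leq_trans n0k (ltnW kr)) // cardsD (setIidPr s1).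
    by rewrite card_initial_seg.
  apply/eqP; rewrite setIDA setD_eq0; apply: subset_trans s0; exact: subsetIl.
apply/vertsP; split.
  apply/negPn/negP => /betw; rewrite cB; lia.
move=> m /betw /orP[h|h].
  apply/orP; right; apply: subset_trans (initial_seg_mono w h) _; exact: subsetUl.
apply/orP; left; apply: subset_trans (initial_seg_mono w h).
by rewrite subUset s01 subsetDl.
Qed.

End Coordinates.

(** * The polytope *)

Lemma is_face_vertices (R : realType) (I : finType) (d : nat) (v : I -> 'rV[R]_d) (F : {set I}) :
  is_face v F <-> exists (a : 'cV[R]_d) (b : R),
    (forall i, (v i *m a) 0 0 <= b) /\ (forall i, (i \in F) = ((v i *m a) 0 0 == b)).
Proof.
split=> -[a [b [h e]]]; exists a, b; split=> //.
  move=> i; apply: h; exists (fun j => (j == i)%:R); split.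
  - by move=> j; rewrite ler0n.
  - by rewrite (bigD1 i) //= eqxx big1 ?addr0 // => j /negbTE->.
  - rewrite (bigD1 i) //= eqxx scale1r big1 ?addr0 // => j /negbTE->.
    by rewrite scale0r.
move=> x [c [c0 c1 ->]]; rewrite mulmx_suml summxE -[b]mul1r -c1 mulr_suml.
by apply: ler_sum => i _; rewrite -scalemxAl mxE ler_wpM2l.
Qed.

Section Heights.
Variables (R : realFieldType) (r : nat) (S : {pred nat}).
Hypothesis S_lt : forall n, n \in S -> (0 < n < r)%N.

(* Strict concavity on S makes the faces exactly the chains. *)
Definition height (k : nat) : R :=
  if k \in S then r%:R ^+ 2 + k%:R * (r%:R - k%:R) else 0.

Lemma height_out k : k \notin S -> height k = 0.
Proof. by rewrite /height => /negbTE->. Qed.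

Lemma cast_bounds k : k \in S -> 1 <= k%:R :> R /\ k%:R + 1 <= r%:R :> R.
Proof. by move=> /S_lt/andP[k0 kr]; rewrite natr1 ler_nat ler1n. Qed.

Lemma height_ge1 k : k \in S -> 1 <= height k.
Proof.
by move=> kS; have := cast_bounds kS; rewrite /height kS => -[h1 h2]; nra.
Qed.

Lemma height_gt0 k : k \in S -> 0 < height k.
Proof. by move/height_ge1; apply: lt_le_trans. Qed.

(** With both neighbours in S this is an equality; a neighbour off S has height 0 and only lowers
    the left side. The slack 2 is a reserve for [lowered], which spends at most 1 of it. *)
Lemma height_concave k : k \in S -> height k.-1 + height k.+1 <= 2 * height k - 2.
Proof.
move=> kS; have [k1 kr] := cast_bounds kS; rewrite {3}/height kS.
have /andP[k0 _] := S_lt kS.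
have e1 : k.-1%:R = k%:R - 1 :> R by rewrite -[in RHS](prednK k0) -natr1 addrK.
have e2 : k.+1%:R = k%:R + 1 :> R by rewrite natr1.
rewrite /height e1 e2; move: (k%:R) (r%:R) k1 kr => x y x1 xy {e1 e2 k0}.
have : 0 <= (x - 1) * (y - 1 - x) by apply: mulr_ge0; lra.
by case: ifP => _; case: ifP => _ h; nra.
Qed.

(** If k' and l' are both in S, this is strict concavity. Otherwise the summand [r^2] of [height]
    decides: k(r - k) is at most r^2/4, so a single height on the left stays below the two on the
    right. *)
Lemma height_submodular k l k' l' : k \in S -> l \in S -> (k + l = k' + l')%N ->
  (k' < k)%N -> (k' < l)%N -> height k' + height l' < height k + height l.
Proof.
move=> kS lS e k'k k'l; have [k1 kr] := cast_bounds kS; have [l1 lr] := cast_bounds lS.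
have eR : l'%:R = k%:R + l%:R - k'%:R :> R by rewrite -natrD e natrD addrAC subrr add0r.
have h1 : 0 < k%:R - k'%:R :> R by rewrite subr_gt0 ltr_nat.
have h2 : 0 < l%:R - k'%:R :> R by rewrite subr_gt0 ltr_nat.
have h3 : 0 <= k'%:R :> R by rewrite ler0n.
rewrite /height kS lS eR; move: (k%:R) (l%:R) (k'%:R) (r%:R) k1 kr l1 lr h1 h2 h3.
move=> x y z t x1 xt y1 yt zx zy z0 {eR}.
have p1 : 0 < (x - z) * (y - z) by apply: mulr_gt0.
have p2 : 0 < x * (t - x) by apply: mulr_gt0; lra.
have p3 : 0 < y * (t - y) by apply: mulr_gt0; lra.
(* The bounds z(t - z) <= t^2/4 for z = k' and for l' in its place. *)
have p4 := sqr_ge0 (t - 2 * z); have p5 := sqr_ge0 (t - 2 * (x + y - z)).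
by case: ifP => _; case: ifP => _; nra.
Qed.

(* The functional with these values is maximal exactly on the vertices of a given
   chain, whose sizes are those outside P. *)
Definition lowered (P : pred nat) k : R := height k - ((k \in S) && P k)%:R / 2.

Lemma lowered_out P k : k \notin S -> lowered P k = 0.
Proof. by move=> kS; rewrite /lowered height_out // (negbTE kS) mul0r subr0. Qed.

Lemma lowered_le P k : lowered P k <= height k.
Proof. by rewrite /lowered gerBl divr_ge0 ?ler0n. Qed.

Lemma lowered_concave P k : k \in S -> lowered P k.-1 + lowered P k.+1 < 2 * lowered P k.
Proof.
move=> kS; have h1 := height_concave kS; have h2 := lowered_le P k.-1; have h3 := lowered_le P k.+1.
have : height k - 1 / 2 <= lowered P k by rewrite /lowered; case: (_ && _) => /=; lra.
lra.
Qed.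

End Heights.

Section Polytope.
Variables (R : realType) (r : nat) (S : {pred nat}) (w : 'S_r).
Implicit Types (p q : 'S_r) (A B : {set 'I_r}).
Hypothesis S_lt : forall n, n \in S -> (0 < n < r)%N.
Hypothesis S_neq0 : exists n, n \in S.
Local Notation cuts := (cuts r S).
Local Notation d := #|cuts|.
Local Notation row_of := (@row_of R r S w).
Local Notation height := (height R r S).
Local Notation verts := (verts S w).
Variables (n : nat) (V : 'I_n -> {set 'I_r}).
Hypothesis V_inj : injective V.
Hypothesis V_verts : forall i, V i \in verts.
Hypothesis V_surj : forall A, A \in verts -> exists i, V i = A.

(** Dividing by the height turns the inequalities [functional <= height], whose bound varies with
    the size, into one inequality with bound 1. *)
Definition point i : 'rV[R]_d := (height #|V i|)^-1 *: row_of (chi R (V i)).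

Let card_V i : #|V i| \in S. Proof. by case/vertsP: (V_verts i). Qed.

Lemma point_mul i (a : 'cV[R]_d) (b : R) :
  ((point i *m a) 0 0 <= b) = ((row_of (chi R (V i)) *m a) 0 0 <= b * height #|V i|).
Proof. by rewrite -scalemxAl mxE ler_pdivrMl ?height_gt0 // mulrC. Qed.

Lemma point_mul_eq i (a : 'cV[R]_d) (b : R) :
  ((point i *m a) 0 0 == b) = ((row_of (chi R (V i)) *m a) 0 0 == b * height #|V i|).
Proof.
rewrite -scalemxAl mxE; have h0 : height #|V i| != 0 by rewrite gt_eqF ?height_gt0.
by apply/eqP/eqP => [<-|->]; field.
Qed.

Definition V_chain (F : {set 'I_n}) : Prop :=
  {in F &, forall i j, (V i \subset V j) || (V j \subset V i)}.

Lemma V_chain_seg F : V_chain F ->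
  exists2 p, same_off S w p & forall i, i \in F -> V i = initial_seg p #|V i|.
Proof.
move=> chF; have [||p wp pV] := @verts_chain r S w [set V i | i in F].
- by apply/subsetP=> _ /imsetP[i _ ->]; apply: V_verts.
- by move=> _ _ /imsetP[i iF ->] /imsetP[j jF ->]; apply: chF.
by exists p => // i iF; apply: pV; apply: imset_f.
Qed.

(** Take the form of a word p through the chain, with heights lowered at the lengths that F does not
    use. By [functional_le] a vertex attains its height only as a prefix of p, and then only at a
    length that is not lowered. *)
Lemma chain_face F : V_chain F -> is_face point F.
Proof.
case/V_chain_seg => p wp pV; apply/is_face_vertices.
pose P k := initial_seg p k \notin [set V i | i in F].
pose h := lowered R r S P.
have h0 k : k \notin S -> h k = 0 by apply: lowered_out.
exists (functional S w p h), 1; have le i : (row_of (chi R (V i)) *m functional S w p h) 0 0 <=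
    h #|V i| ?= iff (V i == initial_seg p #|V i|).
  rewrite (functional_chi S_lt) //; apply: (functional_le S_lt) => //.
    exact: lowered_concave.
  by apply: compatible_same_off wp _; case/vertsP: (V_verts i).
split=> i.
  by rewrite point_mul mul1r; apply: le_trans (le i).1 (lowered_le _ _ _ _ _).
rewrite point_mul_eq mul1r; apply/idP/eqP => [iF|e].
  apply/eqP; rewrite (_ : height _ = h #|V i|); last first.
    by rewrite /h /lowered /P -pV // imset_f // andbF mul0r subr0.
  by rewrite (le i).2 -pV.
have eh : h #|V i| = height #|V i|.
  by apply/eqP; rewrite eq_le lowered_le /= -e (le i).1.
have /eqP ei : V i == initial_seg p #|V i| by rewrite -(le i).2 e eh.
case: (boolP (P #|V i|)) => [Pi|].
  by move: eh; rewrite /h /lowered card_V Pi /=; lra.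
by rewrite /P -ei => /negPn/imsetP[j jF /V_inj->].
Qed.

(** A linear form is modular on indicators, L(A) + L(B) = L(A meet B) + L(A join B), while the
    heights are strictly larger on an incomparable pair than on its meet and join. So two
    incomparable vertices cannot both attain the bound. *)
Lemma face_chain F : is_face point F -> F != setT -> V_chain F.
Proof.
move=> /is_face_vertices[a [b [valid eF]]] FT; pose L A := (row_of (chi R A) *m a) 0 0.
have le i : L (V i) <= b * height #|V i| by rewrite -point_mul.
have opp i : exists2 j, L (V j) = - L (V i) & true.
  have [B BV eB] := verts_opposite R S_lt (V_verts i); have [j jB] := V_surj BV.
  by exists j => //; rewrite /L jB eB mulNmx mxE.
(* The inequalities at a vertex and at its opposite add up to [0 <= b]; for [b = 0] they are
   equalities everywhere and F is the whole vertex set. *)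
have b0 : 0 < b.
  have [i0 _] : exists i : 'I_n, i \notin F.
    by apply/existsP; rewrite -negb_forall; apply: contra FT => /forallP h; apply/eqP/setP=> i; rewrite inE h.
  have bge : 0 <= b.
    have [j ej _] := opp i0; have := le i0; have := le j; rewrite ej.
    have h1 := height_gt0 R S_lt (card_V i0); have h2 := height_gt0 R S_lt (card_V j).
    move=> h3 h4; have : 0 <= b * (height #|V i0| + height #|V j|) by rewrite mulrDr; lra.
    by rewrite pmulr_lge0 // addr_gt0.
  rewrite lt_neqAle bge andbT; apply: contra FT => /eqP be; apply/eqP/setP => i.
  rewrite inE eF point_mul_eq -be mul0r.
  have [j ej _] := opp i; have := le i; have := le j; rewrite ej -/(L _) -be !mul0r.
  by move=> h1 h2; apply/eqP; rewrite -/(L (V i)); lra.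
(* A meet or join that is no vertex still satisfies the inequality, as both sides are 0. *)
have leV A : A \in verts \/ row_of (chi R A) = 0 /\ #|A| \notin S -> L A <= b * height #|A|.
  case=> [/V_surj[i <-]|[e cA]]; first exact: le.
  by rewrite /L e mul0mx mxE height_out // mulr0.
move=> i j iF jF; apply/negPn/negP; rewrite negb_or => /andP[nij nji].
have Li : L (V i) = b * height #|V i| by apply/eqP; rewrite -point_mul_eq -eF.
have Lj : L (V j) = b * height #|V j| by apply/eqP; rewrite -point_mul_eq -eF.
have mod : L (V i) + L (V j) = L (V i :&: V j) + L (V i :|: V j).
  have := row_ofUI R S w (V i) (V j) => /(congr1 (fun z => (z *m a) 0 0)).
  by rewrite !mulmxDl [LHS]mxE [RHS]mxE.
have := leV _ (verts_meet R S_lt (V_verts i) (V_verts j)).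
have := leV _ (verts_join R S_lt (V_verts i) (V_verts j)).
have cUI := cardsUI (V i) (V j).
have ltI : (#|V i :&: V j| < #|V i|)%N.
  by apply: proper_card; rewrite properE subsetIl subsetI subxx.
have ltJ : (#|V i :&: V j| < #|V j|)%N.
  by apply: proper_card; rewrite properE subsetIr subsetI subxx andbT.
have eUI : (#|V i| + #|V j| = #|V i :&: V j| + #|V i :|: V j|)%N by rewrite -cUI addnC.
have := height_submodular R S_lt (card_V i) (card_V j) eUI ltI ltJ.
rewrite -(ltr_pM2l b0) !mulrDr -Li -Lj mod => h1 h2 h3.
by move: h1; rewrite ltNge; lra.
Qed.

(** The form dual to one prefix of p is nonnegative on all prefixes of p, but it is -1 on the
    opposite of that prefix, which is also a vertex. *)
Lemma V_chain_neqT F : V_chain F -> F != setT.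
Proof.
move=> /V_chain_seg[p wp pV]; apply/eqP=> FT; subst F.
have [m mS] := S_neq0.
have [i Vi] := V_surj (verts_seg S_lt wp mS).
have [B BV eB] := verts_opposite R S_lt (V_verts i); have [j jB] := V_surj BV.
have := functional_seg S_lt m wp (h := fun k => (k == m)%:R : R).
move=> h; have {h} /h hm : forall k, k \notin S -> (k == m)%:R = 0 :> R.
  by move=> k; case: eqP => // ->; rewrite mS.
have := functional_seg S_lt #|V j| wp (h := fun k => (k == m)%:R : R).
move=> h; have {h} /h hj : forall k, k \notin S -> (k == m)%:R = 0 :> R.
  by move=> k; case: eqP => // ->; rewrite mS.
move: hj; rewrite -pV ?inE // jB eB mulNmx [X in X = _]mxE Vi hm eqxx.
by case: eqP => _ /= h; have : (0 : R) < 1 by []; lra.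
Qed.

(** The vertices are prefixes of one word p, and the form dual to a prefix isolates its
    coefficient. *)
Lemma chain_independent F : V_chain F -> affinely_independent point F.
Proof.
move=> /V_chain_seg[p wp pV] c _ c0 i iF.
pose h k : R := (k == #|V i|)%:R.
have h0 k : k \notin S -> h k = 0 by rewrite /h; case: eqP => // ->; rewrite card_V.
have term j : j \in F -> (c j *: point j *m functional S w p h) 0 0 =
    c j * ((height #|V j|)^-1 * h #|V j|).
  move=> jF; rewrite -!scalemxAl [LHS]mxE [X in _ * X]mxE.
  by rewrite {2}(pV j jF) (functional_seg S_lt _ wp h0).
have /(congr1 (fun z => (z *m functional S w p h) 0 0)) := c0.
rewrite mulmx_suml summxE mul0mx [RHS]mxE (bigD1 i) //= big1 => [|j /andP[jF ji]].
  rewrite addr0 term // /h eqxx mulr1.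
  by move/eqP; rewrite mulf_eq0 invr_eq0 (gt_eqF (height_gt0 R S_lt (card_V i))) orbF => /eqP.
rewrite term // /h; case: eqP => [e|_]; last by rewrite !mulr0.
by case/eqP: ji; apply: V_inj; rewrite (pV i) // (pV j) // e.
Qed.

(** The prefixes of w give a linear basis up to scaling. The origin lies on the segment between a
    vertex and its opposite, so the total weight of a combination can be corrected to 1 there
    without moving the point. *)
Lemma points_spanning : affinely_spanning point.
Proof.
have wS k : k \in S -> exists i, V i = initial_seg w k.
  by move=> kS; apply: V_surj; apply: verts_seg.
have [m mS] := S_neq0; have [i0 Vi0] := wS m mS.
have [B BV eB] := verts_opposite R S_lt (V_verts i0); have [j0 jB] := V_surj BV.
pose h1 := height #|V i0|; pose h2 := height #|V j0|.
have h10 : 0 < h1 by apply: height_gt0. have h20 : 0 < h2 by apply: height_gt0.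
have zero : (h1 / (h1 + h2)) *: point i0 + (h2 / (h1 + h2)) *: point j0 = 0.
  rewrite /point -/h1 -/h2 jB eB !scalerA scalerN -scalerBl.
  by rewrite (_ : _ - _ = 0) ?scale0r //; field; rewrite !gt_eqF ?addr_gt0.
have idx k : {i | V i = initial_seg w (@nth_cut r S k)}.
  by apply: cid; apply/wS/cut_in.
move=> x; pose c i := \sum_k (if sval (idx k) == i then x 0 k * height (nth_cut k) else 0).
have cx : x = \sum_i c i *: point i.
  rewrite /c (eq_bigr (fun i => \sum_k (if sval (idx k) == i then x 0 k * height (nth_cut k) else 0) *: point i)); last first.
    by move=> i _; rewrite scaler_suml.
  rewrite exchange_big /=; apply/rowP=> l.
  have pk k : \sum_i (if sval (idx k) == i then x 0 k * height (nth_cut k) else 0) *: point i =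
      x 0 k *: (\row_j (nth_cut j == nth_cut k)%:R).
    rewrite (bigD1 (sval (idx k))) //= eqxx big1 ?addr0 => [|i /negbTE]; last first.
      by rewrite eq_sym => ->; rewrite scale0r.
    have /andP[_ kr] := cut_lt S_lt k.
    rewrite /point (svalP (idx k)) card_initial_seg ?(ltnW kr) // (row_of_seg _ _ S_lt) scalerA.
    by rewrite mulfK // gt_eqF ?height_gt0 ?cut_in.
  rewrite (eq_bigr _ (fun k _ => pk k)) summxE (bigD1 l) //= big1 => [|k kl].
    by rewrite !mxE eqxx mulr1 addr0.
  by rewrite !mxE (inj_eq (@cut_inj _ _)) eq_sym (negbTE kl) mulr0.
pose s := \sum_i c i.
exists (fun i => c i + (1 - s) * ((i == i0)%:R * (h1 / (h1 + h2)) + (i == j0)%:R * (h2 / (h1 + h2)))).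
have pick (k : 'I_n) (M : lmodType R) (u : 'I_n -> M) : \sum_i (i == k)%:R *: u i = u k.
  by rewrite (bigD1 k) //= eqxx scale1r big1 ?addr0 // => i /negbTE->; rewrite scale0r.
split.
  rewrite big_split /= -mulr_sumr -/s big_split /= -!mulr_suml.
  have one k : \sum_(i < n) (i == k)%:R = 1 :> R.
    by rewrite (bigD1 k) //= eqxx big1 ?addr0 // => i /negbTE->.
  by rewrite !one; field; rewrite gt_eqF ?addr_gt0.
rewrite (eq_bigr (fun i => c i *: point i + (1 - s) *:
   ((i == i0)%:R *: ((h1 / (h1 + h2)) *: point i) + (i == j0)%:R *: ((h2 / (h1 + h2)) *: point i)))).
  by rewrite big_split /= -cx -scaler_sumr big_split /= !pick zero scaler0 addr0.
move=> i _; rewrite [LHS]scalerDl; congr (_ + _); rewrite -[LHS]scalerA; congr (_ *: _).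
by rewrite [LHS]scalerDl !scalerA.
Qed.

Lemma simplicial_points : simplicial_polytope point.
Proof.
split; first exact: points_spanning.
  by move=> i; apply: chain_face => j k; rewrite !inE => /eqP-> /eqP->; rewrite subxx.
by move=> F fF FT; apply: chain_independent; apply: face_chain.
Qed.

Lemma boundary_pointsP F : reflect (V_chain F) (F \in boundary_complex point).
Proof.
rewrite inE; apply: (iffP andP) => [[/asboolP fF FT]|chF]; first exact: face_chain.
by split; [apply/asboolP/chain_face | apply: V_chain_neqT].
Qed.

End Polytope.

(** * The cone of an up-set of words *)

Section Cone.
Variables (R : realType) (r : nat) (S : {pred nat}) (w : 'S_r) (P : {pred 'S_r}).
Implicit Types (p q : 'S_r) (a b : 'I_r) (A B : {set 'I_r}).
Hypothesis S_lt : forall n, n \in S -> (0 < n < r)%N.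
Hypothesis w_desc : descends_exactly_on S w.
Hypothesis P_off : forall p, p \in P -> same_off S w p.
Hypothesis P_up : forall p q, p \in P -> same_off S w q -> weak_le p q -> q \in P.
Hypothesis P_neq0 : exists p, p \in P.
Hypothesis P_descent : forall p, p \in P ->
  exists a b, [/\ p b = (p a).+1 :> nat, (p b : nat) \in S & (b < a)%N].
Local Notation cuts := (cuts r S).
Local Notation d := #|cuts|.
Local Notation row_of := (@row_of R r S w).
Local Notation liftw := (@lift_fun R r S w).

(** The closed chamber of p: the represented function weakly decreases along p inside each block. *)
Definition sorts p (z : 'rV[R]_d) : Prop :=
  forall a b, p b = (p a).+1 :> nat -> (p b : nat) \in S -> liftw z b <= liftw z a.

Definition in_cone (z : 'rV[R]_d) : Prop := exists2 p, p \in P & sorts p z.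

Lemma sorts_gap p z n : sorts p z -> n \in S -> 0 <= gap (liftw z) p n.
Proof.
move=> sp nS; have /andP[n0 nr] := S_lt nS.
have n1r : (n.-1 < r)%N by rewrite (leq_ltn_trans (leq_pred n)).
pose b := p^-1%g (Ordinal nr); pose a := p^-1%g (Ordinal n1r).
have pb : p b = n :> nat by rewrite permKV.
have pa : p b = (p a).+1 :> nat by rewrite pb permKV /= prednK.
by rewrite -pb (gap_consecutive _ pa) subr_ge0 sp // pb.
Qed.

Lemma gap_sorts p z : (forall n, n \in S -> 0 <= gap (liftw z) p n) -> sorts p z.
Proof. by move=> h a b ab bS; rewrite -subr_ge0 -(gap_consecutive _ ab) h. Qed.

Lemma in_cone0 : in_cone 0.
Proof.
have [p pP] := P_neq0; exists p => // a b _ _.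
by rewrite /lift_fun !big1 // => k _; rewrite mxE mul0r.
Qed.

Lemma lift_funZ t z c : liftw (t *: z) c = t * liftw z c.
Proof. by rewrite /lift_fun mulr_sumr; apply: eq_bigr => k _; rewrite mxE mulrA. Qed.

Lemma in_cone_scale t z : 0 < t -> in_cone z -> in_cone (t *: z).
Proof.
move=> t0 [p pP sp]; exists p => // a b ab bS.
by rewrite !lift_funZ ler_pM2l // sp.
Qed.

Lemma w_block a b : together S w a b -> (a < b)%N -> (w b < w a)%N.
Proof.
move=> t ab; have [lt|//|/perm_nat_inj e] := ltngtP (w a) (w b); last first.
  by rewrite e ltnn in ab.
suff : (b < a)%N by rewrite ltnNge ltnW.
by apply: (descends_between w_desc lt) => m /andP[am mb]; apply: together_cuts t am mb.
Qed.

(** Raising a coordinate adds a positive multiple of the indicator of a prefix of w. Since w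
    descends inside blocks, a larger letter of a block gains at least as much as a smaller one. So
    inversions of a word sorting y persist in a suitable word sorting z, which is then higher in the
    weak order. *)
Lemma in_cone_up (y z : 'rV[R]_d) : (forall k, y 0 k <= z 0 k) -> in_cone y -> in_cone z.
Proof.
move=> yz [p pP sp].
(* Ties go to the larger letter, which gives q as many inversions as z allows. *)
pose lt a b := (liftw z b < liftw z a) || (liftw z a == liftw z b) && (b < a)%N.
have [|||q [wq qE]] := @block_sort r S w lt.
- by move=> a; rewrite /lt ltxx ltnn andbF.
- move=> b a c; rewrite /lt; move: (liftw z a) (liftw z b) (liftw z c) => x u v.
  case/orP=> [ux|/andP[/eqP-> ba]] /orP[vu|/andP[/eqP<- cb]].
  + by rewrite (lt_trans vu ux).
  + by rewrite ux.
  + by rewrite vu.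
  + by rewrite eqxx (ltn_trans cb ba) orbT.
- move=> a b; rewrite /lt -(inj_eq val_inj) /= eq_sym.
  by case: ltgtP => //= _; rewrite neq_ltn orbC.
exists q; last first.
  move=> a b ab bS; have : (q a < q b)%N by rewrite ab.
  have t : together S w a b by rewrite (together_same_off a b wq); apply: together_cover.
  by rewrite qE // /lt => /orP[/ltW//|/andP[/eqP-> _]].
apply: (P_up pP wq) => a b ab ba.
have wp := P_off pP; have [t|nt] := boolP (together S w a b); last first.
  rewrite (together_same_off a b wp) together_sym in nt.
  have [n [nS bn na]] := togetherPn ba nt.
  exact: (same_off_lt (same_off_trans (same_off_sym wp) wq) nS bn na).
rewrite qE 1?together_sym // /lt ab andbT orbC eq_sym -le_eqVlt.
have le_y : liftw y a <= liftw y b.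
  apply: (block_monotone sp); last exact: ltnW.
  by rewrite -(together_same_off _ _ wp) together_sym.
suff : liftw z a - liftw y a <= liftw z b - liftw y b by lra.
rewrite /lift_fun -!sumrB; apply: ler_sum => k _; rewrite -!mulrBl ler_wpM2l ?subr_ge0 //.
rewrite /chi ler_nat !inE; have := w_block t ab.
by case: (ltnP (w a)) => // h1 h2; rewrite (ltn_trans h2).
Qed.

(** Inside a block this function strictly increases along w, hence is larger on smaller letters; a
    word of P, having a descent inside a block, cannot sort it. *)
Lemma not_in_cone_neg : ~ in_cone (const_mx (-1)).
Proof.
case=> p pP sp; have [a [b [e bS ba]]] := P_descent pP.
have t : together S w a b by rewrite (together_same_off a b (P_off pP)); apply: together_cover.
have wab : (w a < w b)%N by apply: w_block ba; rewrite together_sym.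
have [k ek] := cut_ex S_lt (together_cuts t wab (leqnn _)).
have := sp _ _ e bS; apply/negP; rewrite -ltNge /lift_fun.
have mono l : const_mx (-1) 0 l * chi R (initial_seg w (nth_cut l)) a <=
    const_mx (-1) 0 l * chi R (initial_seg w (nth_cut l)) b :> R.
  rewrite !mxE !mulN1r lerN2 /chi ler_nat !inE.
  by case: (ltnP (w b)) => // h; rewrite (ltn_trans wab).
rewrite (bigD1 k) //= [ltRHS](bigD1 k) //=; apply: ltr_leD; last exact: ler_sum.
by rewrite mxE !mulN1r ltrN2 /chi !inE ek ltnn wab ltr01.
Qed.

Variables (T : finType) (x : {set 'I_r} -> T) (ell : T -> {set 'I_r}).
Hypothesis xK : cancel x ell.

(** In the application [x] embeds the letter sets into the lattice as a Boolean sublattice, and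
    [ell] is the label set. *)
Definition facet p : {set T} := [set x (initial_seg p n) | n : 'I_r in cuts].

Lemma card_facet p : #|facet p| = d.
Proof.
rewrite card_in_imset // => m n mS nS /(can_inj xK) /(congr1 (fun A : {set 'I_r} => #|A|)).
by rewrite !card_initial_seg ?(ltnW (ltn_ord _)) // => /val_inj.
Qed.

Lemma mem_facet p t : t \in facet p -> ell t = initial_seg p #|ell t| /\ x (ell t) = t /\ #|ell t| \in S.
Proof.
case/imsetP=> n; rewrite inE => nS ->; rewrite xK card_initial_seg ?(ltnW (ltn_ord _)) //.
Qed.

Lemma facetP p n : n \in S -> x (initial_seg p n) \in facet p.
Proof.
by move=> nS; have /andP[_ nr] := S_lt nS; apply/imsetP; exists (Ordinal nr); rewrite ?inE.
Qed.

Definition weights_on p (c : T -> R) : Prop := forall t, t \notin facet p -> c t = 0.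

(** The map from barycentric weights to the cone; nonnegative weights on [facet p] go to the chamber
    of p. *)
Definition cone_point (c : T -> R) : 'rV[R]_d := \sum_t c t *: row_of (chi R (ell t)).

Lemma sum_facet p (M : zmodType) (F : T -> M) : (forall t, t \notin facet p -> F t = 0) ->
  \sum_t F t = \sum_(n in cuts) F (x (initial_seg p n)).
Proof.
move=> F0; rewrite (bigID (mem (facet p))) /= [X in _ + X]big1 ?addr0 //.
rewrite big_imset //= => m n mS nS /(can_inj xK) /(congr1 (fun A : {set 'I_r} => #|A|)).
by rewrite !card_initial_seg ?(ltnW (ltn_ord _)) // => /val_inj.
Qed.

(** Gaps along p are dual to the prefixes of p, so they recover the weights within one simplex. *)
Lemma gap_cone_point p c m : same_off S w p -> weights_on p c -> m \in S ->
  gap (liftw (cone_point c)) p m = c (x (initial_seg p m)).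
Proof.
move=> wp cp mS.
have -> : cone_point c = row_of (fun a => \sum_(n in cuts) c (x (initial_seg p n)) *
    chi R (initial_seg p n) a).
  rewrite /cone_point (@sum_facet p) => [|t /cp->]; last by rewrite scale0r.
  apply/rowP=> k; rewrite summxE mxE gap_sum; apply: eq_bigr => n _.
  by rewrite !mxE gapZ xK.
have /andP[_ mr] := S_lt mS; have mc : Ordinal mr \in cuts by rewrite inE.
rewrite (gap_lift_row S_lt) // gap_sum (bigD1 (Ordinal mr)) //= big1 => [|n /andP[_ nm]].
  by rewrite gapZ gap_initial_seg ?S_lt // eqxx mulr1 addr0.
rewrite gapZ gap_initial_seg ?S_lt //; move: nm; rewrite -(inj_eq val_inj) /= eq_sym.
by move=> /negbTE->; rewrite mulr0.
Qed.

Lemma cone_point_in p c : p \in P -> weights_on p c -> (forall t, 0 <= c t) ->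
  in_cone (cone_point c).
Proof.
move=> pP cp c0; exists p => //; apply: gap_sorts => n nS.
by rewrite gap_cone_point //; apply: P_off.
Qed.

Lemma eq_weights p c c' : weights_on p c -> weights_on p c' ->
  (forall n, n \in S -> c (x (initial_seg p n)) = c' (x (initial_seg p n))) -> c =1 c'.
Proof.
move=> cp cp' e t; have [/imsetP[n]|tp] := boolP (t \in facet p); last by rewrite cp // cp'.
by rewrite inE => nS ->; apply: e.
Qed.

Lemma cone_point_surj z : in_cone z -> exists p c,
  [/\ p \in P, weights_on p c, forall t, 0 <= c t & cone_point c = z].
Proof.
case=> p pP sp; pose c t := if t \in facet p then gap (liftw z) p #|ell t| else 0.
have cp : weights_on p c by move=> t; rewrite /c => /negbTE->.
exists p, c; split=> // [t|].
  rewrite /c; case: ifP => // /mem_facet[_ [_ tS]]; exact: sorts_gap.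
have wp := P_off pP; rewrite -[LHS](lift_funK w S_lt) -[RHS](lift_funK w S_lt).
apply/rowP=> k; rewrite !mxE; apply/eqP; rewrite -subr_eq0 -gapN -gapD.
apply/eqP/(gap_same_off S_lt (same_off_sym wp)); last exact: cut_in.
move=> n nS; rewrite gapD gapN gap_cone_point // /c facetP // xK.
by rewrite card_initial_seg ?subrr //; case/andP: (S_lt nS) => _ /ltnW.
Qed.

Definition weight_height (c : T -> R) : R := \sum_t c t * height R r S #|ell t|.

(** [functional_le], summed over the support of c. Thus [weight_height c] is the maximum of these
    forms over all words of the class and depends only on the point, which allows weights on
    different simplices to be compared. *)
Lemma functional_cone_point p q c : same_off S w p -> weights_on p c -> same_off S w q ->
  (forall t, 0 <= c t) ->
  (cone_point c *m functional S w q (height R r S)) 0 0 <= weight_height c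
    ?= iff [forall t, (c t == 0) || (ell t == initial_seg q #|ell t|)].
Proof.
move=> wp cp wq c0; rewrite mulmx_suml summxE.
have hc n : n \in S -> height R r S n.-1 + height R r S n.+1 < 2 * height R r S n.
  by move=> /(height_concave R S_lt); lra.
have h0 n : n \notin S -> height R r S n = 0 by apply: height_out.
have step t : (c t *: row_of (chi R (ell t)) *m functional S w q (height R r S)) 0 0 <=
    c t * height R r S #|ell t| ?= iff ((c t == 0) || (ell t == initial_seg q #|ell t|)).
  rewrite -scalemxAl [X in X <= _ ?= iff _]mxE.
  have [->|ct0] := eqVneq (c t) 0; first by rewrite !mul0r; apply/leifP; rewrite eqxx.
  have tp : t \in facet p by apply: contraR ct0 => /cp->.
  have [et _] := mem_facet tp.
  have cq : compatible S q (ell t).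
    by rewrite et; apply: compatible_initial_seg => n nS; rewrite -wp // wq.
  have := functional_le S_lt h0 hc cq; rewrite -(functional_chi S_lt _ wq h0).
  have ct : 0 < c t by rewrite lt_neqAle eq_sym ct0 c0.
  case=> le eq; split; first by rewrite ler_pM2l.
  by rewrite (inj_eq (mulfI ct0)) eq.
have := @leif_sum _ _ (fun t : T => true) _ _ _ (fun t _ => step t).
by congr (_ <= _ ?= iff _); apply/forall_inP/forallP => h t //; apply: h.
Qed.

(** Evaluating the forms of p and q at both points shows that the form of p attains its maximum at
    c' too. So c' is carried by prefixes of p, where gaps determine the weights. *)
Lemma cone_point_inj p q c c' s : p \in P -> q \in P -> weights_on p c -> weights_on q c' ->
    (forall t, 0 <= c t) -> (forall t, 0 <= c' t) -> 0 < s ->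
    cone_point c = s *: cone_point c' ->
  c =1 (fun t => s * c' t).
Proof.
move=> /P_off wp /P_off wq cp cq c0 c0' s0 e.
pose L p' := functional S w p' (height R r S).
have self p' c'' : same_off S w p' -> weights_on p' c'' -> (forall t, 0 <= c'' t) ->
    (cone_point c'' *m L p') 0 0 = weight_height c''.
  move=> wp' cp' cp0; apply/eqP; rewrite (functional_cone_point wp' cp' wp' cp0).2.
  apply/forallP=> t; have [/mem_facet[<- _]|/cp'->] := boolP (t \in facet p').
    by rewrite eqxx orbT.
  by rewrite eqxx.
have scale p' : (cone_point c *m L p') 0 0 = s * (cone_point c' *m L p') 0 0.
  by rewrite e -scalemxAl [LHS]mxE.
have [le1 eq1] := functional_cone_point wq cq wp c0'.
have [le2 _] := functional_cone_point wp cp wq c0.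
have cp' : weights_on p c'.
  have : (cone_point c' *m L p) 0 0 == weight_height c'.
    rewrite eq_le le1 /=; move: le2; rewrite scale (self _ _ wq cq c0').
    by rewrite -(self _ _ wp cp c0) scale ler_pM2l.
  rewrite eq1 => /forallP h t tp; apply/eqP; move: (h t) => /orP[//|/eqP et].
  apply: contraR tp => ct; have tq : t \in facet q by apply: contraR ct => /cq->.
  by have [_ [xt tS]] := mem_facet tq; rewrite -xt et; apply: facetP.
apply: (eq_weights cp) => [t /cp'->|n nS]; first by rewrite mulr0.
rewrite -(gap_cone_point wp cp) // -(gap_cone_point wp cp') // e -gapZ.
by apply: eq_gap => a; apply: lift_funZ.
Qed.

End Cone.

(** * Spheres and their boundaries *)

Lemma complex_ofP (V : finType) (E : {set {set V}}) (F : {set V}) :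
  reflect (exists2 G, G \in E & F \subset G) (F \in complex_of E).
Proof. by rewrite inE; apply: exists_inP. Qed.

Lemma complex_of_sub (V : finType) (E : {set {set V}}) (F G : {set V}) :
  F \in complex_of E -> G \subset F -> G \in complex_of E.
Proof. by move=> /complex_ofP[H HE FH] GF; apply/complex_ofP; exists H => //; apply: subset_trans FH. Qed.

Lemma mem_complex_of (V : finType) (E : {set {set V}}) (F : {set V}) : F \in E -> F \in complex_of E.
Proof. by move=> FE; apply/complex_ofP; exists F. Qed.

Lemma complex_of_eq0 (V : finType) (E : {set {set V}}) : (complex_of E == set0) = (E == set0).
Proof.
apply/eqP/eqP => [/setP e|->]; apply/setP=> F; rewrite in_set0; apply/negP.
  by move/mem_complex_of; rewrite e in_set0.
by case/complex_ofP=> G; rewrite in_set0.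
Qed.

Lemma complex_of_is_complex (V : finType) (E : {set {set V}}) : E != set0 ->
  is_complex (complex_of E).
Proof.
case/set0Pn=> F FE; split; first by apply/complex_ofP; exists F; rewrite ?sub0set.
by move=> G H; apply: complex_of_sub.
Qed.

Lemma complex_iso_imset (V W : finType) (D : {set {set V}}) (f : V -> W) :
  {in [set v | [set v] \in D] &, injective f} -> complex_iso D [set f @: (F : {set V}) | F in D].
Proof. by exists f. Qed.

(** The case of empty S: a polytope in R^0 is a point, whose boundary has the empty face only. *)
Lemma point_boundary (R : realType) (V : finType) :
  polytope_boundary R 0 [set set0 : {set V}].
Proof.
pose v := fun _ : 'I_1 => 0 : 'rV[R]_0.
have faceE (F : {set 'I_1}) : is_face v F.
  have [F0|F1] := boolP (ord0 \in F); last first.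
    exists 0, 1; split=> [x _|i]; first by rewrite mulmx0 mxE.
    by rewrite mulmx0 mxE eq_sym oner_eq0 (ord1 i) (negbTE F1).
  exists 0, 0; split=> [x _|i]; first by rewrite mulmx0 mxE.
  by rewrite mulmx0 mxE eqxx (ord1 i).
exists 1%N, v; split.
  split=> [x|i|F _ FT c c0 _ i iF].
  - exists (fun=> 1); rewrite big_ord1; split=> //; apply/rowP=> -[] //.
  - exact: faceE.
  - case/eqP: FT; apply/setP=> j; rewrite inE (ord1 j) -(ord1 i); exact: iF.
exists (fun=> ord0).
  by move=> a b; rewrite !inE => /eqP/setP/(_ a); rewrite !inE eqxx.
apply/setP=> F; rewrite inE; apply/andP/imsetP => [[_ FT]|[G]]; last first.
  rewrite inE => /eqP-> ->; rewrite imset0; split; first exact/asboolP.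
  by apply/eqP=> /setP/(_ ord0); rewrite !inE.
exists set0; rewrite ?inE // imset0; apply/setP=> i; rewrite inE (ord1 i).
by apply: contraNF FT => F0; apply/eqP/setP => j; rewrite inE (ord1 j).
Qed.

Section Spheres.
Variables (R : realType) (r : nat) (S : {pred nat}) (w : 'S_r) (P Q : {pred 'S_r}).
Implicit Types (p q : 'S_r).
Hypothesis S_lt : forall n, n \in S -> (0 < n < r)%N.
Hypothesis S_neq0 : exists n, n \in S.
Hypothesis QP : forall p, reflect (same_off S w p) (p \in Q).
Hypothesis PQ : forall p, p \in P -> p \in Q.
Variables (T : finType) (x : {set 'I_r} -> T) (ell : T -> {set 'I_r}).
Hypothesis xK : cancel x ell.
Local Notation d := #|cuts r S|.
Local Notation facet := (facet S x).
Local Notation sphere := (complex_of [set facet p | p in Q]).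

Let Vx : {set T} := [set x A | A in verts S w].

Let V (i : 'I_#|Vx|) : {set 'I_r} := ell (enum_val i).

Let VE i : x (V i) = enum_val i.
Proof. by have /imsetP[A _ e] := enum_valP i; rewrite /V e xK. Qed.

Let V_inj : injective V.
Proof. by move=> i j e; apply: enum_val_inj; rewrite -!VE e. Qed.

Let V_verts i : V i \in verts S w.
Proof. by have /imsetP[A AV e] := enum_valP i; rewrite /V e xK. Qed.

Let V_surj A : A \in verts S w -> exists i, V i = A.
Proof.
move=> AV; have xV : x A \in Vx by apply: imset_f.
by exists (enum_rank_in xV (x A)); rewrite /V enum_rankK_in.
Qed.

Let facet_Vx p t : p \in Q -> t \in facet p -> t \in Vx.
Proof.
move=> /QP wp /imsetP[n]; rewrite inE => nS ->; apply: imset_f.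
exact: verts_seg.
Qed.

Let w_Q : w \in Q. Proof. exact/QP. Qed.

Lemma sphere_iso : exists f : T -> 'I_#|Vx|, {in Vx &, injective f} /\
  boundary_complex (@point R r S w #|Vx| V) = [set f @: (F : {set T}) | F in sphere].
Proof.
have [n nS] := S_neq0; have v0 := facet_Vx w_Q (facetP S_lt x w nS).
exists (enum_rank_in v0); split.
  by move=> s t sV tV /(congr1 enum_val); rewrite !enum_rankK_in.
apply/setP=> F; apply/(boundary_pointsP R S_lt S_neq0 V_inj V_verts V_surj)/imsetP => [chF|[G]].
  have [p wp pV] := V_chain_seg V_verts chF.
  exists (enum_val @: F).
    apply/complex_ofP; exists (facet p); first by apply: imset_f; apply/QP.
    apply/subsetP=> _ /imsetP[i iF ->]; rewrite -VE pV //; apply: facetP => //.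
    by case/vertsP: (V_verts i).
  by rewrite -imset_comp (eq_imset _ (enum_valK_in v0)) imset_id.
case/complex_ofP=> _ /imsetP[p pQ ->] /subsetP Gp ->.
have seg t : t \in G -> exists m, V (enum_rank_in v0 t) = initial_seg p m.
  move=> /Gp tp; exists #|ell t|; rewrite /V enum_rankK_in; last exact: facet_Vx tp.
  by have [] := mem_facet xK tp.
move=> _ _ /imsetP[s /seg[m em] ->] /imsetP[t /seg[n' en] ->]; rewrite em en.
by case/orP: (leq_total m n') => h; rewrite (initial_seg_mono p h) ?orbT.
Qed.

Let vertex_Vx s : [set s] \in sphere -> s \in Vx.
Proof. by move=> /complex_ofP[_ /imsetP[p pQ ->]]; rewrite sub1set; apply: facet_Vx. Qed.

Lemma sphere_boundary : polytope_boundary R d sphere.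
Proof.
have [f [finj eb]] := sphere_iso; exists #|Vx|, (@point R r S w #|Vx| V).
split; first exact: simplicial_points.
rewrite eb; apply: complex_iso_imset => s t; rewrite inE => /vertex_Vx sV.
by rewrite inE => /vertex_Vx; apply: finj.
Qed.

Lemma facets_sub : complex_of [set facet p | p in P] \subset sphere.
Proof.
apply/subsetP=> F /complex_ofP[_ /imsetP[p pP ->] Fp].
by apply/complex_ofP; exists (facet p) => //; apply: imset_f; apply: PQ.
Qed.

Lemma facet_inj p q : same_off S p q -> facet p = facet q -> p = q.
Proof.
move=> pq e; apply: (eq_of_same_off pq) => n nS.
have : x (initial_seg p n) \in facet q by rewrite -e; apply: facetP.
have /andP[_ nr] := S_lt nS.
by case/(mem_facet xK) => + _; rewrite xK card_initial_seg // ltnW.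
Qed.

Lemma facet_max p q : same_off S p q -> facet p \subset facet q -> p = q.
Proof.
move=> pq sub; apply: facet_inj => //; apply/eqP; rewrite eqEcard sub.
by rewrite !(card_facet S xK) leqnn.
Qed.

(** The missing face is the facet of q: all facets have the same size, and within a class a facet
    determines its word. *)
Lemma facets_proper q : q \in Q -> q \notin P ->
  proper_in_polytope_boundary R d (complex_of [set facet p | p in P]).
Proof.
move=> qQ qP; have [f [finj eb]] := sphere_iso.
exists #|Vx|, (@point R r S w #|Vx| V), [set f @: (F : {set T}) | F in complex_of [set facet p | p in P]].
split; first exact: simplicial_points.
  rewrite eb; apply/properP; split; first exact/imsetS/facets_sub.
  exists (f @: facet q); first by apply/imset_f/mem_complex_of/imset_f.
  apply/imsetP=> -[F FP e]; case/negP: qP.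
  have sub s G : G \in sphere -> s \in G -> s \in Vx.
    by move=> GS sG; apply/vertex_Vx/(complex_of_sub GS); rewrite sub1set.
  have : facet q \subset F.
    apply/subsetP=> s sq; have /imsetP[t tF est] : f s \in f @: F by rewrite -e imset_f.
    rewrite (finj s t _ _ est) //; first exact: facet_Vx sq.
    by apply: (sub t F) => //; apply: (subsetP facets_sub).
  move: FP => /complex_ofP[_ /imsetP[p pP ->] Fp] qF.
  have pQ : same_off S w p by apply/QP/PQ.
  rewrite (facet_max _ (subset_trans qF Fp)) //.
  by apply: same_off_trans pQ; apply/same_off_sym/QP.
apply: complex_iso_imset => s t; rewrite inE => /(subsetP facets_sub)/vertex_Vx sV.
by rewrite inE => /(subsetP facets_sub)/vertex_Vx; apply: finj.
Qed.

End Spheres.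

Local Close Scope ring_scope.

Lemma dim1_complex_of (V : finType) (E : {set {set V}}) (k : nat) :
  E != set0 -> (forall G, G \in E -> #|G| = k) -> dim1 (complex_of E) = k.
Proof.
move=> /set0Pn[G0 G0E] cE; apply/eqP; rewrite eqn_leq; apply/andP; split.
  by apply/bigmax_leqP => F /complex_ofP[G /cE <-]; apply: subset_leq_card.
rewrite -(cE _ G0E); apply: (@leq_bigmax_cond _ _ (fun F : {set V} => #|F|)).
exact: mem_complex_of.
Qed.

(** * Exchange of adjacent letters *)

Section Swap.
Variables (r : nat) (S : {pred nat}).
Implicit Types (p q : 'S_r) (a b c : 'I_r).

Definition swap a b p : 'S_r := (tperm a b * p)%g.

Lemma swapL a b p : swap a b p a = p b. Proof. by rewrite permM tpermL. Qed.
Lemma swapR a b p : swap a b p b = p a. Proof. by rewrite permM tpermR. Qed.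
Lemma swapD a b p c : a != c -> b != c -> swap a b p c = p c.
Proof. by move=> ac bc; rewrite permM tpermD. Qed.

Lemma initial_seg_swap a b p m : p b = (p a).+1 :> nat -> m != p b :> nat ->
  initial_seg (swap a b p) m = initial_seg p m.
Proof.
move=> e mb; apply/setP=> c; rewrite !inE.
have [<-|ac] := eqVneq a c; first by rewrite swapL; move: mb; rewrite e; lia.
have [<-|bc] := eqVneq b c; first by rewrite swapR; move: mb; rewrite e; lia.
by rewrite swapD.
Qed.

Lemma swap_same_off a b p : p b = (p a).+1 :> nat -> (p b : nat) \in S ->
  same_off S p (swap a b p).
Proof.
move=> e bS n nS; rewrite initial_seg_swap //.
by apply: contraNneq nS => ->.
Qed.

(** The prefixes just before and just after any other letter agree in p and q, so only a and b can
    move, and they share two positions. This says that a ridge of the sphere lies in two facets. *)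
Lemma eq_or_swap a b p q : p b = (p a).+1 :> nat ->
    (forall m, m != p b :> nat -> initial_seg q m = initial_seg p m) ->
  q = p \/ q = swap a b p.
Proof.
move=> e h; have le m c : m != p b :> nat -> (q c < m) = (p c < m).
  by move=> mb; rewrite -!mem_initial_seg h.
have ab : a != b by apply/eqP=> ab; move: e; rewrite ab; lia.
have far c : a != c -> b != c -> q c = p c.
  move=> ac bc; apply/val_inj => /=.
  have cb : (p c : nat) != p b by apply: contraNneq bc => /perm_nat_inj->.
  have ca : (p c).+1 != p b :> nat.
    by rewrite e eqSS; apply: contraNneq ac => /perm_nat_inj->.
  have := le _ c cb; have := le _ c ca; rewrite ltnS leqnn ltnn; lia.
have qa : (q a = p a :> nat \/ q a = p b :> nat).
  have := le (p a) a; have := le (p b).+1 a; rewrite e; lia.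
have qb : (q b = p a :> nat \/ q b = p b :> nat).
  have := le (p a) b; have := le (p b).+1 b; rewrite e; lia.
have nab : q a != q b :> nat by apply: contraNneq ab => /perm_nat_inj->.
case: qa qb nab => ea [] eb; rewrite ?ea ?eb ?eqxx // => _; [left|right];
  apply/permP=> c; have [<-|ac] := eqVneq a c; try (have [<-|bc] := eqVneq b c).
- exact: val_inj.
- exact: val_inj.
- exact: far.
- by rewrite swapL; apply: val_inj.
- by rewrite swapR; apply: val_inj.
- by rewrite swapD // far.
Qed.

(** A statistic that rises whenever a descent is sorted; maximizing it selects words with no descent
    left that could be sorted. *)
Lemma swap_weight a b p : p b = (p a).+1 :> nat -> b < a ->
  \sum_(c < r) (c * p c)%N < \sum_(c < r) (c * swap a b p c)%N.
Proof.
move=> e ba; have ne : b != a by apply: contraTneq ba => ->; rewrite ltnn.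
rewrite (bigD1 a) //= (bigD1 b) //= [ltnRHS](bigD1 a) //= [in ltnRHS](bigD1 b) //=.
rewrite swapL swapR !addnA (eq_bigr (fun c : 'I_r => c * swap a b p c)); last first.
  by move=> c /andP[ca cb]; rewrite swapD // eq_sym.
by rewrite ltn_add2r e !mulnS; lia.
Qed.

End Swap.

(** * The boundary of the complex of a set of words *)

Section Boundary.
Variables (r : nat) (S : {pred nat}) (w : 'S_r) (P Q : {pred 'S_r}).
Implicit Types (p q : 'S_r).
Hypothesis S_lt : forall n, n \in S -> 0 < n < r.
Hypothesis QP : forall p, reflect (same_off S w p) (p \in Q).
Hypothesis PQ : forall p, p \in P -> p \in Q.
Hypothesis P_neq0 : exists p, p \in P.
Variables (T : finType) (x : {set 'I_r} -> T) (ell : T -> {set 'I_r}).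
Hypothesis xK : cancel x ell.
Local Notation facet := (facet S x).
Local Notation Sigma := (complex_of [set facet p | p in P]).
Variable earlier : {set {set T}}.
Hypothesis earlier_sub : forall F G : {set T}, F \in earlier -> G \subset F -> G \in earlier.
Hypothesis earlier_facet : forall q, q \in Q -> q \notin P -> facet q \in earlier.
Hypothesis earlier_descent : forall p (F : {set T}), p \in P -> F \subset facet p -> F \in earlier ->
  exists a b : 'I_r, [/\ p b = (p a).+1 :> nat, (p b : nat) \in S, b < a
     & x (initial_seg p (p b)) \notin F].

Lemma facet_swap p a b : p b = (p a).+1 :> nat -> (p b : nat) \in S ->
  facet p :\ x (initial_seg p (p b)) \subset facet (swap a b p).
Proof.
move=> e bS; apply/subsetP=> t; rewrite !inE => /andP[tb /imsetP[n]].
rewrite inE => nS et; rewrite et -(initial_seg_swap e); last first.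
  by apply: contraNneq tb => <-; rewrite et.
exact: facetP.
Qed.

Lemma dim1_facets : dim1 Sigma = #|cuts r S|.
Proof.
apply: dim1_complex_of.
  by have [p pP] := P_neq0; apply/set0Pn; exists (facet p); apply: imset_f.
by move=> _ /imsetP[p _ ->]; apply: (card_facet S xK).
Qed.

Lemma max_face G : G \in Sigma -> #|G| = #|cuts r S| -> exists2 p, p \in P & G = facet p.
Proof.
move=> /complex_ofP[_ /imsetP[p pP ->] Gp] cG; exists p => //.
by apply/eqP; rewrite eqEcard Gp (card_facet S xK) cG leqnn.
Qed.

Lemma swap_Q p a b : p \in P -> p b = (p a).+1 :> nat -> (p b : nat) \in S -> swap a b p \in Q.
Proof.
move=> /PQ/QP wp e bS; apply/QP; apply: same_off_trans wp _; exact: swap_same_off.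
Qed.

Lemma swap_neq p a b : p b = (p a).+1 :> nat -> facet (swap a b p) = facet p ->
  (p b : nat) \in S -> False.
Proof.
move=> e ef bS; have := facet_inj S_lt xK (same_off_sym (swap_same_off e bS)) ef.
move=> /permP/(_ a); rewrite swapL => /(congr1 val) /=; rewrite e; lia.
Qed.

(** A ridge lies in the facets of a word and of its swap at the missing length. If it lies in one
    facet of the ear only, the swapped word is outside P and its facet is in [earlier]. Conversely
    an earlier face misses a descent of its word, and sorting there must leave P if the word was
    chosen well. *)
Lemma facets_bdry : earlier :&: Sigma = bdry Sigma.
Proof.
apply/setP=> F; rewrite inE; apply/andP/complex_ofP; last first.
  case=> G; rewrite inE dim1_facets => /and3P[GS /eqP cG /cards1P[G1 eG1]] FG.
  split; last exact: complex_of_sub GS FG.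
  have /complex_ofP[_ /imsetP[p pP ->] Gp] := GS.
  have : (G \proper facet p).
    by rewrite properEcard Gp (card_facet S xK) -cG ltnSn.
  case/properP=> _ [t /imsetP[n]]; rewrite inE => nS et; rewrite {t}et => nG.
  have /andP[n0 nr] := S_lt nS; have n1r : n.-1 < r by rewrite (leq_ltn_trans (leq_pred n)).
  pose b := p^-1%g n; pose a := p^-1%g (Ordinal n1r).
  have pb : p b = n by rewrite permKV.
  have e : p b = (p a).+1 :> nat by rewrite pb permKV /= prednK.
  have bS : (p b : nat) \in S by rewrite pb.
  have Gq : G \subset facet (swap a b p).
    apply: subset_trans (facet_swap e bS); apply/subsetP=> t tG; rewrite !inE (subsetP Gp) // andbT.
    by apply: contraNneq nG => et; rewrite -pb -et.
  apply: (earlier_sub _ FG); apply: (earlier_sub _ Gq).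
  apply: earlier_facet; first exact: swap_Q.
  apply/negP=> qP; apply: (swap_neq e _ bS).
  have mem q : q \in P -> G \subset facet q -> facet q = G1.
    move=> qP' Gq'; have : facet q \in [set G1]; last by rewrite inE => /eqP.
    by rewrite -eG1 in_set Gq' (card_facet S xK) eqxx andbT mem_complex_of ?imset_f.
  by rewrite (mem _ qP Gq) (mem _ pP Gp).
case=> Fe /complex_ofP[_ /imsetP[p0 p0P ->] Fp0].
pose cand p := (p \in P) && (F \subset facet p).
have c0 : cand p0 by rewrite /cand p0P.
(* Maximality of p makes the swapped word q leave P: its facet still contains F and its weight is
   larger. *)
case: (@arg_maxnP _ p0 cand (fun p => \sum_(c < r) (c * p c)%N) c0) => p /andP[pP Fp] max_p.
have [a [b [e bS ba nF]]] := earlier_descent pP Fp Fe.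
pose q := swap a b p; pose G := facet p :\ x (initial_seg p (p b)).
have FG : F \subset G.
  apply/subsetP=> t tF; rewrite !inE (subsetP Fp) // andbT.
  by apply: contraNneq nF => <-.
have qP : q \notin P.
  apply/negP=> qP; have : cand q by rewrite /cand qP (subset_trans FG) ?facet_swap.
  by move=> /max_p /= le; have := leq_trans (swap_weight e ba) le; rewrite ltnn.
have pbF : x (initial_seg p (p b)) \in facet p by apply: facetP.
exists G => //; rewrite in_set dim1_facets; apply/and3P; split.
- apply/complex_ofP; exists (facet p); [exact: imset_f | exact: subsetDl].
- by rewrite -(card_facet S xK p) [X in _ == X](cardsD1 (x (initial_seg p (p b)))) pbF.
apply/cards1P; exists (facet p); apply/setP=> H; rewrite in_set in_set1.
apply/and3P/eqP => [[HS GH /eqP cH]|->]; last first.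
  by split; rewrite ?subsetDl ?(card_facet S xK) // mem_complex_of ?imset_f.
have [p' p'P eH] : exists2 p', p' \in P & H = facet p' by apply: max_face.
rewrite eH; suff -> : p' = p by [].
have pp' : same_off S p p'.
  by apply: same_off_trans (same_off_sym (QP _ (PQ pP))) (QP _ (PQ p'P)).
have [//|e'] : p' = p \/ p' = q; last by case/negP: qP; rewrite -e'.
apply: eq_or_swap => // m mb.
have [mS|mS] := boolP (m \in S); last by rewrite pp'.
have : x (initial_seg p m) \in facet p'.
  rewrite -eH; apply: (subsetP GH); rewrite !inE facetP // andbT.
  apply: contraNneq mb => /(can_inj xK) /(congr1 (fun A : {set 'I_r} => #|A|)).
  have /andP[_ mr] := S_lt mS.
  by rewrite !card_initial_seg ?(ltnW mr) ?(ltnW (ltn_ord _)) // => ->.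
have /andP[_ mr] := S_lt mS.
by case/(mem_facet xK) => + _; rewrite xK card_initial_seg // ltnW.
Qed.

End Boundary.

(** * Up-set cones are balls *)

(* The topological part uses names of [classical_sets] that clash with those of
   [finset]; the module keeps them apart. *)
Module Ball.
Import all_classical all_reals all_analysis numFieldNormedType.Exports.
Local Open Scope ring_scope.
Local Open Scope classical_set_scope.

(** * Continuity of maps to row vectors, and homeomorphisms of compact sets *)

Section Continuity.
Variable R : realType.

Lemma row_continuous (X : topologicalType) n (f : X -> 'rV[R]_n) (x : X) :
  (forall i, continuous_at x (fun y => f y 0 i)) -> continuous_at x f.
Proof.
move=> cf A [P nP sP].
have nQ i : nbhs x [set y | P 0 i (f y 0 i)] by apply: cf; apply: nP.
have : \forall y \near x, forall i, P 0 i (f y 0 i) by apply: filter_forall => i; apply: nQ.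
by apply: filterS => y Py; apply: sP => i j; rewrite ord1; exact: Py.
Qed.

Lemma sum_continuous (X : topologicalType) (I : Type) (s : seq I) (P : pred I)
    (f : I -> X -> R) (x : X) :
  (forall i, continuous_at x (f i)) ->
  continuous_at x (fun y => \sum_(i <- s | P i) f i y).
Proof.
move=> cf; elim: s => [|i s IH].
  rewrite (_ : (fun y => _) = cst 0); first exact: cst_continuous.
  by apply/funext => y; rewrite big_nil.
rewrite (_ : (fun y => _) = if P i then (fun y => f i y + \sum_(j <- s | P j) f j y)
  else (fun y => \sum_(j <- s | P j) f j y)).
  by case: ifP => // _; apply: continuousD (cf i) IH.
by apply/funext => y; rewrite big_cons; case: ifP.
Qed.

Lemma norm_coord_le n (x : 'rV[R]_n) i : `|x 0 i| <= `|x|.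
Proof.
rewrite [leRHS]/Num.Def.normr /= mx_normrE.
by apply: (le_trans _ (le_bigmax _ _ (0, i))).
Qed.

Lemma lipschitz_continuous n (f : 'rV[R]_n -> R) :
  (forall x y, f x <= f y + `|x - y|) -> continuous f.
Proof.
move=> lf x A /nbhs_ballP[e /= e0 sA]; apply/nbhs_ballP; exists e => // y.
rewrite -ball_normE /= => xy; apply: sA; rewrite -ball_normE /=; apply: le_lt_trans xy.
have := lf x y; have := lf y x; rewrite (distrC y x) => h1 h2.
by rewrite ler_distl; apply/andP; split; lra.
Qed.

Lemma homeomorphic_compact n m (A : set 'rV[R]_n) (B : set 'rV[R]_m) f :
    compact A -> {within A, continuous f} -> {in A &, injective f} ->
    f @` A = B -> homeomorphic A B.
Proof.
move=> cA cf inj fA.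
pose g y := xget 0 [set x | A x /\ f x = y].
have gP y : B y -> A (g y) /\ f (g y) = y.
  rewrite -fA => -[x Ax fx]; rewrite /g; case: xgetP => [z _ []//|] /(_ x).
  by case.
have gf x : A x -> g (f x) = x.
  move=> Ax; have [] : A (g (f x)) /\ f (g (f x)) = f x by apply: gP; rewrite -fA; exists x.
  by move=> Ag; apply: inj; rewrite inE.
exists f, g; split=> //; last by move=> x Ax; split; [rewrite -fA; exists x | exact: gf].
(* The inverse is continuous: the preimage of a closed C is the image of the compact intersection of
   A and C. *)
apply/continuous_closedP => C cC; apply/closed_subspaceP.
exists (f @` (A `&` C)).
  apply: compact_closed; first exact: norm_hausdorff.
  apply: continuous_compact; last exact: compact_closedI.
  by apply: continuous_subspaceW cf; apply: subIsetl.
apply/seteqP; split=> y [].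
  by case=> x [Ax Cx] <- By; split=> //; suff : C (g (f x)) by []; rewrite gf.
by move=> /= Cg By; split=> //; exists (g y); [split=> //; case: (gP _ By) | case: (gP _ By)].
Qed.

End Continuity.

(** * An up-closed cone is a half-space in suitable coordinates *)

Section UpsetCone.
Variables (R : realType) (m : nat) (K : set 'rV[R]_m.+1).
Implicit Types (x y z : 'rV[R]_m.+1) (s t : R).
Hypothesis K_closed : closed K.
Hypothesis K0 : K 0.
Hypothesis K_scale : forall t z, 0 < t -> K z -> K (t *: z).
Hypothesis K_up : forall y z, (forall i, y 0 i <= z 0 i) -> K y -> K z.
Hypothesis K_neg : ~ K (const_mx (-1)).

Local Notation one := (const_mx 1 : 'rV[R]_m.+1).

(** Signed distance to the boundary of K along [one]: K is where it is nonnegative ([mem_depth]),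
    and up-closure makes it 1-Lipschitz for the sup norm. *)
Definition depth z : R := sup [set t | K (z - t *: one)].

Lemma shiftE z t i : (z - t *: one) 0 i = z 0 i - t.
Proof. by rewrite !mxE mulr1. Qed.

(** For t above the norm of z, every coordinate of the shifted point is at most a fixed negative
    number; up-closure and scaling would then put [- one] into K. *)
Lemma depth_bound z t : K (z - t *: one) -> t <= `|z|.
Proof.
move=> Kt; rewrite leNgt; apply/negP => lt; have e0 : 0 < t - `|z| by rewrite subr_gt0.
apply: K_neg; have := @K_scale (t - `|z|)^-1 (const_mx (- (t - `|z|))) _ _.
rewrite invr_gt0 e0 => /(_ isT); rewrite (_ : _ *: _ = const_mx (-1)); last first.
  by apply/rowP=> i; rewrite !mxE mulrN mulVf ?gt_eqF.
apply; apply: K_up Kt => i; rewrite shiftE mxE.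
by have := norm_coord_le z i; have := ler_norm (z 0 i); lra.
Qed.

Lemma depth_nonempty z : K (z - (- `|z|) *: one).
Proof.
apply: K_up K0 => i; rewrite shiftE mxE.
by have := norm_coord_le z i; have := ler_norm (- z 0 i); rewrite normrN; lra.
Qed.

Lemma depth_has_sup z : has_sup [set t | K (z - t *: one)].
Proof.
by split; [exists (- `|z|); apply: depth_nonempty | exists `|z| => t; apply: depth_bound].
Qed.

Lemma depth_ge z t : K (z - t *: one) -> t <= depth z.
Proof. by move=> Kt; apply: ub_le_sup => //; case: (depth_has_sup z). Qed.

Lemma depth_le z b : (forall t, K (z - t *: one) -> t <= b) -> depth z <= b.
Proof. by move=> h; apply: ge_sup; [case: (depth_has_sup z) | move=> t; apply: h]. Qed.

Lemma depth_mem z : K (z - depth z *: one).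
Proof.
have [ne ub] := depth_has_sup z.
suff /closure_id h : closed [set t | K (z - t *: one)].
  by have := closure_sup ne ub; rewrite -h.
suff /continuous_closedP/(_ _ K_closed) : continuous (fun t : R => z - t *: one) by [].
move=> t.
apply: row_continuous => i.
rewrite (_ : (fun _ => _) = (fun u => z 0 i - u)); last by apply/funext => u; rewrite shiftE.
by apply: continuousB; [apply: cst_continuous | apply: id].
Qed.

Lemma mem_depth z : K z <-> 0 <= depth z.
Proof.
split=> [Kz|d0]; first by apply: depth_ge; rewrite scale0r subr0.
by apply: K_up (depth_mem z) => i; rewrite shiftE; lra.
Qed.

Lemma depth_lipschitz y z : depth y <= depth z + `|y - z|.
Proof.
apply: depth_le => t Kt; rewrite -lerBlDr; apply: depth_ge.
apply: K_up Kt => i; rewrite !shiftE.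
have := norm_coord_le (y - z) i; have := ler_norm ((y - z) 0 i); rewrite !mxE; lra.
Qed.

Lemma depth_continuous : continuous depth.
Proof. exact/lipschitz_continuous/depth_lipschitz. Qed.

Lemma depth_shift z s : depth (z + s *: one) = depth z + s.
Proof.
suff le y t : depth (y + t *: one) <= depth y + t.
  apply/eqP; rewrite eq_le le /=; have := le (z + s *: one) (- s).
  by rewrite scaleNr addrK; lra.
apply: depth_le => u Ku; rewrite -lerBlDr; apply: depth_ge.
by apply: K_up Ku => i; rewrite !mxE; lra.
Qed.

Lemma depth_scale z t : 0 < t -> depth (t *: z) = t * depth z.
Proof.
suff le y s : 0 < s -> depth (s *: y) <= s * depth y.
  move=> t0; apply/eqP; rewrite eq_le le //=; have := le (t *: z) t^-1.
  by rewrite invr_gt0 scalerA mulVf ?gt_eqF // scale1r ler_pdivlMl // => /(_ t0).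
move=> s0; apply: depth_le => u Ku; rewrite -ler_pdivrMl //; apply: depth_ge.
have s0' : 0 < s^-1 by rewrite invr_gt0.
apply: K_up (K_scale s0' Ku) => i; rewrite !mxE mulrDr mulrN !mulr1.
by rewrite mulrA mulVf ?gt_eqF // mul1r.
Qed.

(** Coordinates modulo the line of [one]. The pair ([slope], [depth]) is a positively homogeneous
    change of coordinates taking K to a half-space. *)
Definition slope z : 'rV[R]_m := \row_i (z 0 (lift ord0 i) - z 0 ord0).

Definition lift_row (y : 'rV[R]_m) : 'rV[R]_m.+1 :=
  \row_i (if unlift ord0 i is Some j then y 0 j else 0).

Lemma slope_liftK (y : 'rV[R]_m) s : slope (lift_row y + s *: one) = y.
Proof. by apply/rowP=> i; rewrite !mxE liftK unlift_none /=; ring. Qed.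

Lemma lift_slopeK z : lift_row (slope z) + z 0 0 *: one = z.
Proof.
apply/rowP=> i; rewrite !mxE; case: unliftP => [j ->|->]; rewrite ?mxE; ring.
Qed.

Lemma lift_row_scale t (y : 'rV[R]_m) : lift_row (t *: y) = t *: lift_row y.
Proof. by apply/rowP=> i; rewrite !mxE; case: unlift => [j|]; rewrite ?mxE ?mulr0. Qed.

Lemma slope_scale t z : slope (t *: z) = t *: slope z.
Proof. by apply/rowP=> i; rewrite !mxE; ring. Qed.

Definition sqnorm z : R := \sum_i (slope z) 0 i ^+ 2 + depth z ^+ 2.

Lemma slope_sq_ge0 z : 0 <= \sum_i (slope z) 0 i ^+ 2.
Proof. by apply: sumr_ge0 => i _; rewrite sqr_ge0. Qed.

Lemma sqnorm_gt0 z : z != 0 -> 0 < sqnorm z.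
Proof.
move=> z0; rewrite lt_neqAle eq_sym addr_ge0 ?slope_sq_ge0 ?sqr_ge0 // andbT.
apply: contra z0; rewrite paddr_eq0 ?slope_sq_ge0 ?sqr_ge0 // sqrf_eq0 => /andP[].
rewrite psumr_eq0 => [|i _]; last exact: sqr_ge0.
move=> /allP sl /eqP d0; have sl0 : slope z = 0.
  by apply/rowP=> i; rewrite [RHS]mxE; apply/eqP; have := sl i (mem_index_enum i); rewrite /= sqrf_eq0.
have depth0 : depth 0 = 0.
  by have := @depth_scale 0 2 (ltr0n _ 2); rewrite scaler0; lra.
have lift0 : lift_row 0 = 0.
  by apply/rowP=> i; rewrite !mxE; case: unlift => // j; rewrite mxE.
have := lift_slopeK z; rewrite sl0 lift0 add0r => ez.
have := depth_shift 0 (z 0 0); rewrite add0r ez d0 depth0 add0r => z00.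
by rewrite -ez -z00 scale0r.
Qed.

(** Radial projection to the unit sphere in the coordinates ([slope], [depth]), then dropping the
    depth. K goes to the upper hemisphere, and that to the ball. *)
Definition to_ball z : 'rV[R]_m := (Num.sqrt (sqnorm z))^-1 *: slope z.

Lemma to_ball_sum z : z != 0 ->
  \sum_i to_ball z 0 i ^+ 2 = 1 - (depth z) ^+ 2 / sqnorm z.
Proof.
move=> /sqnorm_gt0 q0; rewrite (eq_bigr (fun i => (sqnorm z)^-1 * (slope z) 0 i ^+ 2)).
  rewrite -mulr_sumr (_ : \sum_i _ = sqnorm z - depth z ^+ 2); last by rewrite /sqnorm; ring.
  by field; rewrite gt_eqF.
by move=> i _; rewrite [to_ball z 0 i]mxE exprMn exprVn sqr_sqrtr // ltW.
Qed.

Lemma to_ball_sub z : z != 0 -> euclidean_ball (to_ball z).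
Proof.
move=> z0; rewrite /euclidean_ball /= to_ball_sum // gerBl.
by rewrite divr_ge0 ?sqr_ge0 // ltW ?sqnorm_gt0.
Qed.

Lemma depth_to_ball z : K z -> z != 0 ->
  depth z = Num.sqrt (sqnorm z) * Num.sqrt (1 - \sum_i to_ball z 0 i ^+ 2).
Proof.
move=> /mem_depth d0 z0; have q0 := sqnorm_gt0 z0.
rewrite to_ball_sum // subKr -sqrtrM ?(ltW q0) // mulrC divfK ?gt_eqF //.
by rewrite sqrtr_sqr ger0_norm.
Qed.

(** On the upper hemisphere the dropped depth is the nonnegative root, so slopes and depths are
    proportional with the same factor. *)
Lemma to_ball_inj y z : K y -> y != 0 -> K z -> z != 0 -> to_ball y = to_ball z ->
  exists2 t, 0 < t & y = t *: z.
Proof.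
move=> Ky y0 Kz z0 e; pose q w := Num.sqrt (sqnorm w).
have qy : 0 < q y by rewrite sqrtr_gt0 sqnorm_gt0.
have qz : 0 < q z by rewrite sqrtr_gt0 sqnorm_gt0.
have slE w : 0 < q w -> slope w = q w *: to_ball w.
  by move=> qw; rewrite scalerA divff ?gt_eqF // scale1r.
have t0 : 0 < q y / q z by rewrite divr_gt0.
have sl : slope y = (q y / q z) *: slope z.
  by rewrite (slE y) // (slE z) // e scalerA divfK ?gt_eqF.
have de : depth y = (q y / q z) * depth z.
  rewrite (depth_to_ball Ky y0) (depth_to_ball Kz z0) e -/(q y) -/(q z).
  by field; rewrite gt_eqF.
move: (q y / q z) t0 sl de => t t0 sl de; exists t => //.
rewrite -[LHS]lift_slopeK -[in RHS](lift_slopeK z) sl lift_row_scale scalerDr scalerA.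
congr (_ + _ *: _).
have := depth_shift (lift_row (slope y)) (y 0 0); rewrite lift_slopeK de.
have := depth_shift (lift_row (slope z)) (z 0 0); rewrite lift_slopeK => ->.
by rewrite sl lift_row_scale depth_scale //; lra.
Qed.

Lemma to_ball_surj b : @euclidean_ball R m b -> exists z, [/\ K z, z != 0 & to_ball z = b].
Proof.
rewrite /euclidean_ball /= => b1; pose t := Num.sqrt (1 - \sum_i b 0 i ^+ 2).
(* Adding a multiple of [one] keeps the slope and shifts the depth, so both can be prescribed. *)
pose z := lift_row b + (t - depth (lift_row b)) *: one.
have dz : depth z = t by rewrite depth_shift; ring.
have sz : slope z = b by rewrite slope_liftK.
have qz : sqnorm z = 1.
  by rewrite /sqnorm sz dz sqr_sqrtr ?subr_ge0 //; ring.
exists z; split.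
- by apply/mem_depth; rewrite dz sqrtr_ge0.
- apply/eqP=> z0; move: qz; rewrite z0 /sqnorm.
  have -> : depth 0 = 0 by have := @depth_scale 0 2 (ltr0n _ 2); rewrite scaler0; lra.
  rewrite big1 => [|i _]; last by rewrite !mxE subrr expr0n.
  by rewrite expr0n addr0 => /eqP; rewrite eq_sym oner_eq0.
- by rewrite /to_ball qz sqrtr1 invr1 scale1r.
Qed.

Lemma to_ball_continuous z : z != 0 -> {for z, continuous to_ball}.
Proof.
move=> z0.
have cc i : continuous (fun y : 'rV[R]_m.+1 => y 0 i) by apply: coord_continuous.
have cs i : continuous (fun y => slope y 0 i).
  move=> y; rewrite (_ : (fun _ => _) = (fun y => y 0 (lift ord0 i) - y 0 ord0)).
    by apply: continuousB; apply: cc.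
  by apply/funext => w; rewrite mxE.
apply: row_continuous => i.
rewrite (_ : (fun _ => _) = (fun y => (Num.sqrt (sqnorm y))^-1 * slope y 0 i)); last first.
  by apply/funext => y; rewrite [LHS]mxE.
apply: (@continuousM _ _ (fun y => (Num.sqrt (sqnorm y))^-1) (fun y => slope y 0 i));
  last exact: cs.
apply: (@continuousV _ _ (fun y => Num.sqrt (sqnorm y))); first by rewrite gt_eqF // sqrtr_gt0 sqnorm_gt0.
apply: (@continuous_comp _ _ _ sqnorm Num.sqrt); last exact: sqrt_continuous.
apply: (@continuousD _ _ _ (fun y => \sum_j slope y 0 j ^+ 2) (fun y => depth y ^+ 2)).
  apply: sum_continuous => j; rewrite (_ : (fun _ => _) = (fun y => slope y 0 j * slope y 0 j)).
    by apply: (@continuousM _ _ (fun y => slope y 0 j) (fun y => slope y 0 j)); apply: cs.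
  by apply/funext => y; rewrite expr2.
rewrite (_ : (fun _ => _) = (fun y => depth y * depth y)).
  by apply: (@continuousM _ _ depth depth); apply: depth_continuous.
by apply/funext => y; rewrite expr2.
Qed.

(* K is the epigraph of a Lipschitz function in the direction (1,..,1). *)
Theorem upset_cone_ball n (X : set 'rV[R]_n) (f : 'rV[R]_n -> 'rV[R]_m.+1) :
    compact X -> continuous f ->
    (forall x : 'rV[R]_n, X x -> K (f x) /\ f x != 0) ->
    (forall (x y : 'rV[R]_n) t, X x -> X y -> 0 < t -> f x = t *: f y -> x = y) ->
    (forall z, K z -> z != 0 -> exists (x : 'rV[R]_n) t, [/\ X x, 0 < t & z = t *: f x]) ->
  homeomorphic X (@euclidean_ball R m).
Proof.
move=> cX cf KX injX surjX.
have to_ballZ z t : z != 0 -> 0 < t -> to_ball (t *: z) = to_ball z.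
  move=> z0 t0; rewrite /to_ball slope_scale scalerA; congr (_ *: _).
  have -> : sqnorm (t *: z) = t ^+ 2 * sqnorm z.
    rewrite /sqnorm depth_scale // slope_scale mulrDr exprMn; congr (_ + _).
    by rewrite mulr_sumr; apply: eq_bigr => i _; rewrite mxE exprMn.
  rewrite sqrtrM ?sqr_ge0 // sqrtr_sqr ger0_norm ?ltW //.
  by field; rewrite !gt_eqF // sqrtr_gt0 sqnorm_gt0.
apply: (@homeomorphic_compact _ _ _ _ _ (to_ball \o f)) => //.
- apply: continuous_in_subspaceT => x; rewrite inE => /KX[_ fx0].
  by apply: continuous_comp; [exact: cf | exact: to_ball_continuous].
- move=> x y; rewrite !inE => Xx Xy /= e.
  have [[Kx x0] [Ky y0]] := (KX x Xx, KX y Xy).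
  by have [t t0 et] := to_ball_inj Kx x0 Ky y0 e; apply: injX t0 et.
- apply/seteqP; split=> b.
    by case=> x /KX[_ fx0] <- /=; apply: to_ball_sub.
  move=> /to_ball_surj[z [Kz z0 <-]]; have [x [t [Xx t0 ez]]] := surjX z Kz z0.
  by exists x => //=; rewrite ez to_ballZ //; case: (KX x Xx).
Qed.

End UpsetCone.

(** A closed part of the unit cube: the support condition is a finite union, over faces F, of the
    vanishing of the coordinates outside F. Closure under subsets covers points whose support is
    smaller than F. *)
Lemma realization_compact (R : realType) (V : finType) (D : {set {set V}}) :
    (forall F G : {set V}, F \in D -> G \subset F -> G \in D) ->
  compact (@realization R V D).
Proof.
move=> sD; pose c v := fun x : 'rV[R]_#|V| => x 0 (enum_rank v).
have cc i : continuous (fun x : 'rV[R]_#|V| => x 0 i) by apply: coord_continuous.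
have box : compact [set x : 'rV[R]_#|V| | forall i, `[0, 1]%classic (x 0 i)].
  by have := @rV_compact _ #|V| (fun=> `[0 : R, 1]%classic); apply => i; exact: segment_compact.
apply: (subclosed_compact _ box); last first.
  move=> x [x0 x1 _] i /=; rewrite in_itv /= x0 -x1 (bigD1 i) //= lerDl.
  exact: sumr_ge0.
have -> : @realization R V D = (\bigcap_(i in [set: 'I_#|V|]) [set x : 'rV[R]_#|V| | 0 <= x 0 i]) `&`
    [set x : 'rV[R]_#|V| | \sum_i x 0 i = 1] `&`
    \bigcup_(F in [set` D]) \bigcap_(v in [set` (~: F)%SET]) [set x | c v x = 0].
  apply/seteqP; split=> x.
    case=> x0 x1 xD; split; first by split=> // i _; apply: x0.
    exists [set v | x 0 (enum_rank v) != 0]%SET; rewrite //= => v.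
    by rewrite /= !inE negbK => /eqP.
  case=> [[x0 x1]] [F FD xF]; split=> //; first by move=> i; apply: x0.
  apply: (sD F) => //; apply/fintype.subsetP => v; rewrite inE.
  by apply: contraR => vF; apply/eqP; apply: xF; rewrite /= inE.
apply: closedI; first apply: closedI.
- apply: closed_bigI => i _.
  by apply: (continuous_closedP _).1 (cc i) _ (@closed_ge R 0).
- have sc : continuous (fun x : 'rV[R]_#|V| => \sum_i x 0 i).
    by move=> x; apply: sum_continuous => i; apply: cc.
  exact: (continuous_closedP _).1 sc _ (@closed_eq R 1).
- apply: closed_bigcup; first exact: finite_finset.
  move=> F _; apply: closed_bigI => v _.
  exact: (continuous_closedP _).1 (cc (enum_rank v)) _ (@closed_eq R 0).
Qed.

Local Close Scope classical_set_scope.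

(** * The realization of an ear as a cross-section of its cone *)

Section FacetsBall.
Variables (R : realType) (r : nat) (S : {pred nat}) (w : 'S_r) (P : {pred 'S_r}).
Hypothesis S_lt : forall n, n \in S -> (0 < n < r)%N.
Hypothesis S_neq0 : exists n, n \in S.
Hypothesis w_desc : descends_exactly_on S w.
Hypothesis P_off : forall p, p \in P -> same_off S w p.
Hypothesis P_up : forall p q, p \in P -> same_off S w q -> weak_le p q -> q \in P.
Hypothesis P_neq0 : exists p, p \in P.
Hypothesis P_descent : forall p, p \in P ->
  exists a b : 'I_r, [/\ p b = (p a).+1 :> nat, (p b : nat) \in S & (b < a)%N].
Variables (T : finType) (x : {set 'I_r} -> T) (ell : T -> {set 'I_r}).
Hypothesis xK : cancel x ell.
Local Notation d := #|cuts r S|.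
Local Notation facet := (facet S x).
Local Notation Sigma := (complex_of [set facet p | p in P]).
Local Notation lift_fun := (@lift_fun R r S w).

Lemma in_cone_closed : closed (@in_cone R r S w P : set 'rV[R]_d).
Proof.
have lc a : continuous (fun z => lift_fun z a).
  move=> z; apply: sum_continuous => k.
  apply: (@continuousM _ _ (fun z : 'rV[R]_d => z 0 k) (fun=> chi R (initial_seg w (nth_cut k)) a)).
    exact: coord_continuous.
  exact: cst_continuous.
have -> : @in_cone R r S w P = (\bigcup_(p in [set` P]) \bigcap_(ab in
    [set ab : 'I_r * 'I_r | p ab.2 = (p ab.1).+1 :> nat /\ (p ab.2 : nat) \in S])
    [set z : 'rV[R]_d | 0 <= lift_fun z ab.1 - lift_fun z ab.2])%classic.
  apply/seteqP; split=> z [p pP sp]; exists p => //.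
    by move=> [a b] /= [e bS]; rewrite subr_ge0; apply: sp.
  by move=> a b e bS; rewrite -subr_ge0; apply: (sp (a, b)).
apply: closed_bigcup; first exact: finite_finset.
move=> p _; apply: closed_bigI => -[a b] _ /=.
suff c : continuous (fun z => lift_fun z a - lift_fun z b).
  exact: (continuous_closedP _).1 c _ (@closed_ge R 0).
by move=> z; apply: (@continuousB _ _ _ (lift_fun^~ a) (lift_fun^~ b)); apply: lc.
Qed.

(** Restated for a dimension that is positive but not syntactically a successor, such as
    [#|cuts r S|]. *)
Lemma upset_cone_ball_pos (e : nat) (K : set 'rV[R]_e) n (X : set 'rV[R]_n) (f : 'rV[R]_n -> 'rV[R]_e) :
    (0 < e)%N -> closed K -> K 0 -> (forall t z, 0 < t -> K z -> K (t *: z)) ->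
    (forall y z : 'rV[R]_e, (forall i, y 0 i <= z 0 i) -> K y -> K z) -> ~ K (const_mx (-1)) ->
    compact X -> continuous f ->
    (forall x : 'rV[R]_n, X x -> K (f x) /\ f x != 0) ->
    (forall (x y : 'rV[R]_n) t, X x -> X y -> 0 < t -> f x = t *: f y -> x = y) ->
    (forall z, K z -> z != 0 -> exists (x : 'rV[R]_n) t, [/\ X x, 0 < t & z = t *: f x]) ->
  homeomorphic X (@euclidean_ball R e.-1).
Proof.
by case: e K f => // m K f _ K1 K2 K3 K4 K5 X1 X2; apply: upset_cone_ball.
Qed.

Definition coords (y : 'rV[R]_#|T|) (t : T) : R := y 0 (enum_rank t).

Lemma realization_facets y : realization Sigma y <->
  [/\ forall t, 0 <= coords y t, \sum_t coords y t = 1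
    & exists2 p, p \in P & weights_on S x p (coords y)].
Proof.
have sumE : \sum_i y 0 i = \sum_t coords y t.
  by rewrite (reindex enum_rank) //; apply: onW_bij; apply: enum_rank_bij.
split=> [[y0 y1 /complex_ofP[_ /imsetP[p pP ->] sp]]|[y0 y1 [p pP cp]]].
  split; [by move=> t; apply: y0 | by rewrite -sumE | exists p => // t].
  by apply: contraNeq => ct; apply: (fintype.subsetP sp); rewrite inE.
split; [by move=> i; rewrite -(enum_valK i); apply: y0 | by rewrite sumE |].
apply/complex_ofP; exists (facet p); first exact: imset_f.
by apply/fintype.subsetP => t; rewrite inE; apply: contraR => /cp; rewrite /coords => ->.
Qed.

(** Each ray of the cone meets the image of the realization once: dividing the weights of a point by
    their sum gives existence, and [cone_point_inj] together with total weight 1 gives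
    uniqueness. *)
Theorem facets_ball : simplicial_ball R Sigma.
Proof.
rewrite /simplicial_ball (dim1_facets S P_neq0 xK).
pose f (y : 'rV[R]_#|T|) := @cone_point R r S w T ell (coords y).
apply: (@upset_cone_ball_pos _ (@in_cone R r S w P) _ _ f).
- have [n nS] := S_neq0; have /andP[_ nr] := S_lt nS.
  by apply/card_gt0P; exists (Ordinal nr); rewrite inE.
- exact: in_cone_closed.
- exact: in_cone0.
- by move=> t z; apply: in_cone_scale.
- by move=> y z; apply: in_cone_up.
- exact: not_in_cone_neg.
- apply: realization_compact => F G /complex_ofP[H HE FH] GF.
  by apply/complex_ofP; exists H => //; apply: fintype.subset_trans FH.
- move=> y; apply: row_continuous => k.
  rewrite (_ : (fun _ => _) = fun z => \sum_t coords z t * (row_of S w (chi R (ell t))) 0 k).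
    apply: sum_continuous => t; apply: (@continuousM _ _ (coords^~ t) (fun=> _)).
      exact: coord_continuous.
    exact: cst_continuous.
  by apply/funext => z; rewrite summxE; apply: eq_bigr => t _; rewrite mxE.
- move=> y /realization_facets[y0 y1 [p pP cp]]; split.
    by apply: (cone_point_in S_lt P_off xK pP cp y0).
  apply/eqP=> fy; have : coords y =1 fun t => 1 * 0.
    apply: (cone_point_inj S_lt P_off xK (c' := fun=> 0) pP pP cp) => //.
    rewrite -/(f y) fy scale1r /cone_point big1 // => t _.
    by rewrite scale0r.
  move=> e; move: y1; rewrite (eq_bigr _ (fun t _ => e t)) big1 => [|t _]; last by rewrite mulr0.
  by move=> /eqP; rewrite eq_sym oner_eq0.
- move=> y z t /realization_facets[y0 y1 [p pP cp]] /realization_facets[z0 z1 [q qP cq]] t0 e.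
  have yz := cone_point_inj S_lt P_off xK pP qP cp cq y0 z0 t0 e.
  have t1 : t = 1.
    by move: y1; rewrite (eq_bigr _ (fun t _ => yz t)) -mulr_sumr z1 mulr1.
  apply/rowP=> i; have := yz (enum_val i); rewrite /coords enum_valK t1 mul1r; exact.
- move=> z Kz z0; have [p [c [pP cp c0 ez]]] := cone_point_surj S_lt P_off xK Kz.
  pose s := \sum_t c t.
  have s0 : 0 < s.
    rewrite lt_neqAle sumr_ge0 // andbT; apply: contra z0.
    rewrite eq_sym psumr_eq0 // => /allP c00; rewrite -ez /cone_point big1 // => t _.
    have /eqP-> : c t == 0 by have := c00 t; rewrite mem_index_enum => /(_ isT).
    by rewrite scale0r.
  pose y : 'rV[R]_#|T| := \row_i (s^-1 * c (enum_val i)).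
  have ey t : coords y t = s^-1 * c t by rewrite /coords mxE enum_rankK.
  exists y, s; split=> //.
    apply/realization_facets; split.
    + by move=> t; rewrite ey mulr_ge0 // invr_ge0 ltW.
    + by rewrite (eq_bigr _ (fun t _ => ey t)) -mulr_sumr mulVf // gt_eqF.
    + by exists p => // t tp; rewrite ey cp ?mulr0.
  rewrite -ez /f /cone_point scaler_sumr; apply: eq_bigr => t _.
  by rewrite ey scalerA mulrA divff ?gt_eqF // mul1r.
Qed.

End FacetsBall.

End Ball.

(** * Chains and edge labelings *)

Section Chains.
Context {disp : Order.disp_t} {T : finPOrderType disp}.
Implicit Types (x y z : T) (A D : {set T}) (s : seq T).
Local Open Scope order_scope.

Lemma covers_lt x y : covers x y -> x < y.
Proof. by case/andP. Qed.

Lemma coversN x y z : covers x y -> x < z -> z < y -> False.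
Proof. by case/andP=> _ /forallP/(_ z)/negP + xz zy; rewrite xz zy; apply. Qed.

Lemma path_covers_lt x s : path covers x s -> path <%O x s.
Proof. exact: (sub_path covers_lt). Qed.

Lemma path_lt_le_last x s : path <%O x s -> x <= last x s.
Proof. by elim: s x => //= y s IH x /andP[xy /IH]; apply/le_trans/ltW. Qed.

Lemma mem_path_lt x s y : path <%O x s -> y \in x :: s -> x <= y <= last x s.
Proof.
elim: s x => [|z s IH] x /=; first by rewrite inE => _ /eqP->; rewrite lexx.
case/andP=> xz zs; rewrite inE => /orP[/eqP->|/(IH _ zs)/andP[zy ->]].
  by rewrite lexx (le_trans (ltW xz)) ?path_lt_le_last.
by rewrite (le_trans (ltW xz)).
Qed.

Lemma is_chainP D : reflect {in D &, forall x y, x >=< y} (is_chain D).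
Proof.
apply: (iffP forall_inP) => [h x y xD yD|h x xD]; first exact: (forall_inP (h x xD)).
by apply/forall_inP => y yD; apply: h.
Qed.

Lemma is_chain_sub A D : D \subset A -> is_chain A -> is_chain D.
Proof. by move=> /subsetP DA /is_chainP h; apply/is_chainP=> x y /DA xA /DA; apply: h. Qed.

Lemma is_chainU1 x D : is_chain D -> {in D, forall y, x >=< y} -> is_chain (x |: D).
Proof.
move=> /is_chainP chD xD; apply/is_chainP=> y z; rewrite !in_setU1.
case/predU1P=> [->|yD] /predU1P[->|zD]; first exact: comparablexx.
- exact: xD.
- by rewrite comparable_sym xD.
- exact: chD.
Qed.

Lemma mem_chain_seq D x : (x \in chain_seq D) = (x \in D).
Proof. by rewrite mem_sort mem_enum. Qed.

Lemma size_chain_seq D : size (chain_seq D) = #|D|.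
Proof. by rewrite size_sort cardE. Qed.

Lemma chain_seq_sorted D : is_chain D -> sorted <%O (chain_seq D).
Proof.
move=> /is_chainP chD; rewrite lt_sorted_uniq_le sort_uniq enum_uniq /=.
apply: (@sort_sorted_in _ (mem D)); last by apply/allP=> x; rewrite mem_enum.
by move=> x y xD yD; apply: chD.
Qed.

Lemma chain_seqE s : sorted <%O s -> chain_seq [set x in s] = s.
Proof.
move=> ss; have ch : is_chain [set x in s].
  apply/is_chainP=> x y; rewrite !inE => xs ys.
  have := sorted_ltn_nth lt_trans x ss => h.
  have [xy|yx|/(congr1 (nth x s))] := ltngtP (index x s) (index y s).
  - by have := h (index x s) (index y s); rewrite !inE !index_mem !nth_index // => /(_ xs ys xy) /ltW/le_comparable.
  - by have := h (index y s) (index x s); rewrite !inE !index_mem !nth_index // => /(_ ys xs yx) /ltW/ge_comparable.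
  - by rewrite !nth_index // => ->; apply: comparablexx.
apply: lt_sorted_eq => //; first exact: chain_seq_sorted.
by move=> x; rewrite mem_chain_seq inE.
Qed.

Lemma maxchainsP A D : reflect
  [/\ is_chain D, D \subset A &
      forall E, is_chain E -> E \subset A -> D \subset E -> E = D]
  (D \in maxchains A).
Proof.
rewrite inE; apply: (iffP maxsetP) => [[/andP[ch DA] mx]|[ch DA mx]].
  by split=> // E chE EA; apply: mx; rewrite chE.
by split=> [|E /andP[chE EA]]; [rewrite ch | apply: mx].
Qed.

Lemma maxchain_mem A D x : D \in maxchains A -> x \in A ->
  {in D, forall y, x >=< y} -> x \in D.
Proof.
move=> /maxchainsP[ch DA mx] xA xD.
rewrite -(mx (x |: D)) ?setU11 ?is_chainU1 ?subsetUr //.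
by rewrite subUset sub1set xA.
Qed.

Lemma maxchain_exists A D : is_chain D -> D \subset A ->
  exists2 E, E \in maxchains A & D \subset E.
Proof.
move=> ch DA; pose P := fun D' : {set T} => is_chain D' && (D' \subset A).
have [|E mE DE] := @maxset_exists _ P D; first by rewrite /P ch.
by exists E; rewrite ?inE.
Qed.

Lemma path_covers_of_dense x s : path <%O x s ->
    (forall z, x <= z <= last x s -> {in x :: s, forall w, z >=< w} -> z \in x :: s) ->
  path covers x s.
Proof.
elim: s x => //= y s IH x /andP[xy ys] dense; apply/andP; split.
  rewrite /covers xy; apply/forallP=> z; apply/negP=> /andP[xz zy].
  have : z \in [:: x, y & s].
    apply: dense => [|w]; first by rewrite ltW //= (le_trans (ltW zy)) ?path_lt_le_last.
    rewrite inE => /predU1P[->|/(mem_path_lt ys)/andP[yw _]].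
      by rewrite comparable_sym lt_comparable.
    by rewrite lt_comparable // (lt_le_trans zy).
  rewrite inE => /predU1P[zx|/(mem_path_lt ys)/andP[yz _]].
    by rewrite zx ltxx in xz.
  by rewrite (le_gtF yz) in zy.
apply: IH => // z /andP[yz zl] zc.
have : z \in [:: x, y & s].
  apply: dense => [|w]; first by rewrite zl andbT ltW // (lt_le_trans xy).
  rewrite inE => /predU1P[->|/zc //].
  by rewrite comparable_sym lt_comparable // (lt_le_trans xy).
by rewrite inE => /predU1P[zx|//]; move: (lt_le_trans xy yz); rewrite zx ltxx.
Qed.

Lemma path_covers_dense x s z : path covers x s -> x <= z <= last x s ->
  {in x :: s, forall w, z >=< w} -> z \in x :: s.
Proof.
elim: s x => [|y s IH] x /=; first by move=> _ /le_anti->; rewrite inE.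
case/andP=> xy ys /andP[xz zl] zc.
have : z >=< y by apply: zc; rewrite !inE eqxx orbT.
rewrite inE; case/orP=> [|yz]; last first.
  by rewrite (IH _ ys) ?orbT ?yz // => w wy; apply: zc; rewrite inE wy orbT.
move: xz; rewrite !le_eqVlt eq_sym => /predU1P[->|xz]; first by rewrite eqxx.
case/predU1P=> [->|zy]; first by rewrite inE eqxx orbT.
by case: (coversN xy xz zy).
Qed.

Lemma maxchain_intervalP x y D : x <= y -> D \in maxchains (closed_interval x y) ->
  exists s, [/\ path covers x s, last x s = y, chain_seq D = x :: s & D = [set z in x :: s]].
Proof.
move=> xy mD; have [ch /subsetP DA _] := maxchainsP _ _ mD.
have in_itv z : z \in D -> x <= z <= y by move/DA; rewrite inE.
have xD : x \in D.
  by apply: maxchain_mem mD _ _; rewrite ?inE ?lexx // => z /in_itv/andP[/le_comparable].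
have yD : y \in D.
  by apply: maxchain_mem mD _ _; rewrite ?inE ?lexx ?xy // => z /in_itv/andP[_ /ge_comparable].
have := chain_seq_sorted ch; have := mem_chain_seq D.
case: (chain_seq D) => [|x' s] memD; first by move: (memD x); rewrite xD.
rewrite /= => ps.
have ex : x' = x.
  have /in_itv/andP[xx' _] : x' \in D by rewrite -memD mem_head.
  have /(mem_path_lt ps)/andP[x'x _] : x \in x' :: s by rewrite memD.
  by apply: le_anti; rewrite x'x.
subst x'; have ey : last x s = y.
  have /in_itv/andP[_ ly] : last x s \in D by rewrite -memD mem_last.
  have /(mem_path_lt ps)/andP[_ yl] : y \in x :: s by rewrite memD.
  by apply: le_anti; rewrite ly.
exists s; split=> //; last by apply/setP=> z; rewrite inE memD.
apply: path_covers_of_dense => // z; rewrite ey => zi zc; rewrite memD.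
by apply: maxchain_mem mD _ _; rewrite ?inE // => w; rewrite -memD; apply: zc.
Qed.

Lemma chain_path x s : path <%O x s -> is_chain [set z in x :: s].
Proof.
move=> ps; apply/is_chainP=> a b; rewrite !in_set.
elim: s x ps => [|y s IH] x /=; first by rewrite !inE => _ /eqP-> /eqP->; apply: comparablexx.
case/andP=> xy ys; rewrite inE => /predU1P[->|ai]; rewrite inE => /predU1P[->|bi].
- exact: comparablexx.
- case/andP: (mem_path_lt ys bi) => yb _; exact/lt_comparable/(lt_le_trans xy).
- rewrite comparable_sym; case/andP: (mem_path_lt ys ai) => ya _.
  exact/lt_comparable/(lt_le_trans xy).
- exact: IH ys ai bi.
Qed.

Lemma path_maxchain x s : path covers x s ->
  [set z in x :: s] \in maxchains (closed_interval x (last x s)).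
Proof.
move=> ps; have ps' := path_covers_lt ps.
apply/maxchainsP; split; first exact: chain_path.
  by apply/subsetP=> z; rewrite in_set => /(mem_path_lt ps'); rewrite inE.
move=> E /is_chainP chE /subsetP Ei /subsetP sE; apply/setP=> z; apply/idP/idP => [zE|/sE //].
rewrite in_set; apply: (path_covers_dense ps); first by have := Ei z zE; rewrite inE.
by move=> w ws; apply: chE => //; apply: sE; rewrite in_set.
Qed.

Section Labels.
Variable lam : T -> T -> nat.

Lemma labels_path x s : path <%O x s -> labels lam [set z in x :: s] = pairmap lam x s.
Proof. by move=> ps; rewrite /labels chain_seqE. Qed.

Lemma EL_path x y : EL_labeling lam -> x <= y ->
  exists s, [/\ path covers x s, last x s = y & sorted leq (pairmap lam x s)].
Proof.
move=> [_ EL] xy; have [D [mD sD _ _]] := EL x y xy.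
have [s [ps ls cs De]] := maxchain_intervalP xy mD.
by exists s; split=> //; move: sD; rewrite De labels_path ?path_covers_lt.
Qed.

Lemma EL_path_uniq x s t : EL_labeling lam ->
  path covers x s -> path covers x t -> last x s = last x t ->
  sorted leq (pairmap lam x s) -> sorted leq (pairmap lam x t) -> s = t.
Proof.
move=> [_ EL] ps pt lst ss st.
have [D [_ _ uD _]] := EL x (last x s) (path_lt_le_last (path_covers_lt ps)).
have ls : sorted leq (labels lam [set z in x :: s]).
  by rewrite labels_path //; apply: path_covers_lt.
have lt : sorted leq (labels lam [set z in x :: t]).
  by rewrite labels_path //; apply: path_covers_lt.
have mt := path_maxchain pt; rewrite -lst in mt.
have e : [set z in x :: s] = [set z in x :: t].
  by apply: (etrans (uD _ (path_maxchain ps) ls)); apply/esym/uD.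
have es' := chain_seqE (path_covers_lt ps : sorted <%O (x :: s)).
have et' := chain_seqE (path_covers_lt pt : sorted <%O (x :: t)).
by move: es'; rewrite e et' => -[].
Qed.

(** A monotone label sequence crosses a threshold once. The relation is a parameter so that
    increasing and decreasing chains are both covered. *)
Lemma path_split (e : rel nat) (P : pred nat) x s : transitive e ->
    (forall m n, e m n -> P n -> P m) -> sorted e (pairmap lam x s) ->
  exists s1 s2, [/\ s = s1 ++ s2, all P (pairmap lam x s1)
     & all (predC P) (pairmap lam (last x s1) s2)].
Proof.
move=> tr init; elim: s x => [|y s IH] x; first by exists [::], [::].
rewrite /= => pl; have [Pxy|nPxy] := boolP (P (lam x y)).
  have [s1 [s2 [-> a1 a2]]] := IH y (path_sorted pl).
  by exists (y :: s1), s2; rewrite /= Pxy.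
exists [::], (y :: s); split=> //=; rewrite nPxy /=.
apply/allP=> m /(allP (order_path_min tr pl)) le_m /=.
by apply: contra nPxy; apply: init.
Qed.

End Labels.
End Chains.

Section Generated.
Context {disp : Order.disp_t} {T : finTBLatticeType disp}.
Implicit Types (x y : T) (A B : {set T}).
Local Open Scope order_scope.

Lemma sub_generated A : A \subset generated A.
Proof. by apply/bigcapsP => B /andP[]. Qed.

Lemma generated_min A B : A \subset B -> is_sublattice B -> generated A \subset B.
Proof. by move=> AB lB; apply: bigcap_inf; rewrite AB. Qed.

Lemma is_sublatticeP A : reflect
  ({in A &, forall x y, x `&` y \in A} /\ {in A &, forall x y, x `|` y \in A}) (is_sublattice A).
Proof.
apply: (iffP forall_inP) => [h|[hI hU] x xA].
  by split=> x y xA yA; have := forall_inP (h x xA) y yA => /andP[].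
by apply/forall_inP => y yA; rewrite hI ?hU.
Qed.

Lemma generated_sublattice A : is_sublattice (generated A).
Proof.
apply/is_sublatticeP; split=> x y /bigcapP xA /bigcapP yA; apply/bigcapP => B hB;
  have := xA B hB; have := yA B hB; case/andP: hB => _ /is_sublatticeP[hI hU] yB xB.
  exact: hI.
exact: hU.
Qed.

Lemma generated_meet A : {in generated A &, forall x y, x `&` y \in generated A}.
Proof. by case/is_sublatticeP: (generated_sublattice A). Qed.

Lemma generated_join A : {in generated A &, forall x y, x `|` y \in generated A}.
Proof. by case/is_sublatticeP: (generated_sublattice A). Qed.

End Generated.

Lemma not_decreasing_split (T : Type) (lam : T -> T -> nat) (x : T) (s : seq T) :
    ~~ sorted gtn (pairmap lam x s) ->
  exists s1 y z s2, s = s1 ++ [:: y, z & s2] /\ lam (last x s1) y <= lam y z.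
Proof.
elim: s x => // y [|z s] IH x //=.
have [yzxy|xyyz _] := ltnP (lam y z) (lam x y); last by exists [::], y, z, s.
by move=> /IH[s1 [y' [z' [s2 [-> le]]]]]; exists (y :: s1), y', z', s2.
Qed.

(** * Descent sets and the order of the ears *)

Section DescentWords.
Variables (r : nat) (S : {pred nat}).
Implicit Types (p q w : 'S_r) (a b : 'I_r).
Hypothesis S_lt : forall n, n \in S -> 0 < n < r.

Lemma has_descent_set_word w : reflect (descends_exactly_on S w) (has_descent_set S (word w)).
Proof.
rewrite /has_descent_set /descents size_word.
have desE a b : w b = (w a).+1 :> nat ->
    (nth 0 (word w) (w b) < nth 0 (word w) (w b).-1) = (b < a).
  by move=> e; rewrite e /= -e !nth_word !permK ltnS.
apply: (iffP eqP) => [e a b ab|desw]; last first.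
  apply: eq_in_filter => k; rewrite mem_iota => /andP[k0 kr].
  have kr' : k < r by lia.
  have kr1 : k.-1 < r by lia.
  pose b := w^-1%g (Ordinal kr'); pose a := w^-1%g (Ordinal kr1).
  have wb : w b = k :> nat by rewrite permKV.
  have wa : w b = (w a).+1 :> nat by rewrite wb permKV /= prednK.
  by rewrite -wb (desw _ _ wa) (desE _ _ wa).
have /(congr1 (fun s : seq nat => (w b : nat) \in s)) := e.
rewrite !mem_filter (desE _ _ ab) mem_iota.
have -> : (0 < w b < 1 + r.-1) by have := ltn_ord (w b); rewrite ab; lia.
by rewrite !andbT.
Qed.

(** Every inversion of p straddles a cut in N, where q has the same prefix. So p is the least word
    with its prefixes at N. *)
Lemma weak_le_shared (N : {pred nat}) p q : ascends_off N p ->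
  (forall n, n \in N -> initial_seg p n = initial_seg q n) -> weak_le p q.
Proof.
move=> asc e a b ab pba.
have [/existsP[m /andP[mN /andP[bm ma]]]|none] :=
    boolP [exists m : 'I_r.+1, ((m : nat) \in N) && (p b < m <= p a)].
  apply: (@leq_trans m).
    by rewrite -mem_initial_seg -e // inE.
  by rewrite leqNgt -mem_initial_seg -e // inE -leqNgt.
suff : b < a by rewrite ltnNge ltnW.
apply: (ascends_off_between asc pba) => m /andP[bm ma]; apply: contra none => mN.
have mr : m < r.+1 by rewrite ltnS (leq_trans ma) // ltnW.
by apply/existsP; exists (Ordinal mr); rewrite /= mN bm.
Qed.

(** Extending the chain of prefixes at S by the natural order gives the least word with the same
    facet. *)
Lemma sort_off p : exists p0, [/\ ascends_off S p0,
  forall n, n \in S -> initial_seg p0 n = initial_seg p n & weak_le p0 p].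
Proof.
have [|p0 [seg0 asc0]] := @chain_extension r [set initial_seg p n | n : 'I_r in cuts r S].
  move=> _ _ /imsetP[m _ ->] /imsetP[n _ ->].
  by case/orP: (leq_total m n) => h; rewrite (initial_seg_mono p h) ?orbT.
have eS n : n \in S -> initial_seg p0 n = initial_seg p n.
  move=> nS; have /andP[_ nr] := S_lt nS.
  have := seg0 (initial_seg p n); rewrite card_initial_seg ?(ltnW nr) // => -> //.
  by apply/imsetP; exists (Ordinal nr); rewrite ?inE.
have asc : ascends_off S p0.
  move=> a b e bS; rewrite ltnNge leq_eqVlt; apply/negP => /orP[/eqP/val_inj ab|ba].
    by move: e; rewrite ab; lia.
  suff : p0 b < p0 a by rewrite e; lia.
  apply: asc0 => // A /imsetP[n nS ->]; rewrite inE in nS; rewrite -eS // !inE e.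
  have : (n : nat) != (p0 b) by apply: contraNneq bS => <-.
  by rewrite e; lia.
by exists p0; split=> //; apply: weak_le_shared asc eS.
Qed.

End DescentWords.

(* [before i j m k] says that (m, k) precedes (i, j). *)
Definition before (i j m k : nat) := (m < i) || (m == i) && (k < j).

Section Pairs.
Variables (N : nat) (f : nat -> nat).
Implicit Types q : nat * nat.

Definition pairs : seq (nat * nat) := [seq (i, j) | i <- iota 0 N, j <- iota 0 (f i)].

Definition pair_lt q q' : bool := before q'.1 q'.2 q.1 q.2.

Lemma pair_lt_irr : irreflexive pair_lt.
Proof. by move=> q; rewrite /pair_lt /before !ltnn andbF. Qed.

Lemma pair_lt_trans : transitive pair_lt.
Proof. by move=> [a b] [i j] [m k]; rewrite /pair_lt /before /=; lia. Qed.

Lemma mem_pairs q : (q \in pairs) = (q.1 < N) && (q.2 < f q.1).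
Proof.
apply/allpairsPdep/andP => [[i [j [iN jf ->]]]|[q1 q2]].
  by move: iN jf; rewrite !mem_iota.
by exists q.1, q.2; rewrite !mem_iota; split=> //; case: q {q1 q2}.
Qed.

Lemma pairs_sorted : pairwise pair_lt pairs.
Proof.
rewrite /pairs; have : pairwise ltn (iota 0 N).
  by rewrite -sorted_pairwise ?iota_ltn_sorted //; apply: ltn_trans.
elim: (iota 0 N) => //= i s IH /andP[/allP si /IH ps].
rewrite pairwise_cat ps andbT; apply/andP; split; last first.
  rewrite pairwise_map; apply: (@sub_pairwise _ ltn).
    by move=> j k /= jk; rewrite /pair_lt /before /= eqxx jk orbT.
  by rewrite -sorted_pairwise ?iota_ltn_sorted //; apply: ltn_trans.
apply/allrelP => _ _ /mapP[j _ ->] /allpairsPdep[m [k [ms _ ->]]].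
have im : i < m := si m ms.
by rewrite /pair_lt /before /= im.
Qed.

End Pairs.

(** * Label sets *)

(* Locked so that [inE] does not unfold it. *)
HB.lock Definition label_set {disp : Order.disp_t} {T : finTBLatticeType disp} (r : nat)
    (lam : T -> T -> nat) (x : T) : {set 'I_r} :=
  [set a : 'I_r | [exists D in maxchains (closed_interval \bot%O x), a.+1 \in labels lam D]].

Section SLabelings.
Context {disp : Order.disp_t} {T : finTBLatticeType disp}.
Implicit Types (x y z : T) (D : {set T}) (s t : seq T).
Local Open Scope order_scope.
Variables (r : nat) (lam : T -> T -> nat).
Hypothesis rank_top : rank (\top : T) = r.
Hypothesis lamP : S_labeling lam r.

Local Notation label_set := (label_set r lam).

Let lam_EL : EL_labeling lam. Proof. by case: lamP. Qed.

Lemma closed_interval_full : closed_interval \bot (\top : T) = [set: T].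
Proof. by apply/setP=> x; rewrite !inE le0x lex1. Qed.

Lemma path_to_top s : path covers \bot s -> last \bot s = \top ->
  [set z in \bot :: s] \in maxchains [set: T].
Proof. by move=> ps ls; rewrite -closed_interval_full -ls path_maxchain. Qed.

Lemma card_path x s : path covers x s -> #|[set z in x :: s]| = (size s).+1.
Proof.
move=> ps; rewrite -size_chain_seq chain_seqE //; exact: (path_covers_lt ps).
Qed.

(** A chain below x together with a saturated chain from x to the top extends to a maximal chain,
    whose size is fixed by gradedness; this bounds every chain below x. *)
Lemma rank_path s : path covers \bot s -> rank (last \bot s) = size s.
Proof.
move=> ps; set x := last _ _; rewrite /rank.
suff -> : \max_(D : {set T} | is_chain D && (D \subset [set z | z <= x])) #|D| = (size s).+1.
  by [].
apply/eqP; rewrite eqn_leq; apply/andP; split; last first.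
  rewrite -(card_path ps).
  apply: (@leq_bigmax_cond _ _ (fun D : {set T} => #|D|)).
  rewrite chain_path ?path_covers_lt //=; apply/subsetP=> z; rewrite !in_set.
  by case/(mem_path_lt (path_covers_lt ps))/andP.
apply/bigmax_leqP => D /andP[chD /subsetP Dx].
have [t [pt lt _]] := EL_path lam_EL (lex1 x).
have [E mE sE] : exists2 E, E \in maxchains [set: T] & D :|: [set z in t] \subset E.
  apply: maxchain_exists; last exact: subsetT.
  have := chain_path (path_covers_lt pt) => /is_chainP cht.
  have lt_t z : z \in t -> x <= z.
    move=> zt; have : z \in x :: t by rewrite inE zt orbT.
    by case/(mem_path_lt (path_covers_lt pt))/andP.
  apply/is_chainP=> a b; rewrite !in_setU !in_set => /orP[aD|aE] /orP[bD|bE].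
  - by move/is_chainP: chD; apply.
  - by have := Dx a aD; rewrite inE => ax; apply/le_comparable/(le_trans ax)/lt_t.
  - by have := Dx b bD; rewrite inE => ax; apply/ge_comparable/(le_trans ax)/lt_t.
  - by apply: cht; rewrite in_set inE ?aE ?bE orbT.
have : #|E| = (size (s ++ t)).+1.
  have pst : path covers \bot (s ++ t) by rewrite cat_path ps.
  rewrite -(card_path pst); case: lam_EL => /forall_inP gr _.
  by apply/eqP/(forall_inP (gr E mE))/path_to_top => //; rewrite last_cat.
rewrite size_cat => cE; rewrite -(leq_add2r (size t)) addSn -cE.
apply: leq_trans (subset_leq_card sE).
have ut : uniq (x :: t).
  by have := path_covers_lt pt; rewrite -[path _ _ _]/(sorted <%O (x :: t)) lt_sorted_uniq_le => /andP[].
rewrite -(card_uniqP (_ : uniq t)); last by case/andP: ut.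
rewrite -[#|t|]cardsE cardsU (_ : D :&: _ = set0) ?cards0 ?subn0 //.
apply/setP=> z; rewrite !inE; apply/negbTE/negP => /andP[/Dx]; rewrite inE => zx zt.
have := path_covers_lt pt; rewrite lt_path_sortedE => /andP[/allP/(_ z zt) xz _].
by move: (lt_le_trans xz zx); rewrite ltxx.
Qed.

Lemma size_full_path s : path covers \bot s -> last \bot s = \top -> size s = r.
Proof. by move=> ps ls; rewrite -rank_top -ls rank_path. Qed.

Lemma label_bound x s : path covers x s -> all (fun m => 1 <= m <= r)%N (pairmap lam x s).
Proof.
have [_ lb _] := lamP.
by elim: s x => //= y s IH x /andP[xy /IH ->]; rewrite lb.
Qed.

Lemma full_path_labels s : path covers \bot s -> last \bot s = \top ->
  uniq (pairmap lam \bot s) /\ forall a : 'I_r, a.+1 \in pairmap lam \bot s.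
Proof.
move=> ps ls; have [_ _ ul] := lamP; have := ul _ (path_to_top ps ls).
rewrite labels_path ?path_covers_lt // => us; split=> // a.
have sub : {subset pairmap lam \bot s <= iota 1 r}.
  by move=> m /(allP (label_bound ps)); rewrite mem_iota add1n ltnS.
have [|_ e] := uniq_min_size us sub; first by rewrite size_iota size_pairmap size_full_path.
by rewrite e mem_iota add1n /= ltnS.
Qed.

(** A full chain carries each label exactly once. Comparing with one fixed chain above the element
    shows that the labels below it do not depend on the chain. *)
Lemma label_complement s t (a : 'I_r) : path covers \bot s -> path covers (last \bot s) t ->
  last (last \bot s) t = \top ->
  (a.+1 \in pairmap lam \bot s) = (a.+1 \notin pairmap lam (last \bot s) t).
Proof.
move=> ps pt lt; have pst : path covers \bot (s ++ t) by rewrite cat_path ps.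
have lst : last \bot (s ++ t) = \top by rewrite last_cat.
have [] := full_path_labels pst lst; rewrite pairmap_cat cat_uniq => /and3P[_ dj _] /(_ a).
rewrite mem_cat; case: (boolP (_ \in pairmap lam _ t)) => [at_ _|_].
  by apply/negbTE; apply: contra dj => as_; apply/hasP; exists a.+1.
by rewrite orbF.
Qed.

Lemma label_set_path s : path covers \bot s ->
  label_set (last \bot s) = [set a : 'I_r | a.+1 \in pairmap lam \bot s].
Proof.
move=> ps; apply/setP=> a; rewrite label_set.unlock !inE; apply/exists_inP/idP => [[D mD]|as_]; last first.
  exists [set z in \bot :: s]; first exact: path_maxchain.
  by rewrite labels_path ?path_covers_lt.
have [s' [ps' ls' _ ->]] := maxchain_intervalP (le0x _) mD.
rewrite labels_path ?path_covers_lt //.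
have [t [pt lt _]] := EL_path lam_EL (lex1 (last \bot s)).
by rewrite (label_complement _ ps pt lt) (label_complement _ ps' (t := t)) ls'.
Qed.

Lemma label_set_cat x s : path covers x s ->
  label_set (last x s) = label_set x :|: [set a : 'I_r | a.+1 \in pairmap lam x s].
Proof.
move=> ps; have [s0 [ps0 ls0 _]] := EL_path lam_EL (le0x x).
subst x; rewrite -last_cat !label_set_path ?cat_path ?ps0 //.
by apply/setP=> a; rewrite pairmap_cat !inE mem_cat.
Qed.

Lemma label_set_notin x s (a : 'I_r) : path covers x s -> a \in label_set x ->
  a.+1 \notin pairmap lam x s.
Proof.
move=> ps; have [s0 [ps0 ls0 _]] := EL_path lam_EL (le0x x); subst x.
have [t [pt lt _]] := EL_path lam_EL (lex1 (last (last \bot s0) s)).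
rewrite label_set_path // inE (label_complement _ ps0 (t := s ++ t)) ?cat_path ?ps ?last_cat //.
by rewrite pairmap_cat mem_cat negb_or => /andP[].
Qed.

Lemma label_set_cover x y : covers x y ->
  exists a : 'I_r, [/\ lam x y = a.+1, a \notin label_set x & label_set y = a |: label_set x].
Proof.
move=> xy; have pxy : path covers x [:: y] by rewrite /= xy.
have := label_bound pxy; rewrite /= andbT => /andP[l0 lr].
have ar : ((lam x y).-1 < r)%N by rewrite prednK.
pose a := Ordinal ar; have ea : lam x y = a.+1 by rewrite prednK.
exists a; split=> //.
  by apply/negP=> /(label_set_notin pxy); rewrite /= ea inE eqxx.
rewrite (label_set_cat pxy) setUC; congr (_ :|: _); apply/setP=> b.
by rewrite !inE ea eqSS.
Qed.

Lemma card_label_set x : #|label_set x| = rank x.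
Proof.
have [s [ps ls _]] := EL_path lam_EL (le0x x); rewrite -ls (rank_path ps).
elim/last_ind: s ps {ls} => [_|s y IH] /=.
  rewrite (@label_set_path [::]) //=; apply/eqP; rewrite cards_eq0.
  by apply/eqP/setP=> a; rewrite !inE.
rewrite rcons_path last_rcons size_rcons => /andP[ps cy].
have [a [_ na ->]] := label_set_cover cy.
by rewrite cardsU1 na IH.
Qed.

Lemma label_set_mono x y : x <= y -> label_set x \subset label_set y.
Proof.
by case/(EL_path lam_EL)=> s [ps <- _]; rewrite (label_set_cat ps) subsetUl.
Qed.

Lemma rank_le x y : x <= y -> (rank x <= rank y)%N.
Proof. by rewrite -!card_label_set => /label_set_mono/subset_leq_card. Qed.

Lemma eq_of_rank x y : x <= y -> (rank y <= rank x)%N -> x = y.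
Proof.
move=> xy; have [[|z s] [ps ls _]] := EL_path lam_EL xy; first by move: ls => /=.
move: ps => /= /andP[xz zs]; have [a [_ na eza]] := label_set_cover xz.
have zy : z <= y by rewrite -ls /=; apply/path_lt_le_last/path_covers_lt.
have := rank_le zy; rewrite -!card_label_set eza cardsU1 na => h1 h2.
by have := leq_trans h1 h2; rewrite ltnn.
Qed.

Lemma eq_of_label_set x y : x <= y -> label_set x = label_set y -> x = y.
Proof. by move=> xy e; apply: eq_of_rank => //; rewrite -!card_label_set e. Qed.

Lemma eq_of_label_sub x y : x <= y -> label_set y \subset label_set x -> x = y.
Proof. by move=> xy /subset_leq_card; rewrite !card_label_set; apply: eq_of_rank. Qed.

Lemma rank_lt x y : x < y -> (rank x < rank y)%N.
Proof.
move=> xy; rewrite ltnNge; apply: contraTN xy => /(eq_of_rank (ltW _)).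
by move=> h; apply/negP => xy; have := h xy => exy; rewrite exy ltxx in xy.
Qed.

Lemma label_set_bot : label_set \bot = set0.
Proof.
by rewrite (@label_set_path [::]) //; apply/setP=> a; rewrite !inE.
Qed.

Lemma label_set_top : label_set \top = setT.
Proof.
by apply/eqP; rewrite eqEcard subsetT cardsT card_ord card_label_set rank_top leqnn.
Qed.

Lemma covers_rank x y : x <= y -> rank y = (rank x).+1 -> covers x y.
Proof.
move=> xy ry; rewrite /covers lt_neqAle xy andbT; apply/andP; split.
  by apply/eqP=> e; move: ry; rewrite e => /eqP; rewrite eqn_leq ltnn andbF.
apply/forallP=> z; apply/negP=> /andP[/rank_lt xz /rank_lt].
by rewrite ry ltnS leqNgt xz.
Qed.

Lemma lam_label x y (a : 'I_r) : covers x y -> a \notin label_set x -> a \in label_set y ->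
  lam x y = a.+1.
Proof.
case/label_set_cover=> b [-> _ ->] na; rewrite in_setU1 (negbTE na) orbF.
by move=> /eqP->.
Qed.

Section Split.
Variables (e : rel nat) (P : pred nat).
Hypotheses (e_trans : transitive e) (P_init : forall m n, e m n -> P n -> P m).

Lemma label_set_split x s : path covers x s -> sorted e (pairmap lam x s) ->
  exists s1 s2, [/\ s = s1 ++ s2, all P (pairmap lam x s1),
     all (predC P) (pairmap lam (last x s1) s2) &
     label_set (last x s1) =
       label_set x :|: (label_set (last x s) :&: [set a : 'I_r | P a.+1])].
Proof.
move=> ps ss; have [s1 [s2 [es a1 a2]]] := path_split e_trans P_init ss.
exists s1, s2; split=> //; move: ps; rewrite es cat_path last_cat => /andP[ps1 ps2].
rewrite (label_set_cat ps2) (label_set_cat ps1); apply/setP=> a; rewrite !inE.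
case: (boolP (a \in label_set x)) => //= ax.
have [as1|as1] /= := boolP (a.+1 \in pairmap lam x s1); first by have := allP a1 _ as1.
by apply/esym/andP => -[/(allP a2)/negP].
Qed.

End Split.

(** The increasing chain of [x, y] is cut where its labels start to exceed k. *)
Lemma label_set_between x y k : x <= y ->
  exists z, [/\ x <= z, z <= y
     & label_set z = label_set x :|: (label_set y :&: lower_labels r k)].
Proof.
move=> xy; have [s [ps ls ss]] := EL_path lam_EL xy.
have init m n : (m <= n -> n <= k -> m <= k)%N by apply: leq_trans.
have [s1 [s2 [es _ _ el]]] :=
  @label_set_split leq [pred m | m <= k]%N leq_trans init x s ps ss.
move: ps ls; rewrite es cat_path last_cat => /andP[ps1 ps2] ls.
exists (last x s1); split.
- exact/path_lt_le_last/path_covers_lt.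
- by rewrite -ls; apply/path_lt_le_last/path_covers_lt.
- by rewrite el es last_cat ls.
Qed.

(** Below such an element all labels are at most k and above it all exceed k, so increasing chains
    on both sides join to an increasing chain of the whole lattice. That chain is unique, and both
    elements are on it at the same rank. *)
Lemma uniq_lower x y k : label_set x = lower_labels r k -> label_set y = lower_labels r k ->
  x = y.
Proof.
suff inc z : label_set z = lower_labels r k -> exists s t,
    [/\ path covers \bot (s ++ t), last \bot (s ++ t) = \top,
        sorted leq (pairmap lam \bot (s ++ t)), last \bot s = z & size s = rank z].
  move=> ex ey; have [s [t [p1 l1 i1 z1 s1]]] := inc x ex.
  have [s' [t' [p2 l2 i2 z2 s2]]] := inc y ey.
  rewrite -z1 -z2; congr (last _ _).
  have e := EL_path_uniq lam_EL p1 p2 (etrans l1 (esym l2)) i1 i2.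
  have es : size s = size s' by rewrite s1 s2 -!card_label_set ex ey.
  by rewrite -[LHS](take_size_cat t erefl) e take_size_cat.
move=> ez; have [s [ps ls ss]] := EL_path lam_EL (le0x z).
have [t [pt lt st]] := EL_path lam_EL (lex1 z).
exists s, t; split=> //.
- by rewrite cat_path ps ls.
- by rewrite last_cat ls.
- rewrite pairmap_cat ls.
  have /allP le_s : all (fun m => m <= k)%N (pairmap lam \bot s).
    apply/allP=> m ms; have /andP[m0 mr] := allP (label_bound ps) m ms.
    have mr' : (m.-1 < r)%N by rewrite prednK.
    have : Ordinal mr' \in label_set z by rewrite -ls label_set_path // inE /= prednK.
    by rewrite ez inE /= prednK.
  have /allP ge_t : all (fun m => k < m)%N (pairmap lam z t).
    apply/allP=> m mt; have /andP[m0 mr] := allP (label_bound pt) m mt.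
    have mr' : (m.-1 < r)%N by rewrite prednK.
    have := @label_set_notin _ _ (Ordinal mr') pt; rewrite /= prednK // mt ez inE /= prednK //.
    by rewrite ltnNge => h; apply/negP => /h.
  rewrite sorted_pairwise ?pairwise_cat; last exact: leq_trans.
  rewrite -!sorted_pairwise ?ss ?st ?andbT; try exact: leq_trans.
  by apply/allrelP => m n /le_s mk /ge_t /ltnW; apply: leq_trans.
- by rewrite -rank_path // ls.
Qed.

Variable c : {set T}.
Hypothesis c_maximal : c \in maxchains [set: T].
Hypothesis c_increasing : sorted leq (labels lam c).

Lemma full_maxchainP D : D \in maxchains [set: T] ->
  exists s, [/\ path covers \bot s, last \bot s = \top & D = [set z in \bot :: s]].
Proof.
rewrite -closed_interval_full => /(maxchain_intervalP (le0x _)).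
by case=> s [? ? _ ?]; exists s.
Qed.

Lemma lower_exists k : exists2 x, x \in c & label_set x = lower_labels r k.
Proof.
have [s [ps ls ec]] := full_maxchainP c_maximal.
move: c_increasing; rewrite ec labels_path ?path_covers_lt // => ss.
have init m n : (m <= n -> n <= k -> m <= k)%N by apply: leq_trans.
have [s1 [s2 [es _ _ el]]] :=
  @label_set_split leq [pred m | m <= k]%N leq_trans init _ s ps ss.
exists (last \bot s1); last by rewrite el ls label_set_top label_set_bot set0U setTI.
rewrite in_set es; apply: (mem_subseq _ (mem_last \bot s1)).
by rewrite /= eqxx prefix_subseq.
Qed.

Lemma upper_exists D k : D \in maxchains [set: T] -> sorted gtn (labels lam D) ->
  exists2 x, x \in D & label_set x = ~: lower_labels r k.
Proof.
move=> /full_maxchainP[s [ps ls ->]]; rewrite labels_path ?path_covers_lt // => ss.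
have tr : transitive gtn by move=> a b d ba ad; apply: ltn_trans ad ba.
have init m n : gtn m n -> (k < n -> k < m)%N by move=> /= nm /ltn_trans->.
have [s1 [s2 [es _ _ el]]] := @label_set_split gtn [pred m | k < m]%N tr init _ s ps ss.
exists (last \bot s1).
  rewrite in_set es; apply: (mem_subseq _ (mem_last \bot s1)).
  by rewrite /= eqxx prefix_subseq.
rewrite el ls label_set_top label_set_bot set0U setTI.
by apply/setP=> a; rewrite !inE ltnS -ltnNge ltnS.
Qed.

Definition low k : T := odflt \bot [pick x in c | label_set x == lower_labels r k].

Lemma lowP k : low k \in c /\ label_set (low k) = lower_labels r k.
Proof.
rewrite /low; case: pickP => [x /andP[xc /eqP] //|none].
by have [x xc /eqP ex] := lower_exists k; have := none x; rewrite /= xc ex.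
Qed.

Lemma low_in k : low k \in c. Proof. by case: (lowP k). Qed.

Lemma label_low k : label_set (low k) = lower_labels r k. Proof. by case: (lowP k). Qed.

(** The increasing chain from x to the top passes, at threshold k, through an element with the
    labels of [low k], hence through [low k] itself. *)
Lemma le_low x k : label_set x \subset lower_labels r k -> x <= low k.
Proof.
move=> xk; have [z [xz _ ez]] := label_set_between k (lex1 x).
rewrite (_ : low k = z) //; apply: (@uniq_lower _ _ k); first exact: label_low.
by rewrite ez label_set_top setTI; apply/setUidPr.
Qed.

Lemma label_meet_low x k : label_set (x `&` low k) = label_set x :&: lower_labels r k.
Proof.
have [z [_ zx ez]] := label_set_between k (le0x x).
rewrite label_set_bot set0U in ez.
have zk : z <= x `&` low k by rewrite lexI zx le_low // ez subsetIr.
apply/eqP; rewrite eqEsubset -{2}ez (label_set_mono zk) andbT subsetI label_set_mono ?leIl //=.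
by rewrite -[lower_labels r k](label_low k) label_set_mono ?leIr.
Qed.

(** The element z of the increasing chain of [x, y] at threshold k has the same meet with [low k] as
    y, because the two meets are comparable with equal labels. So z lies above the join, whose label
    set is at least that of z. *)
Lemma label_join_low x y k : x <= y ->
  label_set (x `|` (low k `&` y)) = label_set x :|: (label_set y :&: lower_labels r k).
Proof.
move=> xy; have [z [xz zy ez]] := label_set_between k xy.
have yz : low k `&` y <= z.
  rewrite meetC; suff <- : z `&` low k = y `&` low k by apply: leIl.
  apply: eq_of_label_set; first exact: leI2.
  rewrite !label_meet_low ez setIUl -setIA setIid; apply/setUidPr.
  by apply/setSI/label_set_mono.
have jz : x `|` (low k `&` y) <= z by rewrite leUx xz.
apply/eqP; rewrite eqEsubset; apply/andP; split; first by rewrite -ez label_set_mono.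
by rewrite subUset label_set_mono ?leUl // -label_meet_low meetC label_set_mono ?leUr.
Qed.

(* Hence the elements of the increasing chain of [x, y] are x \/ (c_k /\ y). *)
Lemma between_eq x y z k : x <= z -> z <= y ->
  label_set z = label_set x :|: (label_set y :&: lower_labels r k) ->
  z = x `|` (low k `&` y).
Proof.
move=> xz zy ez; apply/esym/eq_of_label_set; last by rewrite label_join_low // (le_trans xz).
rewrite leUx xz meetC; suff <- : z `&` low k = y `&` low k by apply: leIl.
apply: eq_of_label_set; first exact: leI2.
rewrite !label_meet_low ez setIUl -setIA setIid; apply/setUidPr.
by apply/setSI/label_set_mono/(le_trans xz).
Qed.

(** * The Boolean sublattices *)

Section Cube.
Implicit Types (A B : {set T}).
Variable D : {set T}.
Hypothesis D_maximal : D \in maxchains [set: T].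
Hypothesis D_decreasing : sorted gtn (labels lam D).
Local Notation L := (generated (D :|: c)).

Lemma chain_label_le A x y : is_chain A -> x \in A -> y \in A ->
  label_set x \subset label_set y -> x <= y.
Proof.
move=> /is_chainP chA xA yA sxy; case/orP: (chA _ _ xA yA) => // yx.
by rewrite (eq_of_label_sub yx sxy).
Qed.

Definition up k : T := odflt \bot [pick x in D | label_set x == ~: lower_labels r k].

Lemma upP k : up k \in D /\ label_set (up k) = ~: lower_labels r k.
Proof.
rewrite /up; case: pickP => [x /andP[xc /eqP] //|none].
have [x xD /eqP ex] := upper_exists k D_maximal D_decreasing.
by have := none x; rewrite /= xD ex.
Qed.

Lemma up_le j k : (j <= k)%N -> up k <= up j.
Proof.
have [[uk ek] [uj ej]] := (upP k, upP j) => jk.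
apply: (@chain_label_le D) => //; first by case/maxchainsP: D_maximal.
rewrite ek ej setCS; apply/subsetP=> a; rewrite !inE => /leq_trans; exact.
Qed.

(** By [label_meet_low] the only label of this element is a. *)
Definition atom (a : 'I_r) : T := low a.+1 `&` up a.

Definition cube (A : {set 'I_r}) : T := \join_(a in A) atom a.

(* Adding the letters in decreasing order, each new atom lies on the increasing
   chain between the part already built and an element of D. *)
Lemma label_cube (A : {set 'I_r}) : label_set (cube A) = A.
Proof.
have [n] := ubnP #|A|; elim: n A => // n IH A An.
have [->|[a0 a0A]] := set_0Vmem A.
  by rewrite /cube big_set0 (label_set_bot).
case: (@arg_minnP _ a0 (mem A) (fun a => a : nat) a0A) => a aA0 min_a.
have {aA0} aA : a \in A := aA0.
have -> : cube A = cube (A :\ a) `|` (low a.+1 `&` up a).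
  rewrite /cube (big_setD1 a) //= joinC; reflexivity.
have le_up : cube (A :\ a) <= up a.
  apply/joinsP => b; rewrite !inE => /andP[ba bA].
  by apply: le_trans (leIr _ _) (up_le _); apply: min_a.
rewrite (label_join_low _ le_up) (upP a).2.
rewrite IH; last by move: An; rewrite (cardsD1 a) aA.
apply/setP=> b; rewrite !inE ltnS -leqNgt -eqn_leq val_eqE.
by rewrite [a == b]eq_sym; case: eqP => [->|_]; rewrite ?aA ?orbT ?orbF.
Qed.

Implicit Types (X Y : {set 'I_r}).

Lemma cubeU X Y : cube (X :|: Y) = cube X `|` cube Y.
Proof. by rewrite /cube; apply: joins_setU. Qed.

Lemma cube_mono X Y : X \subset Y -> cube X <= cube Y.
Proof. by move=> /setUidPr <-; rewrite cubeU leUl. Qed.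

Lemma cube_le X Y : (cube X <= cube Y) = (X \subset Y).
Proof.
by apply/idP/idP => [/(label_set_mono)|/cube_mono //]; rewrite !label_cube.
Qed.

Lemma cube_inj : injective cube.
Proof. by move=> X Y e; rewrite -(label_cube X) e label_cube. Qed.

(** The left side is below the right one, and the label set of the right one lies in both X and Y;
    comparable elements with such labels coincide. *)
Lemma cubeI X Y : cube (X :&: Y) = cube X `&` cube Y.
Proof.
apply: (eq_of_label_sub); first by rewrite lexI !cube_mono ?subsetIl ?subsetIr.
rewrite label_cube subsetI -{2}(label_cube X) -{3}(label_cube Y).
by rewrite !(label_set_mono) ?leIl ?leIr.
Qed.

Lemma card_lower k : (k <= r)%N -> #|lower_labels r k| = k.
Proof.
move=> kr; rewrite -[RHS](card_initial_seg 1%g kr); apply: eq_card => a.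
by rewrite !inE perm1.
Qed.

Lemma chain_rank_eq A x y : is_chain A -> x \in A -> y \in A -> rank x = rank y -> x = y.
Proof.
move=> /is_chainP chA xA yA e; case/orP: (chA _ _ xA yA) => le; [|apply/esym];
  by apply: (eq_of_rank le); rewrite e.
Qed.

Lemma rank_le_r x : (rank x <= r)%N.
Proof. by rewrite -rank_top (rank_le) ?lex1. Qed.

Lemma cube_of_le x : (forall a, a \in label_set x -> atom a <= x) -> x = cube (label_set x).
Proof.
move=> h; apply/esym/(eq_of_label_sub); last by rewrite label_cube.
exact/joinsP.
Qed.

Lemma increasing_cube x : x \in c -> x = cube (label_set x).
Proof.
move=> xc; have ch : is_chain c by case/maxchainsP: c_maximal.
have ex : x = low (rank x).
  apply: (chain_rank_eq ch xc (low_in _)).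
  by rewrite -(card_label_set (low _)) label_low card_lower ?rank_le_r.
apply: cube_of_le => a; rewrite ex label_low inE => ar; apply: le_trans (leIl _ _) _.
apply: (@chain_label_le c); rewrite ?low_in // !label_low.
by apply/subsetP=> b; rewrite !inE => /leq_trans; apply.
Qed.

Lemma decreasing_cube x : x \in D -> x = cube (label_set x).
Proof.
move=> xD; have ch : is_chain D by case/maxchainsP: D_maximal.
have ex : x = up (r - rank x).
  apply: (chain_rank_eq ch xD (upP _).1).
  rewrite -(card_label_set (up _)) (upP _).2 cardsCs setCK card_ord.
  by rewrite card_lower ?leq_subr // subKn ?rank_le_r.
apply: cube_of_le => a; rewrite ex (upP _).2 !inE -leqNgt => ar.
by apply: le_trans (leIr _ _) (up_le ar).
Qed.

(** The elements of [c] and D are cubes and cubes form a sublattice; conversely each atom is the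
    meet of an element of [c] and one of D. *)
Lemma generated_cube : L = [set cube X | X : {set 'I_r}].
Proof.
apply/eqP; rewrite eqEsubset; apply/andP; split.
  apply: generated_min.
    apply/subsetP=> x; rewrite inE => /orP[/decreasing_cube|/increasing_cube] ->; exact: imset_f.
  apply/is_sublatticeP; split=> _ _ /imsetP[X _ ->] /imsetP[Y _ ->].
    by rewrite -cubeI imset_f.
  by rewrite -cubeU imset_f.
apply/subsetP=> _ /imsetP[X _ ->].
have gen x : x \in D :|: c -> x \in L by apply/subsetP/sub_generated.
apply: (big_ind (fun x => x \in L)).
- apply: gen; rewrite inE; apply/orP; right.
  by apply: (maxchain_mem c_maximal); rewrite ?inE // => y _; rewrite le_comparable ?le0x.
- exact: generated_join.
- move=> a _; apply: generated_meet; apply: gen; rewrite inE ?low_in ?orbT //.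
  by rewrite (upP a).1.
Qed.

Lemma mem_cube X : cube X \in L.
Proof. by rewrite generated_cube imset_f. Qed.

Lemma cube_label x : x \in L -> cube (label_set x) = x.
Proof. by rewrite generated_cube => /imsetP[X _ ->]; rewrite label_cube. Qed.

Lemma rank_cube X : rank (cube X) = #|X|.
Proof. by rewrite -(card_label_set) label_cube. Qed.

Definition full_chain (p : 'S_r) : {set T} := [set cube (initial_seg p n) | n : 'I_r.+1].

Lemma full_chainE p : full_chain p = [set x in [seq cube (initial_seg p n) | n <- iota 0 r.+1]].
Proof.
apply/setP=> x; rewrite inE; apply/imsetP/mapP => [[n _ ->]|[n]].
  by exists (n : nat); rewrite // mem_iota /= add0n.
by rewrite mem_iota add0n => /= nr ->; exists (Ordinal nr).
Qed.

Lemma full_chain_sorted p : sorted <%O [seq cube (initial_seg p n) | n <- iota 0 r.+1].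
Proof.
rewrite (@homo_sorted_in _ _ (fun n => n <= r)%N _ ltn) //; last exact: iota_ltn_sorted.
- move=> m n /= mr nr mn; rewrite lt_neqAle cube_le initial_seg_mono ?(ltnW mn) // andbT.
  apply/eqP=> /cube_inj/(congr1 (fun X : {set 'I_r} => #|X|)).
  rewrite !card_initial_seg //; apply/eqP; rewrite neq_ltn mn //.
- by apply/allP=> n; rewrite mem_iota.
Qed.

Lemma chain_seq_full_chain p :
  chain_seq (full_chain p) = [seq cube (initial_seg p n) | n <- iota 0 r.+1].
Proof. by rewrite full_chainE chain_seqE // full_chain_sorted. Qed.

Lemma mem_full_chain p n : cube (initial_seg p n) \in full_chain p.
Proof.
have [nr|rn] := leqP n r; first by apply/imsetP; exists (Ordinal (nr : (n < r.+1)%N)).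
apply/imsetP; exists ord_max => //; congr cube.
by rewrite !initial_seg_top // ltnW.
Qed.

Lemma card_full_chain p : #|full_chain p| = r.+1.
Proof. by rewrite -size_chain_seq chain_seq_full_chain size_map size_iota. Qed.

Lemma full_chain_is_chain p : is_chain (full_chain p).
Proof.
apply/is_chainP=> _ _ /imsetP[m _ ->] /imsetP[n _ ->].
case/orP: (leq_total m n) => mn; [apply: le_comparable | apply: ge_comparable];
  by rewrite cube_le initial_seg_mono.
Qed.

Lemma full_chain_sub p : full_chain p \subset L.
Proof. by apply/subsetP=> _ /imsetP[n _ ->]; apply: mem_cube. Qed.

Lemma nth_full_chain p n : (n <= r)%N ->
  nth \bot (chain_seq (full_chain p)) n = cube (initial_seg p n).
Proof.
by move=> nr; rewrite chain_seq_full_chain (nth_map 0%N) ?size_iota ?nth_iota.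
Qed.

Lemma sub_full_chain E : is_chain E -> E \subset L -> exists p, 
   (forall x, x \in E -> x = cube (initial_seg p (rank x))).
Proof.
move=> /is_chainP chE /subsetP EL.
have [|p [pE _]] := @chain_extension r [set label_set x | x in E].
  move=> _ _ /imsetP[x xE ->] /imsetP[y yE ->].
  by case/orP: (chE _ _ xE yE) => /(label_set_mono) ->; rewrite ?orbT.
exists p => x xE; rewrite -(card_label_set) -pE ?imset_f //.
by rewrite cube_label ?EL.
Qed.

Lemma maxchains_generated E :
  reflect (exists p, E = full_chain p) (E \in maxchains L).
Proof.
apply: (iffP idP) => [mE|[p ->]].
  have [chE EL mx] := maxchainsP _ _ mE; have [p pE] := sub_full_chain chE EL.
  exists p; apply/esym/mx; [exact: full_chain_is_chain | exact: full_chain_sub |].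
  by apply/subsetP=> x /pE->; apply: mem_full_chain.
apply/maxchainsP; split; [exact: full_chain_is_chain | exact: full_chain_sub |].
move=> F chE EL sE; have [q qE] := sub_full_chain chE EL.
apply/eqP; rewrite eq_sym eqEcard sE card_full_chain -(card_full_chain q).
by apply: subset_leq_card; apply/subsetP=> x /qE->; apply: mem_full_chain.
Qed.

Lemma labels_full_chain p : labels lam (full_chain p) = word p.
Proof.
rewrite /labels chain_seq_full_chain -[iota 0 r.+1]/(0%N :: iota 1 r) /=.
apply: (@eq_from_nth _ 0%N) => [|k]; rewrite size_pairmap size_map size_iota.
  by rewrite size_word.
move=> kr; rewrite (nth_pairmap \bot) ?size_map ?size_iota //.
rewrite -[_ :: map _ _]/(map (fun n => cube (initial_seg p n)) (iota 0 r.+1)).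
rewrite !(nth_map 0%N) ?size_iota //; last by rewrite ltnW.
rewrite !nth_iota // ?add0n ?add1n; last by rewrite ltnW.
rewrite (nth_word p (Ordinal kr)).
apply: (lam_label).
- apply: (covers_rank); first by rewrite cube_le initial_seg_mono.
  by rewrite !rank_cube !card_initial_seg // ltnW.
- by rewrite label_cube inE permKV /= ltnn.
- by rewrite label_cube inE permKV /= ltnSn.
Qed.

End Cube.

(** * Every chain lies in a Boolean sublattice *)

Hypothesis mobius_neq0 : forall x y : T, x < y -> mobius x y <> 0%R.
(** With y as only middle element, the Moebius number of [x, z] would be -(1 - 1) = 0. *)
Lemma second_middle x y z : covers x y -> covers y z ->
  exists2 y', y' != y & x < y' < z.
Proof.
move=> xy yz; have [xy' yz'] := (covers_lt xy, covers_lt yz).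
have [/existsP[w /andP[nw mw]]|none] := boolP [exists w, (w != y) && (x < w < z)].
  by exists w.
case: (mobius_neq0 (lt_trans xy' yz')); rewrite mobius_lt ?(lt_trans xy') //.
rewrite (bigD1 x) ?lexx ?(lt_trans xy') //= (bigD1 y) ?(ltW xy') ?yz' ?(gt_eqF xy') //=.
rewrite big1 => [|w /andP[/andP[/andP[xw wz] wx] wy]]; last first.
  move: none; rewrite negb_exists => /forallP/(_ w).
  by rewrite wy wz lt_neqAle eq_sym wx xw.
rewrite addr0 mobiusxx (mobius_lt xy') (bigD1 x) ?lexx //= big1 => [|w].
  by rewrite mobiusxx addr0 subrr oppr0.
case/andP=> /andP[xw wy] wx; case: (coversN xy _ wy).
by rewrite lt_neqAle eq_sym wx.
Qed.

(** At an ascent x < y < z the middle element is replaced by another one, with the two labels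
    exchanged. Repetition ends at a decreasing chain D, and each discarded element is recovered from
    the newer chain and [c]. *)
Lemma exists_decreasing_cover A : A \in maxchains [set: T] ->
  exists D, [/\ D \in maxchains [set: T], sorted gtn (labels lam D)
              & A \subset generated (D :|: c)].
Proof.
move=> mA; have [s [ps ls ->]] := full_maxchainP mA.
(* The sum of [f] along the chain is bounded by [r * M] and rises when the larger label moves down
   to the first step. *)
pose f x := (\sum_(a in label_set x) a)%N; pose M := (\sum_(a < r) a)%N.
have f_le x : (f x <= M)%N.
  by rewrite /f /M [in leqRHS](bigID (mem (label_set x))) leq_addr.
have sum_le t : path covers \bot t -> last \bot t = \top ->
    (\sum_(x <- t) f x <= r * M)%N.
  move=> pt lt; rewrite -(size_full_path pt lt) mulnC -iter_addn_0.
  by rewrite -(count_predT t) -big_const_seq; apply: leq_sum.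
have [n] := ubnP (r * M - \sum_(x <- s) f x)%N.
elim: n s ps ls {A mA} => // n IH s ps ls sn.
have [dec|] := boolP (sorted gtn (pairmap lam \bot s)).
  exists [set z in \bot :: s]; split; first exact: (path_to_top ps ls).
    by rewrite labels_path ?path_covers_lt.
  by apply: subset_trans (sub_generated _); apply: subsetUl.
move=> nd; have [s1 [y [z [s2 [es le_yz]]]]] := not_decreasing_split nd.
subst s; move: {nd} le_yz => le_yz.
set x := last \bot s1 in le_yz.
move: (ps) (ls); rewrite cat_path last_cat /= -/x => /and4P[p1 xy yz p2] l2.
have [a [la na ey]] := label_set_cover xy.
have [b [lb nb ez]] := label_set_cover yz.
have ab : (a < b)%N.
  have ne : b != a by apply: contraNneq nb => ->; rewrite ey setU11.
  by move: le_yz; rewrite la lb ltnS leq_eqVlt val_eqE eq_sym (negbTE ne).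
have [y' ny' /andP[xy' yz']] := second_middle xy yz.
have rz : rank z = (rank x).+2.
  by rewrite -!(card_label_set) ez cardsU1 nb ey cardsU1 na.
have ry' : rank y' = (rank x).+1.
  have := rank_lt xy'; have := rank_lt yz'; rewrite rz.
  by move=> h1 h2; apply/eqP; rewrite eqn_leq h2 -ltnS h1.
have cxy' : covers x y' by apply: (covers_rank); rewrite ?ltW.
have cyz' : covers y' z by apply: (covers_rank); rewrite ?ltW // rz ry'.
have [a' [la' na' ey']] := label_set_cover cxy'.
have [b' [lb' nb' ez']] := label_set_cover cyz'.
(* If y' had the labels a, b in this order, [x, z] would have two increasing chains. *)
have ab' : a' = b.
  have : a' \in label_set z by rewrite ez' ey' !inE eqxx orbT.
  rewrite ez ey !in_setU1 (negbTE na') orbF => /orP[/eqP //|/eqP ea].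
  have eb : b' = b.
    have : b' \in label_set z by rewrite ez' setU11.
    rewrite ez ey !in_setU1 => /or3P[/eqP //|/eqP eb|bx].
      by move: nb'; rewrite ey' ea eb setU11.
    by move: nb'; rewrite ey' in_setU1 bx orbT.
  have [] : [:: y'; z] = [:: y; z] => [|/eqP]; last by rewrite (negbTE ny').
  by apply: (EL_path_uniq (x := x) (lam := lam)) => //=;
    rewrite ?cxy' ?cyz' ?xy ?yz ?la ?lb ?la' ?lb' ?ea ?eb ?andbT ?ltnS ?(ltnW ab) //; case: lamP.
pose s' := s1 ++ [:: y', z & s2].
have ps' : path covers \bot s' by rewrite cat_path p1 /= -/x cxy' cyz'.
have ls' : last \bot s' = \top by rewrite last_cat.
have sum_lt : (\sum_(w <- s1 ++ [:: y, z & s2]) f w < \sum_(w <- s') f w)%N.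
  rewrite !big_cat !big_cons /= ltn_add2l ltn_add2r.
  by rewrite /f ey ey' !big_setU1 // ab' ltn_add2r.
have [|D [mD decD sD]] := IH s' ps' ls'.
  have := sum_le _ ps ls; have := sum_le _ ps' ls'; move: sn sum_lt.
  move: (\sum_(w <- _) _)%N (\sum_(w <- _) _)%N => u v; move: (r * M)%N => m.
  clear; lia.
exists D; split=> //; apply/subsetP=> w; rewrite in_set => ws.
have s'D v : v \in \bot :: s' -> v \in generated (D :|: c).
  by move=> vs; apply: (subsetP sD); rewrite in_set.
have [ws'|] := boolP (w \in \bot :: s'); first exact: s'D.
have -> : (w \in \bot :: s') = (w \in \bot :: s1) || (w \in [:: y', z & s2]).
  by rewrite !inE mem_cat orbA.
move: ws; rewrite inE mem_cat orbA -[(_ == _) || (_ \in s1)]in_cons.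
case: (w \in \bot :: s1) => //=; rewrite !inE.
case: (w == z); rewrite ?orbT //; case: (w \in s2); rewrite ?orbT ?orbF //.
move=> /eqP-> _.
(* The old middle element is on the increasing chain of [x, z], so it is generated by x, z and
   [c]. *)
have -> : y = x `|` (low a.+1 `&` z).
  apply: (between_eq); rewrite ?ltW ?covers_lt //.
  apply/setP=> d; rewrite ez ey !inE ltnS; case: (d \in label_set x); rewrite ?orbT ?orbF //=.
  have [->|da] := eqVneq d a; first by rewrite leqnn orbT.
  by have [->|//] := eqVneq d b; rewrite leqNgt ab.
apply: generated_join.
  apply: s'D; rewrite -[_ :: s']/((\bot :: s1) ++ _) mem_cat mem_last //.
apply: generated_meet.
  by apply: (subsetP (sub_generated _)); rewrite inE (low_in) ?orbT.
by apply: s'D; rewrite !inE mem_cat !inE eqxx !orbT.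
Qed.

Local Close Scope order_scope.

(** * The ears *)

Section Ears.
Variables (R : realType) (S : {pred nat}) (cs : seq {set T}).
Hypothesis S_sub : forall n : nat, n \in S -> 1 <= n <= r.-1.
Hypothesis cs_decreasing : forall D : {set T},
  (D \in cs) = (D \in maxchains [set: T]%SET) && sorted gtn (labels lam D).
Implicit Types (p q w : 'S_r) (a b : 'I_r) (i j k m n : nat) (E F G : {set T}).

Let S_lt n : n \in S -> 0 < n < r.
Proof. by move=> /S_sub; lia. Qed.

Local Notation D_ i := (nth set0 cs i).
Local Notation X i := (@cube (D_ i)).
Local Notation full i := (@full_chain (D_ i)).
Local Notation dc i := (descent_chains lam S c cs i).
Local Notation Lsub2 := (Lsub2 lam S c cs).
Local Notation Eset := (Eset lam S c cs).
Local Notation d := #|cuts r S|.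

Section OneCube.
Variable i : nat.
Hypothesis i_lt : i < size cs.

Lemma D_max : D_ i \in maxchains [set: T].
Proof. by have := mem_nth set0 i_lt; rewrite cs_decreasing => /andP[]. Qed.

Lemma D_dec : sorted gtn (labels lam (D_ i)).
Proof. by have := mem_nth set0 i_lt; rewrite cs_decreasing => /andP[]. Qed.

Lemma XK : cancel (X i) label_set.
Proof. by move=> A; apply: (label_cube D_max D_dec). Qed.

Lemma X_Lsub A : X i A \in Lsub c cs i.
Proof. exact: (mem_cube D_max D_dec). Qed.

Lemma X_label (t : T) : t \in Lsub c cs i -> X i (label_set t) = t.
Proof. exact: (cube_label D_max D_dec). Qed.

Lemma X_low k : X i (lower_labels r k) \in c.
Proof.
have lc := low_in k.
have := increasing_cube D_max D_dec lc.
by rewrite (label_low) => <-.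
Qed.

Lemma XI A B : X i (A :&: B) = (X i A `&` X i B)%O.
Proof. exact: (cubeI D_max D_dec). Qed.

Lemma XU A B : X i (A :|: B) = (X i A `|` X i B)%O.
Proof. exact: cubeU. Qed.

Lemma X_le A B : (X i A <= X i B)%O = (A \subset B).
Proof. exact: (cube_le D_max D_dec). Qed.

Lemma rank_X A : rank (X i A) = #|A|.
Proof. exact: (rank_cube D_max D_dec). Qed.

(** The letter sets on which L_i meets L_m; the interval sets belong because every L_m contains
    [c]. *)
Lemma Lsub_lattice m : set_lattice [set A | X i A \in Lsub c cs m].
Proof.
split=> [A B|A B|k]; rewrite ?inE.
- by rewrite XI; apply: generated_meet.
- by rewrite XU; apply: generated_join.
- by apply: (subsetP (sub_generated _)); rewrite inE X_low orbT.
Qed.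

Lemma mem_dc E : reflect (exists2 w, E = full i w & descends_exactly_on S w) (E \in dc i).
Proof.
rewrite mem_sort mem_enum inE; apply: (iffP andP).
  case=> /(maxchains_generated D_max D_dec)[w ->].
  rewrite (labels_full_chain D_max D_dec).
  by move=> /has_descent_set_word; exists w.
case=> w -> desw; rewrite (labels_full_chain D_max D_dec).
split; last exact/has_descent_set_word.
by apply/(maxchains_generated D_max D_dec); exists w.
Qed.

End OneCube.

Definition W i j : 'S_r := odflt 1%g [pick w | full i w == nth set0 (dc i) j].

Lemma W_full i j : i < size cs -> j < size (dc i) -> nth set0 (dc i) j = full i (W i j).
Proof.
move=> i_lt jlt; have /(mem_dc i_lt)[w ew _] := mem_nth set0 jlt.
by rewrite /W; case: pickP => [v /eqP -> //|/(_ w)]; rewrite -ew eqxx.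
Qed.

Lemma full_inj i : i < size cs -> injective (full i).
Proof.
move=> i_lt p q e; apply: eq_initial_seg => n.
have [nr|rn] := leqP n r; last by rewrite !initial_seg_top // ltnW.
apply: (can_inj (XK i_lt)).
have D_max := D_max i_lt; have D_dec := D_dec i_lt.
have nf := nth_full_chain D_max D_dec.
by rewrite -!nf // e.
Qed.

Lemma W_desc i j : i < size cs -> j < size (dc i) -> descends_exactly_on S (W i j).
Proof.
move=> i_lt jlt; have := mem_nth set0 jlt; rewrite (W_full i_lt jlt).
by case/(mem_dc i_lt) => w /(full_inj i_lt) ->.
Qed.

Lemma W_ex i w : i < size cs -> descends_exactly_on S w ->
  exists2 j, j < size (dc i) & W i j = w.
Proof.
move=> i_lt desw; have mw : full i w \in dc i by apply/(mem_dc i_lt); exists w.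
have jlt : index (full i w) (dc i) < size (dc i) by rewrite index_mem.
exists (index (full i w) (dc i)) => //; apply: (full_inj i_lt).
by rewrite -W_full // nth_index.
Qed.

Lemma W_lt i j k : i < size cs -> j < k -> k < size (dc i) ->
  ~~ ((word (W i k) : seqlexi nat) <= (word (W i j) : seqlexi nat))%O.
Proof.
move=> i_lt jk klt; have jlt := ltn_trans jk klt.
have D_max := D_max i_lt; have D_dec := D_dec i_lt.
apply/negP=> kj; have : lex_le lam (nth set0 (dc i) j) (nth set0 (dc i) k).
  apply: (sorted_leq_nth _ _ set0 (s := dc i)); rewrite ?inE //.
  - by move=> y x z; apply: le_trans.
  - by move=> x; apply: lexx.
  - by apply: sort_sorted => x y; apply: le_total.
  - exact: ltnW.
rewrite /lex_le !W_full // !(labels_full_chain D_max D_dec).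
move=> jk'; have /(@word_inj _) e : word (W i j) = word (W i k).
  by apply/eqP; rewrite (eq_le (word (W i j) : seqlexi nat)) jk' kj.
have : nth set0 (dc i) j = nth set0 (dc i) k by rewrite !W_full // e.
move/eqP; rewrite nth_uniq ?sort_uniq ?enum_uniq //; move: jk; lia.
Qed.

Definition ear_facet i := facet S (X i).

Lemma mem_Cset i j E : i < size cs -> j < size (dc i) ->
  reflect (exists2 p, E = full i p & same_off S (W i j) p) (E \in Cset lam S c cs i j).
Proof.
move=> i_lt jlt; have D_max := D_max i_lt; have D_dec := D_dec i_lt.
have nf := nth_full_chain D_max D_dec.
rewrite inE W_full // rank_top; apply: (iffP andP).
  case=> /(maxchains_generated D_max D_dec)[p ->].
  move=> /allP h; exists p => // n nS; have [nr|rn] := leqP n r; last first.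
    by rewrite !initial_seg_top // ltnW.
  have := h n; rewrite mem_iota (negbTE nS) !nf // => /(_ nr) /eqP.
  by move=> /(can_inj (XK i_lt)).
case=> p -> wp; split.
  by apply/(maxchains_generated D_max D_dec); exists p.
apply/allP=> n; rewrite mem_iota add0n ltnS => /andP[_ nr].
by case: (boolP (n \in S)) => //= nS; rewrite !nf // wp.
Qed.

Lemma mem_Lsub2 i j (t : T) : i < size cs -> j < size (dc i) ->
  reflect (exists p n, [/\ same_off S (W i j) p, n \in S & t = X i (initial_seg p n)])
    (t \in Lsub2 i j).
Proof.
move=> i_lt jlt; rewrite !inE; apply: (iffP andP).
  case=> tS /bigcupP[_ /(mem_Cset _ i_lt jlt)[p -> wp]] /imsetP[n _ et].
  exists p, n; split=> //.
  by move: tS; rewrite et (rank_X i_lt) card_initial_seg // -ltnS.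
case=> p [n [wp nS ->]]; have /andP[_ nr] := S_lt nS.
rewrite (rank_X i_lt) card_initial_seg ?(ltnW nr) //; split=> //.
apply/bigcupP; exists (full i p); first by apply/(mem_Cset _ i_lt jlt); exists p.
exact: mem_full_chain.
Qed.

Lemma facet_is_chain i p : i < size cs -> is_chain (ear_facet i p).
Proof.
move=> i_lt; apply/is_chainP=> _ _ /imsetP[m _ ->] /imsetP[n _ ->].
by case/orP: (leq_total m n) => h; [apply: le_comparable|apply: ge_comparable];
  rewrite X_le // initial_seg_mono.
Qed.

Lemma facet_Lsub2 i j p : i < size cs -> j < size (dc i) -> same_off S (W i j) p ->
  ear_facet i p \subset Lsub2 i j.
Proof.
move=> i_lt jlt wp; apply/subsetP=> _ /imsetP[n nS ->]; rewrite inE in nS.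
by apply/(mem_Lsub2 _ i_lt jlt); exists p, n.
Qed.

(** The elements of F may come from different chains of C_i^j; [verts_chain] threads a single word
    of the class through all of them. *)
Lemma chain_sub_facet i j F : i < size cs -> j < size (dc i) -> is_chain F ->
    F \subset Lsub2 i j ->
  exists2 p, same_off S (W i j) p & F \subset ear_facet i p.
Proof.
move=> i_lt jlt /is_chainP chF /subsetP FL.
have mem (t : T) : t \in F -> exists p n, [/\ same_off S (W i j) p, n \in S & t = X i (initial_seg p n)].
  by move=> /FL /(mem_Lsub2 _ i_lt jlt).
have [||p wp pF] := @verts_chain r S (W i j) [set label_set t | t in F].
- apply/subsetP=> A /imsetP[t /mem[p [n [wp nS et]]] eA]; rewrite eA et (XK i_lt).
  exact: verts_seg.
- move=> A B /imsetP[s sF eA] /imsetP[t tF eB]; rewrite eA eB.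
  by case/orP: (chF _ _ sF tF) => /(label_set_mono)->; rewrite ?orbT.
exists p => //; apply/subsetP=> t tF; have [q [n [wq nS et]]] := mem t tF.
have /andP[_ nr] := S_lt nS.
have -> : t = X i (initial_seg p n); last exact: facetP.
rewrite et; congr (X i _); have := pF (label_set t) (imset_f _ tF).
by rewrite et (XK i_lt) card_initial_seg // ltnW.
Qed.

Lemma maxchains_Lsub2 i j E : i < size cs -> j < size (dc i) ->
  reflect (exists2 p, same_off S (W i j) p & E = ear_facet i p) (E \in maxchains (Lsub2 i j)).
Proof.
move=> i_lt jlt; apply: (iffP idP) => [mE|[p wp ->]].
  have [chE EL mx] := maxchainsP _ _ mE.
  have [p wp Ep] := chain_sub_facet i_lt jlt chE EL.
  by exists p => //; apply/esym/mx => //; [apply: facet_is_chain | apply: facet_Lsub2].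
apply/maxchainsP; split; [exact: facet_is_chain | exact: facet_Lsub2 |] => F chF FL sF.
have [q wq Fq] := chain_sub_facet i_lt jlt chF FL.
apply/eqP; rewrite eq_sym eqEcard sF (card_facet S (XK i_lt)) -(card_facet S (XK i_lt) q).
exact: subset_leq_card.
Qed.

(* The ears, in terms of words: if p does not ascend off S or is a word of an earlier
   L_m, then its facet already lies in a sphere that comes before. *)
Definition ear_perms i j : {pred 'S_r} := [pred p | `[< [/\ same_off S (W i j) p, ascends_off S p
  & forall m, m < i -> ~~ (full i p \subset Lsub c cs m)] >]].

Definition sphere_perms i j : {pred 'S_r} := [pred p | `[< same_off S (W i j) p >]].

Lemma sphere_permsP i j p : reflect (same_off S (W i j) p) (p \in sphere_perms i j).
Proof. exact: asboolP. Qed.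

Lemma ear_permsP i j p : reflect [/\ same_off S (W i j) p, ascends_off S p
  & forall m, m < i -> ~~ (full i p \subset Lsub c cs m)] (p \in ear_perms i j).
Proof. exact: asboolP. Qed.

(** Label sets are intrinsic, so an element shared by two Boolean sublattices has the same letter
    set in both. *)
Lemma full_transfer i m p n : i < size cs -> m < size cs -> full i p \subset Lsub c cs m ->
  X i (initial_seg p n) = X m (initial_seg p n).
Proof.
move=> i_lt m_lt sub; have : X i (initial_seg p n) \in Lsub c cs m.
  by apply: (subsetP sub); apply: mem_full_chain.
by move=> /(X_label m_lt); rewrite (XK i_lt).
Qed.

Lemma full_sub_weak i m p q : i < size cs -> weak_le p q ->
  full i q \subset Lsub c cs m -> full i p \subset Lsub c cs m.
Proof.
move=> i_lt pq sub; apply/subsetP=> _ /imsetP[n _ ->].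
have := set_lattice_weak (Lsub_lattice i_lt m) pq.
move=> h; have {}h := h _ n; rewrite inE in h; apply: h => k; rewrite inE.
by apply: (subsetP sub); apply: mem_full_chain.
Qed.

Lemma full_sub_ascends i m p (N : {pred nat}) : i < size cs -> ascends_off N p ->
  (forall n, n \in N -> X i (initial_seg p n) \in Lsub c cs m) -> full i p \subset Lsub c cs m.
Proof.
move=> i_lt asc NL; apply/subsetP=> _ /imsetP[n _ ->].
have := set_lattice_ascends (Lsub_lattice i_lt m) asc.
move=> h; have {}h := h _ n; rewrite inE in h; apply: h => k kN; rewrite inE.
exact: NL.
Qed.

Lemma facet_seg i p q n : i < size cs -> n \in S -> X i (initial_seg p n) \in ear_facet i q ->
  initial_seg p n = initial_seg q n.
Proof.
move=> i_lt nS; have /andP[_ nr] := S_lt nS.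
by case/(mem_facet (XK i_lt)) => + _; rewrite (XK i_lt) card_initial_seg // ltnW.
Qed.

Lemma maxchain_Lsub i j E : i < size cs -> j < size (dc i) ->
  E \in maxchains (Lsub2 i j) -> E \subset Lsub c cs i.
Proof.
move=> i_lt jlt /(maxchains_Lsub2 _ i_lt jlt)[p _ ->].
by apply/subsetP=> _ /imsetP[n _ ->]; apply: X_Lsub.
Qed.

Lemma facet_in_sphere i m p : i < size cs -> m < size cs -> full i p \subset Lsub c cs m ->
  ascends_off S p -> exists2 k, k < size (dc m) & ear_facet i p \in maxchains (Lsub2 m k).
Proof.
move=> i_lt m_lt sub asc; have [w [desw pw]] := exists_descends_exactly_on asc.
have [k klt ek] := W_ex m_lt desw; exists k => //.
apply/(maxchains_Lsub2 _ m_lt klt); exists p; first by rewrite ek; apply: same_off_sym.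
by apply: eq_imset => n; apply: full_transfer.
Qed.

Lemma mem_Eset i j E : (E \in Eset i j) =
  (E \in maxchains (Lsub2 i j)) &&
    ([forall m : 'I_j, E \notin maxchains (Lsub2 i m)] &&
     [forall m : 'I_i, forall k : 'I_(size (dc m)), E \notin maxchains (Lsub2 m k)]).
Proof. exact: in_set. Qed.

(** The least word with a given facet ascends off S and belongs to the first class of L_i in which
    the facet occurs, as weak order implies lexicographic order of the class representatives. *)
Lemma EsetP i j E : i < size cs -> j < size (dc i) ->
  reflect (exists2 p, p \in ear_perms i j & E = ear_facet i p) (E \in Eset i j).
Proof.
move=> i_lt jlt; rewrite inE; apply: (iffP and3P).
  case=> /(maxchains_Lsub2 _ i_lt jlt)[p wp ->] /forallP h1 /forallP h2.
  have [p0 [asc0 e0 le0]] := sort_off S_lt p.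
  have ef : ear_facet i p = ear_facet i p0.
    by apply: eq_in_imset => n; rewrite inE => nS; rewrite e0.
  have [w0 [desw0 pw0]] := exists_descends_exactly_on asc0.
  have [j0 jlt0 ej0] := W_ex i_lt desw0.
  have jj0 : j <= j0.
    rewrite leqNgt; apply/negP => j0j; have := h1 (Ordinal j0j) => /negP; apply.
    apply/(maxchains_Lsub2 _ i_lt jlt0); exists p0 => //; rewrite ej0; exact: same_off_sym.
  (* The sorted word is weakly below p, so its class representative is not lexicographically
     later. *)
  have j0j : j0 <= j.
    rewrite leqNgt; apply/negP => lt; have /negP := W_lt i_lt lt jlt0; apply.
    rewrite ej0; apply: (word_le_of_weak_le S_lt desw0 (W_desc i_lt jlt) pw0 _ le0).
    exact: same_off_sym.
  have {j0j jj0} ejj : j0 = j by apply/eqP; rewrite eqn_leq j0j.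
  have ep : p = p0.
    apply: (@eq_of_same_off r S); last by move=> n nS; rewrite e0.
    by apply: same_off_trans (same_off_sym wp) _; rewrite -ejj ej0; apply: same_off_sym.
  exists p => //; apply/ear_permsP; split=> // [|m mi]; first by rewrite ep.
  have m_lt := ltn_trans mi i_lt.
  apply/negP=> sub; have asc : ascends_off S p by rewrite ep.
  have [k klt mk] := facet_in_sphere i_lt m_lt sub asc.
  by have /forallP/(_ (Ordinal klt)) := h2 (Ordinal mi); rewrite mk.
case=> p /ear_permsP[wp asc nsub] ->; split.
- by apply/(maxchains_Lsub2 _ i_lt jlt); exists p.
(* A word q of an earlier class with the same facet would be weakly above p, which forces its class
   to come no earlier. *)
- apply/forallP=> m; apply/negP=> mm; have mlt := ltn_trans (ltn_ord m) jlt.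
  have [q wq e] := maxchains_Lsub2 _ i_lt mlt mm.
  have /negP := W_lt i_lt (ltn_ord m) jlt; apply.
  apply: (word_le_of_weak_le S_lt (W_desc i_lt jlt) (W_desc i_lt mlt) (same_off_sym wp) (same_off_sym wq)).
  apply: weak_le_shared asc _ => n nS; apply: (facet_seg i_lt nS).
  by rewrite -e; apply: facetP.
- apply/forallP=> m; apply/forallP=> k; have m_lt := ltn_trans (ltn_ord m) i_lt.
  apply/negP=> mk; case/negP: (nsub m (ltn_ord m)).
  apply: (full_sub_ascends i_lt asc) => n nS.
  by apply: (subsetP (maxchain_Lsub m_lt (ltn_ord k) mk)); apply: facetP.
Qed.

Lemma ear_perms_sphere i j p : p \in ear_perms i j -> p \in sphere_perms i j.
Proof. by case/ear_permsP=> wp _ _; apply/sphere_permsP. Qed.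

Lemma ear_perms_up i j p q : i < size cs -> p \in ear_perms i j -> same_off S (W i j) q ->
  weak_le p q -> q \in ear_perms i j.
Proof.
move=> i_lt /ear_permsP[wp asc nsub] wq pq; apply/ear_permsP; split=> // [|m mi].
  by apply: ascends_off_weak pq asc; apply: same_off_trans wq; apply: same_off_sym.
apply: contra (nsub m mi); exact: full_sub_weak.
Qed.

(** * Faces contained in earlier complexes *)

Definition prior i j (F : {set T}) : Prop := exists m k G,
  [/\ before i j m k, k < size (dc m), G \in maxchains (Lsub2 m k) & F \subset G].

Lemma prior_sub i j F G : prior i j F -> G \subset F -> prior i j G.
Proof.
by case=> m [k [H [b klt HL FH]]] GF; exists m, k, H; split=> //; apply: subset_trans FH.
Qed.

(** If no descent of p at S could be sorted without moving F, then p would ascend off the lengths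
    present in F, and F alone would determine as much as the facet does: either the whole word lies
    in an earlier L_m, or the class of p is lexicographically no later than an earlier one. *)
Lemma ear_descent i j p F : i < size cs -> j < size (dc i) ->
    p \in ear_perms i j -> F \subset ear_facet i p -> prior i j F ->
  exists a b, [/\ p b = (p a).+1 :> nat, (p b : nat) \in S, b < a
     & X i (initial_seg p (p b)) \notin F].
Proof.
move=> i_lt jlt /ear_permsP[wp asc nsub] Fp [m [k [G [mk klt GL FG]]]].
have [/existsP[a /existsP[b /and4P[/eqP e bS ba nF]]]|none] := boolP [exists a, exists b,
    [&& p b == (p a).+1 :> nat, (p b : nat) \in S, b < a & X i (initial_seg p (p b)) \notin F]].
  by exists a, b.
pose N := [pred n | (n \in S) && (X i (initial_seg p n) \in F)].
have ascN : ascends_off N p.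
  move=> a b e; rewrite inE negb_and => /orP[|nF]; first exact: asc.
  have [bS|bS] := boolP ((p b : nat) \in S); last exact: asc.
  rewrite ltnNge leq_eqVlt; apply/negP => /orP[/eqP/val_inj ab|ba].
    by move: e; rewrite ab => /eqP; rewrite (ltn_eqF (ltnSn _)).
  by case/negP: none; apply/existsP; exists a; apply/existsP; exists b; rewrite e eqxx -e bS ba.
have FN n : n \in N -> X i (initial_seg p n) \in G.
  by rewrite inE => /andP[_ nF]; apply: (subsetP FG).
case/orP: mk => [mi|/andP[/eqP mi kj]]; [exfalso|subst m; exfalso].
  have m_lt := ltn_trans mi i_lt; case/negP: (nsub m mi).
  apply: (full_sub_ascends i_lt ascN) => n /FN.
  exact: (subsetP (maxchain_Lsub m_lt klt GL)).
have [q wq e] := maxchains_Lsub2 _ i_lt klt GL.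
have /negP := W_lt i_lt kj jlt; apply.
apply: (word_le_of_weak_le S_lt (W_desc i_lt jlt) (W_desc i_lt klt) (same_off_sym wp) (same_off_sym wq)).
apply: weak_le_shared ascN _ => n nN; have := nN; rewrite inE => /andP[nS _].
by apply: (facet_seg i_lt nS); rewrite -[ear_facet i q]e FN.
Qed.

Lemma prior_sphere i j q : i < size cs -> j < size (dc i) -> q \in sphere_perms i j ->
  q \notin ear_perms i j -> prior i j (ear_facet i q).
Proof.
move=> i_lt jlt /sphere_permsP wq nq.
have mq : ear_facet i q \in maxchains (Lsub2 i j).
  by apply/(maxchains_Lsub2 _ i_lt jlt); exists q.
have : ear_facet i q \notin Eset i j.
  apply/(EsetP _ i_lt jlt) => -[p pP e]; case/negP: nq.
  rewrite (facet_inj S_lt (XK i_lt) _ e) //.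
  by apply: same_off_trans (same_off_sym wq) _; apply/sphere_permsP/ear_perms_sphere.
rewrite mem_Eset 2!negb_and => /or3P[/negP//||].
  rewrite negb_forall => /existsP[k]; rewrite negbK => mk.
  exists i, k, (ear_facet i q); split=> //; first by rewrite /before eqxx ltn_ord orbT.
  exact: ltn_trans jlt.
rewrite negb_forall => /existsP[m]; rewrite negb_forall => /existsP[k]; rewrite negbK => mk.
by exists m, k, (ear_facet i q); split=> //; rewrite /before ltn_ord.
Qed.

Lemma maxchain_first m k G : m < size cs -> k < size (dc m) ->
    G \in maxchains (Lsub2 m k) ->
  exists i j, [/\ i < size cs, j < size (dc i), G \in Eset i j
    & (i < m) || (i == m) && (j <= k)].
Proof.
move=> m_lt klt GL.
pose inL i := [exists j : 'I_(size (dc i)), G \in maxchains (Lsub2 i j)].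
have inLm : inL m by apply/existsP; exists (Ordinal klt).
have exi : exists i, (i < size cs) && inL i by exists m; rewrite m_lt inLm.
case: (ex_minnP exi) => i /andP[i_lt inLi] min_i.
have im : i <= m by apply: min_i; rewrite m_lt inLm.
pose inLj j := (j < size (dc i)) && (G \in maxchains (Lsub2 i j)).
have exj : exists j, inLj j.
  by case/existsP: inLi => j0 Gj0; exists j0; rewrite /inLj ltn_ord.
case: (ex_minnP exj) => j /andP[jlt Gj] min_j.
exists i, j; split=> //.
  rewrite mem_Eset; apply/and3P; split; [exact: Gj | apply/forallP=> l | apply/forallP=> l].
    apply/negP=> Gl; have /min_j : inLj l by rewrite /inLj Gl (ltn_trans (ltn_ord l) jlt).
    by rewrite leqNgt ltn_ord.
  apply/forallP=> q; apply/negP=> Gq.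
  have inLl : inL l by apply/existsP; exists q.
  have /min_i : (l < size cs) && inL l by rewrite (ltn_trans (ltn_ord l) i_lt) inLl.
  by rewrite leqNgt ltn_ord.
move: im; rewrite leq_eqVlt => /orP[/eqP e|->//]; subst m; rewrite eqxx /=.
have /min_j -> : inLj k by apply/andP.
by rewrite orbT.
Qed.

(** A maximal chain of an earlier L_m^k is new in the first L in which it occurs, so the earlier
    ears cover the same faces. *)
Lemma priorP i j F : i < size cs -> prior i j F <-> exists m k,
  [/\ before i j m k, m < size cs, k < size (dc m) & F \in complex_of (Eset m k)].
Proof.
move=> i_lt; split=> [[m [k [G [mk klt GL FG]]]]|[m [k [mk m_lt klt /complex_ofP[G GE FG]]]]].
  have m_lt : m < size cs by case/orP: mk => [/ltn_trans->//|/andP[/eqP-> _]].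
  have [m' [k' [m'_lt k'lt GE le]]] := maxchain_first m_lt klt GL.
  exists m', k'; split=> //; last by apply/complex_ofP; exists G.
  move: mk le; rewrite /before; case: (ltngtP m i) => //= [mi _|-> kj].
    by case/orP=> [h|/andP[/eqP-> _]]; rewrite ?mi // (ltn_trans h mi).
  by case/orP=> [->//|/andP[-> h]]; rewrite (leq_ltn_trans h kj) orbT.
by exists m, k, G; split=> //; move: GE; rewrite inE => /and3P[].
Qed.

Lemma ear_chain i j F : i < size cs -> j < size (dc i) ->
  F \in complex_of (Eset i j) -> F \in order_complex (rank_selected S).
Proof.
move=> i_lt jlt /complex_ofP[_ /(EsetP _ i_lt jlt)[p _ ->] Fp]; rewrite inE.
apply/andP; split; first by apply: is_chain_sub Fp _; apply: facet_is_chain.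
apply: subset_trans Fp _; apply/subsetP=> _ /imsetP[n nS ->].
by rewrite inE (rank_X i_lt) card_initial_seg; [rewrite inE in nS | apply/ltnW/ltn_ord].
Qed.

Lemma chain_facet F : F \in order_complex (rank_selected S) -> exists i j p,
  [/\ i < size cs, j < size (dc i), same_off S (W i j) p & F \subset ear_facet i p].
Proof.
rewrite inE => /andP[chF FS].
have [E mE FE] := maxchain_exists chF (subsetT F).
have [D [mD decD ED]] := exists_decreasing_cover mE.
have Dcs : D \in cs by rewrite cs_decreasing mD.
pose i := index D cs; have i_lt : i < size cs by rewrite index_mem.
have eD : D_ i = D by rewrite nth_index.
have D_max := D_max i_lt; have D_dec := D_dec i_lt.
have FL : F \subset Lsub c cs i by rewrite /Lsub eD; apply: subset_trans FE ED.
have [p pF] := sub_full_chain D_max D_dec chF FL.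
have [p0 [asc0 e0 _]] := sort_off S_lt p.
have [w [desw pw]] := exists_descends_exactly_on asc0.
have [j jlt ej] := W_ex i_lt desw.
exists i, j, p0; split=> //; first by rewrite ej; apply: same_off_sym.
apply/subsetP=> t tF; have : t \in rank_selected S by apply: (subsetP FS).
rewrite inE => tS; rewrite (pF t tF) -e0 //; exact: facetP.
Qed.

Lemma chain_ear F : F \in order_complex (rank_selected S) -> exists i j,
  [/\ i < size cs, j < size (dc i) & F \in complex_of (Eset i j)].
Proof.
case/chain_facet=> m [k [p [m_lt klt wp Fp]]].
have mL : ear_facet m p \in maxchains (Lsub2 m k).
  by apply/(maxchains_Lsub2 _ m_lt klt); exists p.
have [i [j [i_lt jlt GE _]]] := maxchain_first m_lt klt mL.
by exists i, j; split=> //; apply/complex_ofP; exists (ear_facet m p).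
Qed.

Lemma cs_neq0 : 0 < size cs.
Proof.
(* Even the empty chain has to lie in some Boolean sublattice, so a decreasing chain exists. *)
have [|i [j [p [i_lt _ _ _]]]] := @chain_facet set0; last exact: leq_ltn_trans i_lt.
rewrite inE sub0set andbT; apply/is_chainP=> x y; rewrite inE //.
Qed.

Lemma dc_neq0 i : i < size cs -> 0 < size (dc i).
Proof.
move=> i_lt; have asc1 : ascends_off S (1%g : 'S_r).
  by move=> a b; rewrite !perm1 => -> _.
have [w [desw _]] := exists_descends_exactly_on asc1.
by have [j jlt _] := W_ex i_lt desw; apply: leq_ltn_trans jlt.
Qed.

Lemma dim1_order_complex : dim1 (order_complex (rank_selected S : {set T})) = #|cuts r S|.
Proof.
apply/eqP; rewrite eqn_leq; apply/andP; split.
  apply/bigmax_leqP=> F /chain_facet[i [j [p [i_lt _ _ Fp]]]].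
  by rewrite -(card_facet S (XK i_lt) p); apply: subset_leq_card.
have i_lt := cs_neq0; have jlt := dc_neq0 i_lt.
rewrite -(card_facet S (XK i_lt) (W 0 0)).
apply: (@leq_bigmax_cond _ _ (fun F : {set T} => #|F|)).
rewrite inE facet_is_chain //=; apply/subsetP=> _ /imsetP[n nS ->].
by rewrite inE (rank_X i_lt) card_initial_seg; [rewrite inE in nS | apply/ltnW/ltn_ord].
Qed.

Lemma Eset_facets i j : i < size cs -> j < size (dc i) ->
  Eset i j = [set ear_facet i p | p in ear_perms i j].
Proof.
move=> i_lt jlt; apply/setP=> E; apply/(EsetP _ i_lt jlt)/imsetP => -[p pP ->]; by exists p.
Qed.

Lemma Eset_first : Eset 0 0 = [set ear_facet 0 p | p in sphere_perms 0 0].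
Proof.
have i_lt := cs_neq0; have jlt := dc_neq0 i_lt.
apply/setP=> E; rewrite inE.
have -> : [forall m : 'I_0, E \notin maxchains (Lsub2 0 m)] by apply/forallP=> -[].
have -> : [forall m : 'I_0, forall p : 'I_(size (dc m)), E \notin maxchains (Lsub2 m p)].
  by apply/forallP=> -[].
rewrite !andbT; apply/(maxchains_Lsub2 _ i_lt jlt)/imsetP => [[p wp ->]|[p /sphere_permsP wp ->]];
  by exists p => //; apply/sphere_permsP.
Qed.

Lemma sphere_complex i j : i < size cs -> polytope_boundary R d
  (complex_of [set facet S (X i) p | p in sphere_perms i j]).
Proof.
move=> i_lt.
have XiK := XK i_lt.
have [/existsP[n nS]|none] := boolP [exists n : 'I_r, (n : nat) \in S].
  by apply: (sphere_boundary R S_lt (w := W i j) _ (sphere_permsP _ _) XiK); exists (n : nat).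
(* For empty S every facet is empty, and the sphere is the boundary of a point. *)
have cuts0 : cuts r S = set0.
  by apply/setP=> n; rewrite !inE; apply: contraNF none => nS; apply/existsP; exists n.
have facet0 p : facet S (X i) p = set0 by rewrite /facet cuts0 imset0.
rewrite cuts0 cards0 (_ : complex_of _ = [set set0]); first exact: point_boundary.
apply/setP=> F; rewrite in_set1; apply/complex_ofP/eqP => [[_ /imsetP[p _ ->]]|->].
  by rewrite facet0 subset0 => /eqP.
exists set0 => //; apply/imsetP; exists (W i j); [exact/sphere_permsP | by rewrite facet0].
Qed.

(** * A nonempty ear after the first *)

Section LaterEar.
Variables i j : nat.
Hypotheses (i_lt : i < size cs) (j_lt : j < size (dc i)).
Hypothesis later : before i j 0 0.
Hypothesis ear_neq0 : Eset i j != set0.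

Let XiK := XK i_lt.

Let EsetE : Eset i j = [set facet S (X i) p | p in ear_perms i j].
Proof. exact: (Eset_facets i_lt j_lt). Qed.

Lemma perms_neq0 : exists p, p \in ear_perms i j.
Proof. by case/set0Pn: ear_neq0 => E; rewrite EsetE => /imsetP[p pP _]; exists p. Qed.

Lemma perms_off p : p \in ear_perms i j -> same_off S (W i j) p.
Proof. by case/ear_permsP. Qed.

Lemma prior_set0 : prior i j set0.
Proof.
have c0 := cs_neq0; have d0 := dc_neq0 c0.
exists 0, 0, (facet S (X 0) (W 0 0)); split=> //; last exact: sub0set.
apply/(maxchains_Lsub2 _ c0 d0).
by exists (W 0 0).
Qed.

(** The empty face already lies in the first sphere, so [ear_descent] applies to it and yields a
    descent of p at S. *)
Lemma perms_descent p : p \in ear_perms i j ->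
  exists a b, [/\ p b = (p a).+1 :> nat, (p b : nat) \in S & (b < a)%N].
Proof.
move=> pP; have [a [b [e bS ba _]]] := ear_descent i_lt j_lt pP (sub0set _) prior_set0.
by exists a, b.
Qed.

Lemma S_neq0 : exists n, n \in S.
Proof. by have [p /perms_descent[a [b [_ bS _]]]] := perms_neq0; exists (p b : nat). Qed.

Lemma perms_up p q : p \in ear_perms i j -> same_off S (W i j) q -> weak_le p q ->
  q \in ear_perms i j.
Proof. exact: (ear_perms_up i_lt). Qed.

Lemma later_ball : simplicial_ball R (complex_of (Eset i j)).
Proof.
rewrite EsetE.
exact: (Ball.facets_ball R S_lt S_neq0 (W_desc i_lt j_lt) perms_off perms_up perms_neq0 perms_descent XiK).
Qed.

Lemma later_dim1 : dim1 (complex_of (Eset i j)) = d.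
Proof. by rewrite EsetE; apply: (dim1_facets S perms_neq0 XiK). Qed.

(** A word of maximal weight in the class has no descent at S left to sort, so it is not a word of
    the ear and its facet is missing. *)
Lemma later_proper : proper_in_polytope_boundary R d (complex_of (Eset i j)).
Proof.
have w0 : W i j \in sphere_perms i j by apply/sphere_permsP.
case: (@arg_maxnP _ (W i j) (mem (sphere_perms i j)) (fun p => \sum_(x < r) (x * p x)%N) w0) => q qQ max_q.
rewrite EsetE; apply: (facets_proper R S_lt S_neq0 (w := W i j) (sphere_permsP _ _)
  (@ear_perms_sphere _ _) XiK qQ).
apply/negP=> qP; have [a [b [e bS ba]]] := perms_descent qP.
have sQ : swap a b q \in sphere_perms i j.
  apply/sphere_permsP; apply: same_off_trans (swap_same_off e bS); exact: perms_off.
by have /= := leq_trans (swap_weight e ba) (max_q _ sQ); rewrite ltnn.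
Qed.

Lemma later_bdry (earlier : {set {set T}}) :
  (forall F, F \in earlier <-> prior i j F) ->
  earlier :&: complex_of (Eset i j) = bdry (complex_of (Eset i j)).
Proof.
move=> eP; rewrite EsetE.
apply: (facets_bdry S_lt (w := W i j) (sphere_permsP _ _)
  (@ear_perms_sphere _ _) perms_neq0 XiK).
- by move=> F G /eP FP GF; apply/eP; apply: prior_sub FP GF.
- by move=> q qQ qP; apply/eP; apply: prior_sphere.
- by move=> p F pP Fp /eP FP; apply: ear_descent FP.
Qed.

End LaterEar.

(** * Assembly of the sequence after deletion of the empty ears *)

Lemma ears_decomposition : convex_ear_decomposition R (order_complex (rank_selected S))
  [seq X <- ears lam S c cs | X != set0].
Proof.
pose f i := size (dc i); pose F (u : nat * nat) := complex_of (Eset u.1 u.2).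
have -> : ears lam S c cs = [seq F u | u <- pairs (size cs) f] by rewrite map_allpairs.
rewrite filter_map; pose Q := [seq u <- pairs (size cs) f | F u != set0].
rewrite -/Q; pose nthQ := nth (0, 0) Q.
have Qsorted : pairwise pair_lt Q by apply: pairwise_filter; apply: pairs_sorted.
have memQ u : (u \in Q) = [&& u.1 < size cs, u.2 < f u.1 & F u != set0].
  by rewrite mem_filter mem_pairs andbC -andbA.
have lt_index k l : k < size Q -> l < size Q -> pair_lt (nthQ k) (nthQ l) = (k < l).
  move=> kQ lQ; have up m n : m < n -> n < size Q -> pair_lt (nthQ m) (nthQ n).
    by move=> mn nQ; apply: (pairwiseP (0, 0) Qsorted); rewrite // inE (ltn_trans mn).
  case: ltngtP => [kl|lk|->]; [exact: up | | exact: pair_lt_irr].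
  by apply/negP => /(pair_lt_trans (up _ _ lk kQ)); rewrite pair_lt_irr.
have nthF k : k < size Q -> nth set0 [seq F u | u <- Q] k = F (nthQ k) by apply: nth_map.
have nthP k : k < size Q -> [/\ (nthQ k).1 < size cs, (nthQ k).2 < f (nthQ k).1 & F (nthQ k) != set0].
  by move=> /(mem_nth (0, 0)); rewrite memQ => /and3P.
have inQ G i j : i < size cs -> j < f i -> G \in F (i, j) ->
    exists k, [/\ k < size Q, nthQ k = (i, j) & G \in nth set0 [seq F u | u <- Q] k].
  move=> i_lt j_lt GF; have ijQ : (i, j) \in Q.
    by rewrite memQ i_lt j_lt; apply/set0Pn; exists G.
  have e : nthQ (index (i, j) Q) = (i, j) by apply: nth_index.
  have kQ : index (i, j) Q < size Q by rewrite index_mem.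
  by exists (index (i, j) Q); split; [exact: kQ | exact: e | rewrite (nthF _ kQ) e; exact: GF].
have cs0 := cs_neq0; have dc0 := dc_neq0 cs0; have E00 := Eset_first.
have [k0 [k0Q ek0 _]] : exists k, [/\ k < size Q, nthQ k = (0, 0)
    & facet S (X 0) (W 0 0) \in nth set0 [seq F u | u <- Q] k].
  apply: inQ; [exact: cs0 | exact: dc0 | rewrite /F /= E00].
  by apply: mem_complex_of; apply: imset_f; apply/sphere_permsP.
have Q_gt0 : 0 < size Q by apply: leq_ltn_trans k0Q.
(* The pair (0, 0) survives the deletion, its ear being a whole sphere, and no pair precedes it. *)
have Q0 : nthQ 0 = (0, 0).
  have := lt_index 0 k0 Q_gt0 k0Q; rewrite ek0 /pair_lt /before /= !ltn0 andbF.
  by case: (posnP k0) ek0 => [->|].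
(* Deleted ears are empty and contribute no face, so the union over smaller positions is still what
   [prior] describes. *)
have unionQ k (G : {set T}) : k < size Q ->
    G \in \bigcup_(j < k) nth set0 [seq F u | u <- Q] j <-> prior (nthQ k).1 (nthQ k).2 G.
  move=> kQ; have [i_lt j_lt _] := nthP k kQ.
  rewrite priorP //; split=> [/bigcupP[j _]|[m [l [lt m_lt l_lt GE]]]].
    have jQ := ltn_trans (ltn_ord j) kQ; rewrite (nthF _ jQ) => GF.
    have [m_lt l_lt _] := nthP j jQ; exists (nthQ j).1, (nthQ j).2; split=> //.
    exact: etrans (lt_index j k jQ kQ) (ltn_ord j).
  have [n [nQ en Gn]] := inQ G m l m_lt l_lt GE.
  have nk : n < k by rewrite -lt_index // en.
  by apply/bigcupP; exists (Ordinal nk); [ | exact: Gn].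
have later k : 0 < k < size Q -> [/\ (nthQ k).1 < size cs, (nthQ k).2 < f (nthQ k).1,
    before (nthQ k).1 (nthQ k).2 0 0, Eset (nthQ k).1 (nthQ k).2 != set0
    & nth set0 [seq F u | u <- Q] k = complex_of (Eset (nthQ k).1 (nthQ k).2)].
  case/andP=> k_gt0 kQ; have [i_lt j_lt nE] := nthP k kQ.
  split; [exact: i_lt | exact: j_lt | | by rewrite -complex_of_eq0 | exact: nthF].
  by have := lt_index 0 k Q_gt0 kQ; rewrite k_gt0 Q0.
rewrite /convex_ear_decomposition size_map dim1_order_complex; split.
- split=> [|_ /mapP[u + ->]]; first exact: Q_gt0.
  rewrite memQ => /and3P[i_lt j_lt q0]; split; last first.
    by apply/subsetP => G; exact: (ear_chain i_lt j_lt).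
  by apply: complex_of_is_complex; rewrite -complex_of_eq0.
- apply/setP=> G; apply/bigcupP/idP => [[k _]|/chain_ear[i [j [i_lt j_lt GE]]]].
    have kQ := ltn_ord k; have [i_lt j_lt _] := nthP k kQ; rewrite (nthF _ kQ); exact: (ear_chain i_lt j_lt).
  have [k [kQ _ Gk]] := inQ G i j i_lt j_lt GE.
  by exists (Ordinal kQ); [ | exact: Gk].
- split=> [|k /later[i_lt j_lt lt nE ->]].
    by rewrite (nthF _ Q_gt0) Q0 /F /= E00; exact: (sphere_complex 0 cs0).
  by split; [exact: (later_dim1 i_lt j_lt nE) | exact: (later_proper i_lt j_lt lt nE)].
- by move=> k /later[i_lt j_lt lt nE ->]; exact: (later_ball i_lt j_lt lt nE).
- move=> k kQ; have [i_lt j_lt lt nE ->] := later k kQ.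
  by apply: (later_bdry i_lt j_lt nE) => G; apply: unionQ; case/andP: kQ.
Qed.

End Ears.
End SLabelings.

From mathcomp Require Import all_classical all_reals all_analysis.

Theorem theorem5p1 (R : realType) (disp : Order.disp_t)
    (T : finTBLatticeType disp) (r : nat) (S : {pred nat})
    (lam : T -> T -> nat) (c : {set T}) (cs : seq {set T})
    (T_supersolvable : supersolvable T)
    (T_rank : rank (\top%O : T) = r)
    (mobius_neq0 : forall x y : T, (x < y)%O -> mobius x y <> 0%R)
    (S_sub : forall n : nat, n \in S -> 1 <= n <= r.-1)
    (lam_S_labeling : S_labeling lam r)
    (c_maximal : c \in maxchains [set: T]%SET)
    (c_increasing : sorted leq (labels lam c))
    (cs_uniq : uniq cs)
    (cs_decreasing : forall D : {set T},
       (D \in cs) = (D \in maxchains [set: T]%SET) && sorted gtn (labels lam D)) :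
  convex_ear_decomposition R (order_complex (rank_selected S))
    [seq X <- ears lam S c cs | X != finset.set0].
Proof.
exact: (ears_decomposition T_rank lam_S_labeling c_maximal c_increasing mobius_neq0 R S_sub
  cs_decreasing).
Qed.
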